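(* Let $\Gamma=\Gamma_1*\Gamma_2$ be the free product of $\Gamma_1=\mathbb{Z}^3$ and $\Gamma_2=\mathbb{Z}^d$, with $d\in\{5,6\}$. For $i=1,2$, let $\mu_i$ be a finitely supported, admissible and symmetric probability measure on $\Gamma_i$. For $\alpha\in[0,1]$, let $\mu_\alpha=\alpha\mu_1+(1-\alpha)\mu_2$, a probability measure on $\Gamma$. Then there exists $\alpha_*\in(0,1)$ such that the random walk on $\Gamma$ driven by $\mu_{\alpha_*}$ is divergent and not spectrally positive recurrent.
   Context: A probability measure $\mu$ on a group $\Gamma$ is symmetric if $\mu(x)=\mu(x^{-1})$ for all $x$, and admissible if for every $x\in\Gamma$ there is $n$ with $\mu^{*n}(x)>0$, where $\mu^{*n}$ is the $n$th convolution power. The measures $\mu_1,\mu_2$ are viewed as measures on $\Gamma$ via the inclusions $\Gamma_i\subset\Gamma$. The Green function is $G(x,y|r)=\sum_{n\ge 0}\mu^{*n}(x^{-1}y)r^n$, and $G(r)=G(e,e|r)$. Its radius of convergence $R$ does not depend on $x,y$ for admissible $\mu$, and is the inverse of the spectral radius $\limsup_n \mu^{*n}(e)^{1/n}$. The random walk driven by $\mu$ is divergent if $G'(R)=\sum_{n\ge1} n\mu^{*n}(e)R^{n-1}=+\infty$; equivalently $\sum_{x\in\Gamma}G(e,x|R)G(x,e|R)=+\infty$. For $\Gamma=\Gamma_1*\Gamma_2$ and $i=1,2$, set $$I_i^{(2)}(r)=\sum_{x_1,x_2\in\Gamma_i}G(e,x_1|r)G(x_1,x_2|r)G(x_2,e|r),\qquad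 J^{(2)}(r)=I_1^{(2)}(r)+I_2^{(2)}(r).$$ The random walk is spectrally positive recurrent if it is divergent and $J^{(2)}(R)<\infty$. *)

(* Defs.v *)
From HB Require Import structures.
From mathcomp Require Import all_boot all_order all_algebra.
From mathcomp Require Import all_classical all_reals all_analysis.

Set Implicit Arguments.
Unset Strict Implicit.
Unset Printing Implicit Defensive.

Import Order.TTheory GRing.Theory Num.Theory.

Section FreeProduct.
Local Open Scope group_scope.
Variables G H : groupType.

Definition is_left (a : G + H) : bool := if a is inl _ then true else false.

Definition nontrivial (a : G + H) : bool :=
  match a with inl x => x != 1 | inr y => y != 1 end.

Definition reduced (w : seq (G + H)) : bool :=
  all nontrivial w && sorted (fun a b => is_left a != is_left b) w.

(* The free product G * H, realised as the set of reduced words: finite words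
   of nontrivial letters, alternately in G and in H. *)
Record free_prod := FreeProd { word : seq (G + H); _ : reduced word }.
HB.instance Definition _ := [isSub for word].
HB.instance Definition _ := [Choice of free_prod by <:].

(* Left multiplication of a reduced word by one letter, with reduction. *)
Definition lcons (a : G + H) (w : seq (G + H)) : seq (G + H) :=
  if ~~ nontrivial a then w else
  match a, w with
  | inl x, inl y :: w' => if x * y == 1 then w' else inl (x * y) :: w'
  | inr x, inr y :: w' => if x * y == 1 then w' else inr (x * y) :: w'
  | _, _ => a :: w
  end.

Definition linv (a : G + H) : G + H :=
  match a with inl x => inl x^-1 | inr y => inr y^-1 end.

Definition mulw (s t : seq (G + H)) := foldr lcons t s.
Definition invw (s : seq (G + H)) := rev [seq linv a | a <- s].

Lemma reduced_cons a w : reduced (a :: w) =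
  [&& nontrivial a, (if w is b :: _ then is_left a != is_left b else true)
    & reduced w].
Proof.
rewrite /reduced /=; case: w => [|b w] /=; first by rewrite !andbT.
by case: nontrivial; case: nontrivial; case: (_ != _); case: all.
Qed.

Lemma reduced_lcons a w : reduced w -> reduced (lcons a w).
Proof.
rewrite /lcons; case: ifPn => // /negPn na.
case: a na => x na; case: w => [|[y|y] w] //= rw; do 1?[by rewrite reduced_cons na];
  move: rw; rewrite reduced_cons => /and3P[ny sw rw]; case: ifPn => // nxy;
  by rewrite reduced_cons; apply/and3P; split=> //; case: (w) sw.
Qed.

Lemma reduced_mulw s t : reduced t -> reduced (mulw s t).
Proof. by move=> rt; elim: s => //= a s IHs; apply: reduced_lcons. Qed.

Lemma lconsM w : reduced w ->
  (forall x y, lcons (inl x) (lcons (inl y) w) = lcons (inl (x * y)) w) /\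
  (forall x y, lcons (inr x) (lcons (inr y) w) = lcons (inr (x * y)) w).
Proof.
rewrite /lcons => rw; split=> x y /=.
all: have [->|nx] := eqVneq x 1; first by rewrite mul1g.
all: have [->|ny] := eqVneq y 1; first by rewrite mulg1 nx.
all: have [xy1|nxy] := eqVneq (x * y) 1 => /=.
all: case: w rw => [|[z|z] w] //= rw; rewrite ?xy1 ?(negPf nxy) ?eqxx//.
all: move: rw; rewrite reduced_cons => /and3P[/= nz sw rw].
all: have [yz|nyz] := eqVneq (y * z) 1; rewrite /= ?mulgA ?xy1 ?mul1g ?(negPf nz)//.
1,3: have -> : x = z by rewrite -[z]mul1g -xy1 -mulgA yz mulg1.
3,4: rewrite -mulgA yz mulg1 (negPf nx).
all: by case: w sw {rw} => [|[t|t] w].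
Qed.

Lemma lcons1 a w : ~~ nontrivial a -> lcons a w = w.
Proof. by rewrite /lcons => ->. Qed.

Lemma mulw_lcons a w u : reduced w -> reduced u ->
  mulw (lcons a w) u = lcons a (mulw w u).
Proof.
move=> rw ru; have [na|ta] := boolP (nontrivial a); last by rewrite !lcons1.
rewrite {1}/lcons na /=; case: a na => x nx; case: w rw => [|[y|y] w] //= rw.
all: have [lM rM] := lconsM (reduced_mulw w ru).
all: by rewrite ?lM ?rM; case: ifPn => //= xy; rewrite lcons1 //= negbK.
Qed.

Lemma mulwA s t u : reduced t -> reduced u ->
  mulw s (mulw t u) = mulw (mulw s t) u.
Proof.
by move=> rt ru; elim: s => //= a s IHs; rewrite mulw_lcons ?reduced_mulw// IHs.
Qed.

Lemma mulw1 s : reduced s -> mulw s [::] = s.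
Proof.
elim: s => //= a s IHs; rewrite reduced_cons => /and3P[na sa rs].
by rewrite IHs// /lcons na; case: a s sa {na IHs rs} => [x|x] [|[y|y] s].
Qed.

Lemma nontrivial_linv a : nontrivial (linv a) = nontrivial a.
Proof. by case: a => x /=; rewrite invg_eq1. Qed.

Lemma reduced_invw s : reduced s -> reduced (invw s).
Proof.
rewrite /reduced /invw all_rev rev_sorted all_map sorted_map => /andP[an ss].
apply/andP; split; first by apply: sub_all an => a; rewrite /= nontrivial_linv.
by apply: sub_sorted ss => -[x|x] [y|y].
Qed.

Lemma invwK : involutive invw.
Proof.
move=> s; rewrite /invw map_rev revK -map_comp map_id_in// => -[x|x] _ /=;
by rewrite invgK.
Qed.

Lemma mulVw s : reduced s -> mulw (invw s) s = [::].
Proof.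
elim: s => //= a s IHs; rewrite reduced_cons => /and3P[na _ rs].
rewrite /mulw /invw /= rev_cons foldr_rcons.
suff -> : lcons (linv a) (a :: s) = s by exact: IHs.
by rewrite /lcons nontrivial_linv na; case: a {na} => x /=; rewrite mulVg eqxx.
Qed.

Definition fp_mul (s t : free_prod) : free_prod :=
  FreeProd (reduced_mulw (word s) (valP t)).
Definition fp_one : free_prod := FreeProd (erefl : reduced [::]).
Definition fp_inv (s : free_prod) : free_prod := FreeProd (reduced_invw (valP s)).

Lemma fp_mulA : associative fp_mul.
Proof. by move=> s t u; apply/val_inj/mulwA; exact: valP. Qed.
Lemma fp_mul1 : left_id fp_one fp_mul.
Proof. by move=> s; apply/val_inj. Qed.
Lemma fp_mulr1 : right_id fp_one fp_mul.
Proof. by move=> s; apply/val_inj/mulw1/valP. Qed.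
Lemma fp_mulV : left_inverse fp_one fp_inv fp_mul.
Proof. by move=> s; apply/val_inj/mulVw/valP. Qed.
Lemma fp_mulrV : right_inverse fp_one fp_inv fp_mul.
Proof.
by move=> s; have /= := fp_mulV (fp_inv s);
  rewrite (_ : fp_inv (fp_inv s) = s)//; apply/val_inj/invwK.
Qed.

HB.instance Definition _ := isGroup.Build free_prod
  fp_mulA fp_mul1 fp_mulr1 fp_mulV fp_mulrV.

Definition fp_inl (x : G) : free_prod :=
  FreeProd (reduced_lcons (inl x) (erefl : reduced [::])).
Definition fp_inr (y : H) : free_prod :=
  FreeProd (reduced_lcons (inr y) (erefl : reduced [::])).

Lemma fp_inlM : {morph fp_inl : x y / x * y}.
Proof.
move=> x y; apply/val_inj => /=; rewrite mulw_lcons ?reduced_lcons//.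
by rewrite (proj1 (lconsM (erefl : reduced [::]))).
Qed.

Lemma fp_inrM : {morph fp_inr : x y / x * y}.
Proof.
move=> x y; apply/val_inj => /=; rewrite mulw_lcons ?reduced_lcons//.
by rewrite (proj2 (lconsM (erefl : reduced [::]))).
Qed.

HB.instance Definition _ := isMultiplicative.Build _ _ fp_inl fp_inlM.
HB.instance Definition _ := isMultiplicative.Build _ _ fp_inr fp_inrM.

Lemma fp_inl_inj : injective fp_inl.
Proof.
move=> x y /(congr1 val); rewrite /= /lcons /=.
by have [->|_] := eqVneq x 1; have [->|_] := eqVneq y 1 => //= -[].
Qed.

Lemma fp_inr_inj : injective fp_inr.
Proof.
move=> x y /(congr1 val); rewrite /= /lcons /=.
by have [->|_] := eqVneq x 1; have [->|_] := eqVneq y 1 => //= -[].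
Qed.

End FreeProduct.

(* The group Z^d, written multiplicatively. *)
Definition Zpow (d : nat) := Algebra.to_multiplicative 'rV[int]_d.
HB.instance Definition _ (d : nat) := Group.on (Zpow d).

Local Open Scope classical_set_scope.
Local Open Scope ring_scope.
Local Open Scope ereal_scope.

(* A measure on a countable group is identified with its mass function. *)
Section RandomWalk.
Variables (R : realType) (G : groupType).
Implicit Types (mu : G -> R) (r : R) (x y : G).

Definition is_probability mu : Prop :=
  (forall x, (0 <= mu x)%R) /\ \esum_(x in [set: G]) (mu x)%:E = 1.

Definition finitely_supported mu : Prop := finite_set [set x | mu x != 0%R].

Definition is_symmetric mu : Prop := forall x, mu x = mu x^-1%g.

Definition convolution (f g : G -> \bar R) : G -> \bar R :=
  fun y => \esum_(x in [set: G]) (f x * g (x^-1 * y)%g).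

Fixpoint conv_pow mu (n : nat) : G -> \bar R :=
  if n is m.+1 then convolution (EFin \o mu) (conv_pow mu m)
  else fun x => if x == 1%g then 1 else 0.

Definition admissible mu : Prop := forall x, exists n, 0 < conv_pow mu n x.

Definition green mu r x y : \bar R :=
  \sum_(0 <= n <oo) (conv_pow mu n (x^-1 * y)%g * (r ^+ n)%:E).

(* The radius of convergence of [green mu r 1 1] as a power series in r. For a
   symmetric probability mass function mu the supremum is over a bounded set,
   as [conv_pow mu 2 1 > 0], so it may be taken in R. *)
Definition green_radius mu : R :=
  sup [set r | (0 <= r)%R /\ green mu r 1%g 1%g < +oo].

Definition green_derivative mu r : \bar R :=
  \sum_(1 <= n <oo) (n%:R%:E * conv_pow mu n 1%g * (r ^+ n.-1)%:E).

Definition divergent mu : Prop := green_derivative mu (green_radius mu) = +oo.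

Definition I2 mu (A : set G) r : \bar R :=
  \esum_(x in A `*` A)
    (green mu r 1%g x.1 * green mu r x.1 x.2 * green mu r x.2 1%g).

End RandomWalk.

Section FreeProductWalk.
Variables (R : realType) (G1 G2 : groupType).

(* The image of the measure mu under an injective map f; the finitely supported
   sum requires the fibres of f to be finite. *)
Definition push_mass (K G : groupType) (f : K -> G) (mu : K -> R) : G -> R :=
  fun y => (\sum_(x \in f @^-1` [set y]) mu x)%R.

Definition mix (alpha : R) (mu1 : G1 -> R) (mu2 : G2 -> R) :
    free_prod G1 G2 -> R :=
  fun g => (alpha * push_mass (@fp_inl G1 G2) mu1 g
            + (1 - alpha) * push_mass (@fp_inr G1 G2) mu2 g)%R.

Definition J2 (mu : free_prod G1 G2 -> R) (r : R) : \bar R :=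
  I2 mu (range (@fp_inl G1 G2)) r + I2 mu (range (@fp_inr G1 G2)) r.

Definition spectrally_positive_recurrent (mu : free_prod G1 G2 -> R) : Prop :=
  divergent mu /\ J2 mu (green_radius mu) < +oo.

End FreeProductWalk.

(* Main.v *)
(** For a finitely supported walk write [A] for the transition operator, [U(s)]
for the generating function of the first return time and [F(x|s)] for that of
the first visit, so that [s A F = F] off the identity, with value [U(s)] there.
On the free product let [f] be the product over the letters of a word of the
[F_i(.|s_i)].  If [alpha (1 - U_1(s_1)) / s_1 = (1 - alpha) (1 - U_2(s_2)) / s_2
= 1 / t] and [1 / r = alpha / s_1 + (1 - alpha) / s_2 - 1 / t], then
[f = (r / t) delta + r A f].  Hence [G(e, w | r) <= Phi f(w)] with
[Phi = t / r = 1 / (1 - U_1(s_1)) + 1 / (1 - U_2(s_2)) - 1], with equality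
whenever [r] is below the [r] of a larger pair of parameters.

On Z^3 the first return time has infinite mean, on Z^d (d = 5, 6) it has a finite
mean but [sum n^2 p_n] diverges.  With [W = 1 - U + s U'] one can therefore choose
[sb < 1] such that [1 / W_1(sb) + 1 / W_2(1) = 1], and then [alpha] such that
[(sb, 1)] is admissible.  At this point [dr / dt] vanishes while [dG / dt] does
not, so [G'] is infinite at the corresponding [rb], which is thus the radius of
convergence; and since [s_2 = 1] there, the double sum over Z^d of products of
three Green functions dominates a multiple of [sum n^2 p_n], which is infinite. *)

Require Import Defs.
From HB Require Import structures.
From mathcomp Require Import all_boot all_order all_algebra.
From mathcomp Require Import all_classical all_reals all_analysis.
From mathcomp Require Import ring lra zify.

Set Implicit Arguments.
Unset Strict Implicit.
Unset Printing Implicit Defensive.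

Import Order.TTheory GRing.Theory Num.Theory numFieldNormedType.Exports.

(** The dimensions enter through return probabilities of order n^(-d/2) at even times: sum n p_n
    diverges for d <= 4 and converges for d >= 5, sum n^2 p_n diverges for d <= 6. No local limit
    theorem is used: upper bounds come from comparing a power of mu with products of coin tosses,
    lower bounds from Chebyshev and Cauchy-Schwarz.

    The condition on W is dr/dt = 0: since r = t / Phi, dr/dt = (Phi - t Phi') / Phi^2, and Phi - t
    Phi' = 1 / W_1 + 1 / W_2 - 1. It is solvable because W_2(1) is finite and above 1, while W_1
    takes every value above 1 on (0, 1).

    At the endpoint s_2 = 1 only one-sided estimates are at hand. So r and Phi are never
    differentiated: secant slopes of U_1 and U_2 replace derivatives, the formulas for dr and dPhi
    become exact secant identities, and endpoint limits go through polynomial truncations. At rb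
    itself f could contain a part h with h = rb A h, so Green functions there are reached from
    smaller r. *)

Section NonnegSeries.
Local Open Scope ring_scope.
Local Open Scope classical_set_scope.
Variable R : realType.
Implicit Types (a b : nat -> R) (M : R).

(** [limn] is total, so this is the sum only when [series a] converges, which is carried as a
    separate hypothesis. Sums stay in R to remain within reach of [ring] and [lra]. *)
Definition rsum a : R := limn (series a).

Lemma seriesE a n : series a n = \sum_(k < n) a k.
Proof. by rewrite /series /= big_mkord. Qed.

Lemma nonneg_series_homo a : (forall k, 0 <= a k) ->
  {homo series a : n m / (n <= m)%N >-> n <= m}.
Proof. by move=> a0; apply: nondecreasing_series. Qed.

Lemma nonneg_series_cvg a M : (forall k, 0 <= a k) ->
  (forall N, \sum_(k < N) a k <= M) -> cvgn (series a).
Proof.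
move=> a0 aM; apply: nondecreasing_is_cvgn; first exact: nonneg_series_homo.
by exists M => _ [N _ <-]; rewrite seriesE.
Qed.

Lemma rsum_cvg a : cvgn (series a) -> (\sum_(k < N) a k) @[N --> \oo] --> rsum a.
Proof. by move=> ca; under eq_fun do rewrite -seriesE; exact: ca. Qed.

Lemma rsum_ge a N : (forall k, 0 <= a k) -> cvgn (series a) ->
  \sum_(k < N) a k <= rsum a.
Proof.
move=> a0 ca; rewrite -seriesE; apply: nondecreasing_cvgn_le => //.
exact: nonneg_series_homo.
Qed.

Lemma rsum_le a M : cvgn (series a) -> (forall N, \sum_(k < N) a k <= M) ->
  rsum a <= M.
Proof.
move=> ca aM; apply: limr_le => //; apply: nearW => N.
by rewrite seriesE.
Qed.

Lemma rsum_ge0 a : (forall k, 0 <= a k) -> cvgn (series a) -> 0 <= rsum a.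
Proof. by move=> a0 ca; have := @rsum_ge a 0 a0 ca; rewrite big_ord0. Qed.

Lemma le_rsum a b : cvgn (series a) -> cvgn (series b) ->
  (forall k, a k <= b k) -> rsum a <= rsum b.
Proof. exact: lim_series_le. Qed.

Lemma dominated_series_cvg a b : (forall k, 0 <= a k) -> (forall k, a k <= b k) ->
  cvgn (series b) -> cvgn (series a).
Proof.
move=> a0 ab cb; apply: (@nonneg_series_cvg _ (rsum b)) => // N.
apply: le_trans (rsum_ge N _ cb) => [|k]; last exact: le_trans (ab k).
by apply: ler_sum => i _.
Qed.

Lemma rsumB a b : cvgn (series a) -> cvgn (series b) ->
  rsum (fun k => a k - b k) = rsum a - rsum b.
Proof. by move=> ca cb; rewrite /rsum -lim_seriesB. Qed.

Lemma rsumZ a M : cvgn (series a) -> rsum (fun k => M * a k) = M * rsum a.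
Proof. by move=> ca; exact: (lim_seriesZ M ca). Qed.

Lemma nneseries_rsum a : (forall k, 0 <= a k) -> cvgn (series a) ->
  (\sum_(0 <= k <oo) (a k)%:E = (rsum a)%:E)%E.
Proof.
move=> a0 ca; rewrite /rsum -EFin_lim//; congr (limn _).
by apply/funext => n /=; rewrite /series /= sumEFin.
Qed.

Lemma nneseries_fin_cvg a : (forall k, 0 <= a k) ->
  (\sum_(0 <= k <oo) (a k)%:E < +oo)%E -> cvgn (series a).
Proof. by move=> a0; exact: nnseries_is_cvg. Qed.

End NonnegSeries.

(** * Convolution powers as iterates of an operator on real functions *)

Section Walk.
Local Open Scope ring_scope.
Local Open Scope classical_set_scope.
Variables (R : realType) (G : groupType) (mu : G -> R) (S : seq G).
Implicit Types (f g : G -> R) (x y : G).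

(** Left convolution by mu, written over a finite list that will contain the support. It commutes
    with right translations, and on a free product it acts at the front of a word. *)
Definition step f x : R := \sum_(y <- S) mu y * f (y^-1 * x)%g.
Definition dirac1 x : R := (x == 1%g)%:R.
Definition mass n : G -> R := iter n step dirac1.

Hypothesis mu_ge0 : forall x, 0 <= mu x.

Lemma le_step f g : (forall x, f x <= g x) -> forall x, step f x <= step g x.
Proof. by move=> fg x; apply: ler_sum => y _; apply: ler_wpM2l. Qed.

Lemma le_iter_step n f g : (forall x, f x <= g x) ->
  forall x, iter n step f x <= iter n step g x.
Proof. by move=> fg; elim: n => //= n IHn; apply: le_step. Qed.

Lemma stepD f g : step (fun x => f x + g x) = fun x => step f x + step g x.
Proof.
by apply/funext => x; rewrite /step -big_split; apply: eq_bigr => y _; rewrite mulrDr.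
Qed.

Lemma stepZ c f : step (fun x => c * f x) = fun x => c * step f x.
Proof.
by apply/funext => x; rewrite /step mulr_sumr; apply: eq_bigr => y _; rewrite mulrCA.
Qed.

Lemma iter_stepD n f g : iter n step (fun x => f x + g x) =
  fun x => iter n step f x + iter n step g x.
Proof. by elim: n => //= n ->; rewrite stepD. Qed.

Lemma iter_stepZ n c f : iter n step (fun x => c * f x) = fun x => c * iter n step f x.
Proof. by elim: n => //= n ->; rewrite stepZ. Qed.

Lemma iter_step0 n : iter n step (fun=> 0) = fun=> 0.
Proof.
by elim: n => //= n ->; apply/funext => x; rewrite /step big1// => y _; rewrite mulr0.
Qed.

Lemma iter_step_ge0 n f : (forall x, 0 <= f x) -> forall x, 0 <= iter n step f x.
Proof. by move=> f0 x; rewrite -(congr1 (fun h => h x) (iter_step0 n)) le_iter_step. Qed.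

Lemma step_sum I (r : seq I) (F : I -> G -> R) :
  step (fun x => \sum_(i <- r) F i x) = fun x => \sum_(i <- r) step (F i) x.
Proof.
apply/funext => x; rewrite /step exchange_big; apply: eq_bigr => y _ /=.
by rewrite mulr_sumr.
Qed.

Lemma iter_step_sum n I (r : seq I) (F : I -> G -> R) :
  iter n step (fun x => \sum_(i <- r) F i x) = fun x => \sum_(i <- r) iter n step (F i) x.
Proof. by elim: n => //= n ->; rewrite step_sum. Qed.

Lemma iter_step_translate n f z :
  iter n step (fun x => f (x * z)%g) = fun x => iter n step f (x * z)%g.
Proof.
elim: n => //= n ->; apply/funext => x; apply: eq_bigr => y _.
by rewrite mulgA.
Qed.

Lemma dirac1_ge0 x : 0 <= dirac1 x.
Proof. exact: ler0n. Qed.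

Lemma mass_ge0 n x : 0 <= mass n x.
Proof. exact/iter_step_ge0/dirac1_ge0. Qed.

Hypothesis S_uniq : uniq S.
Hypothesis S_supp : forall x, x \notin S -> mu x = 0.

Lemma esum_supp (f : G -> R) : (forall x, 0 <= f x) ->
  (forall x, x \notin S -> f x = 0) ->
  (\esum_(x in [set: G]) (f x)%:E = (\sum_(x <- S) f x)%:E)%E.
Proof.
move=> f0 fS.
transitivity (\esum_(x in [set` S]) (f x)%:E)%E.
  rewrite [RHS]esum_mkcond; apply: eq_esum => x _.
  by case: ifPn => // xS; rewrite fS//; apply/negP => h; case/negP: xS; rewrite inE.
rewrite esum_fset; [|exact: finite_seq|by move=> x _; rewrite lee_fin].
by rewrite -fsbig_seq// sumEFin.
Qed.

Lemma mu_mass1 x : mass 1 x = mu x.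
Proof.
rewrite /mass /= /step; have [xS|xS] := boolP (x \in S).
  rewrite (bigD1_seq x)//= mulVg /dirac1 eqxx mulr1 big1 ?addr0// => y yx.
  by rewrite (_ : _ == _ = false) ?mulr0//; apply/negP => /eqP h; case/eqP: yx;
    rewrite -[y]mulg1 -h mulgA mulgV mul1g.
rewrite big_seq big1 ?S_supp// => y yS.
rewrite /dirac1 (_ : _ == _ = false) ?mulr0//; apply/negP => /eqP h.
by case/negP: xS; rewrite (_ : x = y)// -[y]mulg1 -h mulgA mulgV mul1g.
Qed.

Lemma conv_pow_mass n x : conv_pow mu n x = (mass n x)%:E.
Proof.
elim: n x => [|n IHn] x; first by rewrite /= /mass /= /dirac1; case: ifP.
rewrite [conv_pow _ _]/= /convolution.
under eq_esum => y _ do rewrite IHn /= -EFinM.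
rewrite esum_supp// => y; first by rewrite mulr_ge0// mass_ge0.
by move=> /S_supp ->; rewrite mul0r.
Qed.

Lemma green_mass r x y :
  green mu r x y = (\sum_(0 <= n <oo) (mass n (x^-1 * y)%g * r ^+ n)%:E)%E.
Proof. by apply: eq_eseriesr => n _; rewrite conv_pow_mass EFinM. Qed.

Lemma green_derivative_mass r :
  green_derivative mu r = (\sum_(0 <= n <oo) (n%:R * mass n 1%g * r ^+ n.-1)%:E)%E.
Proof.
rewrite /green_derivative.
under eq_eseriesr => n _ do rewrite conv_pow_mass -!EFinM.
(* Both ranges become conditions on an index running over all n; the extra term n = 0 carries the
   factor 0. *)
rewrite [RHS](eseries_cond _ predT) [LHS](eseries_cond _ predT).
rewrite [in RHS]eseries_mkcond [in LHS]eseries_mkcond.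
by apply: eq_eseriesr => -[|n] _ //=; rewrite !mul0r.
Qed.

(** The equation for f is substituted into itself N times. The remainder is kept exact: its sign
    bounds Green sums from above, and its decay turns these bounds into equalities. *)
Lemma mass_expand c r f N : (forall x, f x = c * dirac1 x + r * step f x) ->
  forall x, f x = c * (\sum_(n < N) mass n x * r ^+ n) + r ^+ N * iter N step f x.
Proof.
move=> fE; elim: N => [|N IHN] x; first by rewrite big_ord0 mulr0 add0r mul1r.
have E : iter N step f x = c * mass N x + r * iter N.+1 step f x.
  by rewrite {1}(funext fE) iter_stepD !iter_stepZ -iterSr.
by rewrite IHN big_ord_recr exprS E; move: (iter N.+1 _ _ _) => I1 /=; ring.
Qed.

End Walk.

Arguments dirac1 {R G} x.

(** * Endpoint limits and mean value inequalities for powers *)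

Section PowerSums.
Local Open Scope ring_scope.
Local Open Scope classical_set_scope.
Variable R : realType.
Implicit Types (a : nat -> R) (s t c : R).

(* By left continuity of polynomials. *)
Lemma polysum_le_left N a (e : nat -> nat) s0 t c : s0 < t ->
  (forall s, s0 < s < t -> \sum_(k < N) a k * s ^+ e k <= c) ->
  \sum_(k < N) a k * t ^+ e k <= c.
Proof.
move=> s0t H; pose p := \sum_(k < N) a k *: 'X^(e k) : {poly R}.
have pE s : p.[s] = \sum_(k < N) a k * s ^+ e k.
  by rewrite /p horner_sum; apply: eq_bigr => k _; rewrite hornerZ hornerXn.
have cp : horner p x @[x --> t^'-] --> p.[t].
  by apply: cvg_at_left_filter; exact: continuous_horner.
rewrite -pE -(cvg_lim _ cp)//; apply: limr_le; first by apply/cvg_ex; exists p.[t].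
near=> s; rewrite pE; apply: H; apply/andP; split; near: s.
  exact: nbhs_left_gt.
exact: nbhs_left_lt.
Unshelve. all: by end_near. Qed.

(** In (t^n - s^n) / (t - s) = sum t^(n-1-i) s^i each of the n terms is at least s^(n-1), and at
    most t^(n-1) in the companion bound. Together they replace termwise differentiation. The
    truncated [n.-1] is harmless at n = 0, where the factor n vanishes. *)
Lemma expr_diff_ge n s t : 0 <= s -> s <= t ->
  n%:R * s ^+ n.-1 * (t - s) <= t ^+ n - s ^+ n.
Proof.
move=> s0 st; rewrite subrXX mulrC ler_wpM2l ?subr_ge0//.
rewrite mulr_natl -[X in _ *+ X]card_ord -sumr_const; apply: ler_sum => i _.
rewrite -{1}(subnK (_ : (i <= n.-1)%N)); last by case: n i => [[]|n i]//; rewrite -ltnS.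
rewrite exprD ler_wpM2r ?exprn_ge0// lerXn2r// nnegrE//; exact: le_trans st.
Qed.

Lemma expr_diff_le n s t : 0 <= s -> s <= t ->
  t ^+ n - s ^+ n <= n%:R * t ^+ n.-1 * (t - s).
Proof.
move=> s0 st; have t0 : 0 <= t by exact: le_trans st.
rewrite subrXX mulrC ler_wpM2r ?subr_ge0//.
rewrite mulr_natl -[X in _ *+ X]card_ord -sumr_const; apply: ler_sum => i _.
rewrite -{2}(subnK (_ : (i <= n.-1)%N)); last by case: n i => [[]|n i]//; rewrite -ltnS.
by rewrite exprD ler_wpM2l ?exprn_ge0// lerXn2r.
Qed.

Lemma expr01_le1 n s : 0 <= s <= 1 -> s ^+ n <= 1.
Proof. by move=> /andP[s0 s1]; rewrite exprn_ile1. Qed.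

End PowerSums.

(** * First passage *)

Section FirstPassage.
Local Open Scope ring_scope.
Local Open Scope classical_set_scope.
Variables (R : realType) (G : groupType) (mu : G -> R) (S : seq G).
Implicit Types (f g : G -> R) (x y : G) (s : R).

Local Notation A := (step mu S).
Local Notation p := (mass mu S).

(** The value at the identity is erased before convolving, so that iterates only count paths that
    have not yet visited it. *)
Definition taboo f := A (fun x => (x != 1%g)%:R * f x).

(* The probability that the walk from x first visits 1 at time k.+1. *)
Definition hit k : G -> R := iter k taboo (A dirac1).
Definition hitsum s x : R := rsum (fun k => hit k x * s ^+ k.+1).
Definition Fgen s x : R := if x == 1%g then 1 else hitsum s x.
Definition Ugen s : R := hitsum s 1%g.

Variable M : R.
Hypothesis mu_ge0 : forall x, 0 <= mu x.
Hypothesis mu_sum1 : \sum_(y <- S) mu y = 1.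
Hypothesis transient : forall N x, \sum_(n < N) p n x <= M.

Lemma taboo_ge0 f : (forall x, 0 <= f x) -> forall x, 0 <= taboo f x.
Proof.
by move=> f0 x; apply: sumr_ge0 => y _; rewrite !mulr_ge0// ler0n.
Qed.

Lemma hit_ge0 k x : 0 <= hit k x.
Proof.
by elim: k x => [|k IHk] x; [exact: (mass_ge0 _ mu_ge0 1)|exact: taboo_ge0].
Qed.

Lemma hit_le_mass k x : hit k x <= p k.+1 x.
Proof.
elim: k x => // k IHk x; apply: le_step => // y.
case: (_ != _); rewrite ?mul1r// mul0r; exact: (mass_ge0 S mu_ge0 k.+1 y).
Qed.

Lemma hit_bounded N x : \sum_(k < N) hit k x <= M.
Proof.
apply: le_trans (transient N.+1 x); rewrite big_ord_recl -[leLHS]add0r.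
by apply: lerD; [exact: mass_ge0|apply: ler_sum => i _; exact: hit_le_mass].
Qed.

Lemma transient_ge1 : 1 <= M.
Proof.
apply: le_trans (transient 1 1%g); rewrite big_ord_recl big_ord0 addr0.
by rewrite /mass /= /dirac1 eqxx.
Qed.

Lemma hit_term_ge0 s x k : 0 <= s -> 0 <= hit k x * s ^+ k.+1.
Proof. by move=> s0; rewrite mulr_ge0 ?exprn_ge0 ?hit_ge0. Qed.

Lemma hit_term_le s x k : 0 <= s <= 1 -> hit k x * s ^+ k.+1 <= hit k x.
Proof. by move=> s01; rewrite ler_piMr ?hit_ge0// expr01_le1. Qed.

Lemma hit_cvg s x : 0 <= s <= 1 -> cvgn (series (fun k => hit k x * s ^+ k.+1)).
Proof.
move=> s01; apply: (@nonneg_series_cvg _ _ M) => [k|N].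
  by apply: hit_term_ge0; case/andP: s01.
by apply: le_trans (hit_bounded N x); apply: ler_sum => i _; exact: hit_term_le.
Qed.

Lemma hitsum_ge0 s x : 0 <= s <= 1 -> 0 <= hitsum s x.
Proof.
move=> s01; apply: rsum_ge0; last exact: hit_cvg.
by move=> k; apply: hit_term_ge0; case/andP: s01.
Qed.

Lemma hitsum_le s x : 0 <= s <= 1 -> hitsum s x <= M.
Proof.
move=> s01; apply: rsum_le; first exact: hit_cvg.
by move=> N; apply: le_trans (hit_bounded N x); apply: ler_sum => i _; exact: hit_term_le.
Qed.

Lemma hitsum_homo s t x : 0 <= s -> s <= t -> t <= 1 -> hitsum s x <= hitsum t x.
Proof.
move=> s0 st t1; have t0 : 0 <= t by exact: le_trans st.
apply: le_rsum => [||k]; [apply: hit_cvg|apply: hit_cvg|]; rewrite ?s0 ?t0 ?t1 ?(le_trans st)//.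
by rewrite ler_wpM2l ?hit_ge0// lerXn2r.
Qed.

Lemma Fgen_ge0 s x : 0 <= s <= 1 -> 0 <= Fgen s x.
Proof. by move=> s01; rewrite /Fgen; case: ifP => // _; exact: hitsum_ge0. Qed.

Lemma Fgen_le s x : 0 <= s <= 1 -> Fgen s x <= M.
Proof.
by move=> s01; rewrite /Fgen; case: ifP => _; [exact: transient_ge1|exact: hitsum_le].
Qed.

Lemma Fgen_homo s t x : 0 <= s -> s <= t -> t <= 1 -> Fgen s x <= Fgen t x.
Proof. by move=> s0 st t1; rewrite /Fgen; case: ifP => // _; exact: hitsum_homo. Qed.

Lemma cvg_step (f_ : nat -> G -> R) f x : (forall y, f_ n y @[n --> \oo] --> f y) ->
  A (f_ n) x @[n --> \oo] --> A f x.
Proof.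
move=> ff; rewrite /step; elim: S => [|y S' IHS].
  under eq_fun do rewrite big_nil; rewrite big_nil; exact: cvg_cst.
under eq_fun do rewrite big_cons; rewrite big_cons.
by apply: cvgD => //; apply: cvgMr.
Qed.

(** First-step decomposition, proved on truncations: s A sends the sum of the first N first-visit
    terms to the sum of the first N+1. The limit passes through [step] because it is a finite
    sum. *)
Lemma step_Fgen s x : 0 <= s <= 1 -> s * A (Fgen s) x = hitsum s x.
Proof.
move=> s01.
pose FN N y : R := dirac1 y + (y != 1%g)%:R * \sum_(k < N) hit k y * s ^+ k.+1.
have sFN N : s * A (FN N) x = \sum_(k < N.+1) hit k x * s ^+ k.+1.
  rewrite /FN stepD big_ord_recl mulrDr mulrC expr1; congr (_ + _).
  rewrite (_ : (fun y => _) =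
      fun y => \sum_(k < N) s ^+ k.+1 * ((y != 1%g)%:R * hit k y)); last first.
    by apply/funext => y; rewrite mulr_sumr; apply: eq_bigr => k _; ring.
  rewrite step_sum mulr_sumr; apply: eq_bigr => k _ /=.
  by rewrite stepZ -[taboo _ _]/(step _ _ _ _) [in RHS]exprS; ring.
have FF y : FN N y @[N --> \oo] --> Fgen s y.
  rewrite /FN /Fgen /dirac1; have [->|_] /= := eqVneq y 1%g.
    under eq_fun do rewrite mul0r addr0; exact: cvg_cst.
  under eq_fun do rewrite mul1r add0r.
  by apply: rsum_cvg; exact: hit_cvg.
have c1 : s * A (FN N) x @[N --> \oo] --> s * A (Fgen s) x.
  by apply: cvgMr; exact: cvg_step.
have c2 : s * A (FN N) x @[N --> \oo] --> hitsum s x.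
  have : (\sum_(k < N) hit k x * s ^+ k.+1) @[N --> \oo] --> hitsum s x.
    by apply: rsum_cvg; exact: hit_cvg.
  by rewrite -cvg_shiftS; under [in X in X -> _]eq_fun do rewrite -sFN.
exact: (cvg_unique _ c1 c2).
Qed.

Lemma Fgen_equation s x : 0 <= s <= 1 ->
  Fgen s x = (1 - Ugen s) * dirac1 x + s * A (Fgen s) x.
Proof.
move=> s01; rewrite step_Fgen// /Fgen /dirac1 /Ugen.
by have [->|_] /= := eqVneq x 1%g; ring.
Qed.

Lemma Fgen1 s : Fgen s 1%g = 1.
Proof. by rewrite /Fgen eqxx. Qed.

Lemma iter_step_bounded n f c : (forall x, f x <= c) -> forall x, iter n A f x <= c.
Proof.
move=> fc; elim: n => //= n IHn x.
rewrite -[leRHS]mul1r -mu_sum1 mulr_suml.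
by apply: ler_sum => y _; apply: ler_wpM2l.
Qed.

Lemma Fgen_expand s x N : 0 <= s <= 1 ->
  Fgen s x = (1 - Ugen s) * (\sum_(n < N) p n x * s ^+ n) + s ^+ N * iter N A (Fgen s) x.
Proof. by move=> s01; apply: mass_expand => // y; exact: Fgen_equation. Qed.

Lemma green_cvg s x : 0 <= s <= 1 -> cvgn (series (fun n => p n x * s ^+ n)).
Proof.
move=> s01; apply: (@nonneg_series_cvg _ _ M) => [k|N].
  by rewrite mulr_ge0 ?mass_ge0 ?exprn_ge0//; case/andP: s01.
apply: le_trans (transient N x); apply: ler_sum => i _.
by rewrite ler_piMr ?mass_ge0// expr01_le1.
Qed.

(** For s < 1 the remainder s^N A^N F is at most s^N M, since averaging by a probability preserves
    upper bounds. This decay is lost at s = 1. *)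
Lemma Fgen_green s x : 0 <= s < 1 ->
  Fgen s x = (1 - Ugen s) * rsum (fun n => p n x * s ^+ n).
Proof.
move=> /andP[s0 s1]; have s01 : 0 <= s <= 1 by rewrite s0 ltW.
have M0 : 0 <= M by apply: le_trans transient_ge1.
have c1 : (1 - Ugen s) * (\sum_(n < N) p n x * s ^+ n) @[N --> \oo] -->
    (1 - Ugen s) * rsum (fun n => p n x * s ^+ n).
  by apply: cvgMr; apply: rsum_cvg; exact: green_cvg.
have c2 : s ^+ N * iter N A (Fgen s) x @[N --> \oo] --> (0 : R).
  have sM : s ^+ N * M @[N --> \oo] --> (0 : R).
    rewrite -[X in _ --> X](mul0r M); apply: cvgMl; apply: cvg_expr.
    by rewrite ger0_norm.
  apply: (@squeeze_cvgr _ _ _ _ (fun=> 0) (fun N => s ^+ N * M)) => //; last exact: cvg_cst.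
  apply: nearW => N; rewrite mulr_ge0 ?exprn_ge0//=; last first.
    by apply: iter_step_ge0 => // y; exact: Fgen_ge0.
  by rewrite ler_wpM2l ?exprn_ge0//; apply: iter_step_bounded => y; exact: Fgen_le.
have : (fun N => (1 - Ugen s) * (\sum_(n < N) p n x * s ^+ n) +
    s ^+ N * iter N A (Fgen s) x) N @[N --> \oo] -->
    (1 - Ugen s) * rsum (fun n => p n x * s ^+ n) + 0 by exact: cvgD c1 c2.
rewrite addr0; under eq_fun do rewrite -Fgen_expand//.
by move=> /cvg_lim <-//; rewrite lim_cst.
Qed.

(** At the identity F = (1 - U) G reads 1 = (1 - U(s)) G(s), and transience bounds G(s) by M. *)
Lemma Ugen_green s : 0 <= s < 1 -> 1 <= (1 - Ugen s) * M.
Proof.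
move=> s01; have s01' : 0 <= s <= 1 by case/andP: s01 => -> /ltW ->.
have g1 : 1 <= rsum (fun n => p n 1%g * s ^+ n).
  have := @rsum_ge _ (fun n => p n 1%g * s ^+ n) 1 _ (@green_cvg s 1%g s01').
  rewrite big_ord_recl big_ord0 addr0 /mass /= /dirac1 eqxx mul1r; apply => k.
  by rewrite mulr_ge0 ?mass_ge0 ?exprn_ge0//; case/andP: s01.
have := Fgen_green 1%g s01; rewrite Fgen1 => E.
have U1 : 0 <= 1 - Ugen s.
  rewrite -(@pmulr_lge0 _ (rsum (fun n => p n 1%g * s ^+ n))) -?E//.
  exact: lt_le_trans g1.
rewrite [leLHS]E; apply: ler_wpM2l => //; apply: rsum_le; first exact: green_cvg.
move=> N; apply: le_trans (transient N 1%g); apply: ler_sum => i _.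
by rewrite ler_piMr ?mass_ge0// expr01_le1.
Qed.

Lemma Ugen_le_left c t : 0 < t <= 1 -> (forall s, 0 < s < t -> Ugen s <= c) -> Ugen t <= c.
Proof.
move=> /andP[t0 t1] H; apply: rsum_le; first by apply: hit_cvg; rewrite (ltW t0).
move=> N; apply: (@polysum_le_left _ _ (hit ^~ 1%g) succn _ _ _ t0) => s /andP[s0 st].
apply: le_trans (H s _); last by rewrite s0.
apply: rsum_ge => [k|]; first by apply: hit_term_ge0; exact: ltW.
by apply: hit_cvg; rewrite (ltW s0) ltW// (lt_le_trans st).
Qed.

(** The bound U(s) <= 1 - 1/M is uniform in s < 1, hence survives at s = 1, where it says that the
    walk returns with probability less than 1. *)
Lemma Ugen_gap s : 0 <= s <= 1 -> M^-1 <= 1 - Ugen s.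
Proof.
move=> /andP[s0 s1]; have M0 : 0 < M by apply: lt_le_trans transient_ge1.
have H t : 0 <= t < 1 -> Ugen t <= 1 - M^-1.
  move=> /Ugen_green; rewrite -ler_pdivrMr// mul1r; lra.
suff : Ugen s <= 1 - M^-1 by lra.
have [s1'|s1'] := ltP s 1; first by apply: H; rewrite s0.
have -> : s = 1 by apply/eqP; rewrite eq_le s1.
apply: Ugen_le_left; first by rewrite ltr01 lexx.
by move=> t /andP[t0 t1]; apply: H; rewrite ltW.
Qed.

Lemma Ugen_lt1 s : 0 <= s <= 1 -> 0 < 1 - Ugen s.
Proof.
move=> s01; apply: lt_le_trans (Ugen_gap s01).
by rewrite invr_gt0; apply: lt_le_trans transient_ge1.
Qed.

(** What is kept at s = 1 of F = (1 - U) G. A truncation of G is a polynomial in s, so it is enough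
    to argue for s < 1, where 1 - U(1) <= 1 - U(s) and F(s) <= F(1). *)
Lemma green_le_Fgen1 N x : (1 - Ugen 1) * (\sum_(n < N) p n x) <= Fgen 1 x.
Proof.
have U1 : 0 < 1 - Ugen 1 by apply: Ugen_lt1; rewrite ler01 lexx.
rewrite -ler_pdivlMl//.
rewrite (eq_bigr (fun n : 'I_N => p n x * 1 ^+ n)); last by move=> i _; rewrite expr1n mulr1.
apply: (@polysum_le_left _ _ (p ^~ x) id 0 1 _ ltr01) => s /andP[s0 s1].
have s01 : 0 <= s <= 1 by rewrite !ltW.
rewrite ler_pdivlMl//.
apply: le_trans (Fgen_homo x (ltW s0) (ltW s1) (lexx _)).
rewrite Fgen_green ?(ltW s0)//; apply: ler_pM; first exact: ltW.
- by apply: sumr_ge0 => i _; rewrite mulr_ge0 ?mass_ge0 ?exprn_ge0 ?(ltW s0).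
- by rewrite lerD2l lerN2; exact: hitsum_homo (ltW s0) (ltW s1) _.
- apply: rsum_ge => [k|]; last exact: green_cvg.
  by rewrite mulr_ge0 ?mass_ge0 ?exprn_ge0 ?(ltW s0).
Qed.

(* If the first return time has mean b, then (G(t) - G(s)) / (t - s) <= b M^2. *)
Lemma mean_hit_mean_mass b : (forall N, \sum_(k < N) k.+1%:R * hit k 1%g <= b) ->
  forall N, \sum_(n < N) n%:R * p n 1%g <= b * M ^+ 2.
Proof.
move=> hb N; have M0 : 0 < M by apply: lt_le_trans transient_ge1.
pose g s := rsum (fun n => p n 1%g * s ^+ n).
have gE s : 0 <= s < 1 -> g s * (1 - Ugen s) = 1.
  by move=> s01; rewrite mulrC -Fgen_green ?Fgen1.
have gM s : 0 <= s < 1 -> 0 <= g s <= M.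
  move=> s01; have s01' : 0 <= s <= 1 by case/andP: s01 => -> /ltW ->.
  have U1 := Ugen_lt1 s01'; apply/andP; split.
    by rewrite -(pmulr_lge0 _ U1) gE.
  by rewrite -(ler_pM2r U1) gE// mulrC Ugen_green.
rewrite (eq_bigr (fun n : 'I_N => n%:R * p n 1%g * 1 ^+ n.-1)); last first.
  by move=> i _; rewrite expr1n mulr1.
apply: (@polysum_le_left _ _ (fun n => n%:R * p n 1%g) predn 0 1 _ ltr01).
(* The slope of G over [s, t] dominates its derivative at s because the coefficients are
   nonnegative; t < 1 keeps G (1 - U) = 1 available at both ends. *)
move=> s /andP[s0 s1]; pose t := (s + 1) / 2.
have st : s < t by rewrite /t; lra.
have t1 : t < 1 by rewrite /t; lra.
have t0 : 0 < t by exact: lt_trans st.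
have s01 : 0 <= s < 1 by rewrite ltW.
have t01 : 0 <= t < 1 by rewrite ltW.
have s01' : 0 <= s <= 1 by rewrite !ltW.
have t01' : 0 <= t <= 1 by rewrite !ltW.
have ts : 0 < t - s by rewrite subr_gt0.
rewrite -(ler_pM2r ts).
have H1 : (\sum_(n < N) n%:R * p n 1%g * s ^+ n.-1) * (t - s) <= g t - g s.
  rewrite -rsumB; [|exact: green_cvg..].
  apply: le_trans (_ : _ <= \sum_(n < N) (p n 1%g * t ^+ n - p n 1%g * s ^+ n)) _.
    rewrite mulr_suml; apply: ler_sum => n _; rewrite -mulrBr.
    rewrite [leLHS](_ : _ = p n 1%g * (n%:R * s ^+ n.-1 * (t - s))); last by ring.
    by rewrite ler_wpM2l ?mass_ge0 ?expr_diff_ge ?(ltW s0) ?(ltW st).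
  apply: rsum_ge => [k|]; last by apply: is_cvg_seriesB; exact: green_cvg.
  rewrite -mulrBr mulr_ge0 ?mass_ge0// subr_ge0 lerXn2r ?nnegrE ?ltW//.
have H2 : Ugen t - Ugen s <= b * (t - s).
  rewrite -rsumB; [|exact: hit_cvg..].
  apply: rsum_le => [|K]; first by apply: is_cvg_seriesB; exact: hit_cvg.
  apply: le_trans (_ : (\sum_(k < K) k.+1%:R * hit k 1%g) * (t - s) <= _).
    rewrite mulr_suml; apply: ler_sum => k _; rewrite -mulrBr.
    rewrite [leRHS](_ : _ = hit k 1%g * (k.+1%:R * (t - s))); last by ring.
    rewrite ler_wpM2l ?hit_ge0//.
    apply: le_trans (expr_diff_le _ (ltW s0) (ltW st)) _.
    by rewrite ler_wpM2r ?(ltW ts)// ler_piMr ?ler0n// expr01_le1.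
  by rewrite ler_wpM2r ?(ltW ts).
apply: le_trans H1 _.
have -> : g t - g s = g t * g s * (Ugen t - Ugen s).
  transitivity (g t * (g s * (1 - Ugen s)) - g s * (g t * (1 - Ugen t))); last by ring.
  by rewrite !gE// !mulr1.
have b0 : 0 <= b by apply: le_trans (hb 0%N); rewrite big_ord0.
have /andP[gt0 gtM] := gM _ t01; have /andP[gs0 gsM] := gM _ s01.
apply: le_trans (_ : g t * g s * (b * (t - s)) <= _).
  by rewrite ler_wpM2l ?mulr_ge0.
rewrite mulrA ler_wpM2r ?(ltW ts)// mulrC ler_wpM2l// expr2 ler_pM//.
Qed.

End FirstPassage.

(** * Iterates of the step operator as finite convolutions *)

Section WalkSupport.
Local Open Scope ring_scope.
Variables (R : realType) (G : groupType) (mu : G -> R) (S : seq G).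
Implicit Types (f g : G -> R) (x y z : G).
Hypothesis mu_ge0 : forall x, 0 <= mu x.

Local Notation A := (step mu S).
Local Notation p := (mass mu S).

(** The argument of [iter n A] is a combination of translated Dirac masses: f cut down to the points
    [z^-1 * x], z in L. Since A commutes with right translations, each mass contributes one value of
    [p n], and no n-fold sum has to be reindexed. *)
Lemma iter_step_pick n (L : seq G) f x :
  iter n A (fun y => \sum_(z <- L) f (z^-1 * x)%g * dirac1 (y * (z^-1 * x)^-1)%g) x =
  \sum_(z <- L) p n z * f (z^-1 * x)%g.
Proof.
rewrite iter_step_sum; apply: eq_bigr => z _.
by rewrite iter_stepZ iter_step_translate mulrC invgM invgK mulgA mulgV mul1g.
Qed.

Lemma sum_dirac1 (L : seq G) f x z0 : uniq L ->
  \sum_(z <- L) f (z^-1 * x)%g * dirac1 ((z0^-1 * x) * (z^-1 * x)^-1)%g =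
  if z0 \in L then f (z0^-1 * x)%g else 0 :> R.
Proof.
move=> uL; have E z : dirac1 ((z0^-1 * x) * (z^-1 * x)^-1)%g = (z == z0)%:R :> R.
  rewrite /dirac1 invgM invgK -mulgA [(x * _)%g]mulgA mulgV mul1g.
  by rewrite eq_sym -(inj_eq (mulgI z0)) mulgA mulgV mul1g mulg1 eq_sym.
case: ifP => zL; last first.
  rewrite big_seq big1// => z zL'; rewrite E.
  by case: eqP => [zz|_]; [rewrite -zz zL' in zL|rewrite mulr0].
rewrite (bigD1_seq z0)//= E eqxx mulr1 big1 ?addr0// => z /negPf zz.
by rewrite E zz mulr0.
Qed.

Lemma iter_step_ge_sum n (L : seq G) f x : uniq L -> (forall y, 0 <= f y) ->
  \sum_(z <- L) p n z * f (z^-1 * x)%g <= iter n A f x.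
Proof.
move=> uL f0; rewrite -iter_step_pick; apply: le_iter_step => // y.
have -> : y = ((x * y^-1)^-1 * x)%g by rewrite invgM invgK mulgVK.
by rewrite sum_dirac1//; case: ifP.
Qed.

Lemma iter_step_ge_mass n f x z : (forall y, 0 <= f y) ->
  p n z * f (z^-1 * x)%g <= iter n A f x.
Proof.
move=> f0; have := @iter_step_ge_sum n [:: z] f x isT f0.
by rewrite big_seq1.
Qed.

(** A^n f at x only depends on f at [z^-1 * x] for z in a finite list of n-fold products, so f may
    be replaced by its cut-down version on that list. *)
Lemma mass_support n : exists2 L : seq G, uniq L &
  forall f x, iter n A f x = \sum_(z <- L) p n z * f (z^-1 * x)%g.
Proof.
suff [L uL HL] : exists2 L : seq G, uniq L & forall f g x,
    (forall z, z \in L -> f (z^-1 * x)%g = g (z^-1 * x)%g) -> iter n A f x = iter n A g x.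
  exists L => // f x; rewrite -iter_step_pick; apply: HL => z zL.
  by rewrite sum_dirac1// zL.
elim: n => [|n [L uL IHL]].
  exists [:: 1%g] => // f g x /(_ 1%g); rewrite inE eqxx invg1 mul1g; exact.
exists (undup [seq (y * z)%g | y <- S, z <- L]); first exact: undup_uniq.
move=> f g x fg; rewrite !iterS /step big_seq [RHS]big_seq; apply: eq_bigr => y yS.
congr (_ * _); apply: IHL => z zL; rewrite !mulgA -invgM; apply: fg.
by rewrite mem_undup; apply/allpairsP; exists (y, z).
Qed.

Lemma massD m n x : p (m + n) x = iter m A (p n) x.
Proof. by rewrite /mass iterD. Qed.

Lemma massD_ge m n x y : p m x * p n y <= p (m + n) (x * y)%g.
Proof.
rewrite massD -[y in p n y](mulKg x); apply: iter_step_ge_mass => z.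
exact: mass_ge0.
Qed.

End WalkSupport.

(** * Binomial coefficients, binomial mixtures and tails of inverse square roots *)

Section BinomialBound.
Local Open Scope nat_scope.

Lemma leq_bin_succ n k : k.*2 < n -> 'C(n, k) <= 'C(n, k.+1).
Proof.
move=> kn; have := mul_bin_left n k; nia.
Qed.

Lemma bin_le_central m k : 'C(m.*2, k) <= 'C(m.*2, m).
Proof.
have H j : j <= m -> 'C(m.*2, m - j) <= 'C(m.*2, m).
  elim: j => [|j IHj] jm; first by rewrite subn0.
  apply: leq_trans (IHj (ltnW jm)).
  rewrite (_ : m - j = (m - j.+1).+1); last lia.
  by apply: leq_bin_succ; lia.
have [km|mk] := leqP k m; first by rewrite -(subKn km) H// leq_subr.
have [k2|k2] := leqP k m.*2; last by rewrite bin_small.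
rewrite -bin_sub// (_ : m.*2 - k = m - (k - m)); last lia.
by apply: H; lia.
Qed.

(** An integer form of C(2m, m) <= 4^m / sqrt(2m + 1). The ratio of consecutive central coefficients
    is 2 (2m + 1) / (m + 1), and the induction closes by (2m + 1) (2m + 3) <= 4 (m + 1)^2. *)
Lemma central_bin_bound m : 'C(m.*2, m) ^ 2 * m.*2.+1 <= 16 ^ m.
Proof.
elim: m => // m IHm; rewrite [16 ^ _]expnS.
have E : m.+1 * 'C(m.+1.*2, m.+1) = 2 * m.*2.+1 * 'C(m.*2, m).
  have := mul_bin_diag m.*2.+2 m; rewrite /= doubleS => E1.
  have := mul_bin_down m.*2.+1 m; rewrite /= => E2.
  have E3 : m.*2.+1 - m = m.+1 by lia.
  rewrite E3 in E2.
  nia.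
rewrite -(leq_pmul2l (_ : 0 < m.+1 ^ 2))//.
rewrite mulnA -expnMn E !expnMn.
apply: (@leq_trans (4 * m.*2.+1 * m.+1.*2.+1 * 16 ^ m)).
  rewrite -[2 ^ 2]/4; move: IHm; set c := 'C(_, _) ^ 2; set K := 16 ^ m.
  move=> IHm; have : 4 * m.*2.+1 * m.+1.*2.+1 * (c * m.*2.+1) <= 4 * m.*2.+1 * m.+1.*2.+1 * K.
    by rewrite leq_mul2l IHm orbT.
  by apply: leq_trans; rewrite leq_eqVlt; apply/orP; left; apply/eqP; ring.
rewrite mulnA leq_mul2r; apply/orP; right; rewrite -!muln2; nia.
Qed.

(** The factor 2 pays for odd j = 2m + 1, where Pascal's rule gives C(j, k) <= 2 C(2m, m) and j + 1
    <= 2 (2m + 1). *)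
Lemma bin_bound j k : 'C(j, k) ^ 2 * j.+1 <= 2 * 4 ^ j.
Proof.
rewrite -(odd_double_half j); set m := j./2.
have E4 : 4 ^ m.*2 = 16 ^ m by rewrite -mul2n expnM.
case: (odd j); rewrite ?add0n ?add1n.
  have b : 'C(m.*2.+1, k) <= 2 * 'C(m.*2, m).
    case: k => [|k]; first by rewrite bin0; have := bin_le_central m 0; rewrite bin0; lia.
    by rewrite binS; have := bin_le_central m k; have := bin_le_central m k.+1; lia.
  have b3 := central_bin_bound m.
  rewrite [4 ^ _]expnS E4.
  apply: (@leq_trans ((2 * 'C(m.*2, m)) ^ 2 * (2 * m.*2.+1))).
    by apply: leq_mul; [rewrite leq_exp2r|lia].
  rewrite expnMn; nia.
have b1 := bin_le_central m k; have b3 := central_bin_bound m.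
rewrite E4.
apply: leq_trans (_ : 'C(m.*2, m) ^ 2 * m.*2.+1 <= _); last by nia.
by rewrite leq_mul2r leq_exp2r// b1 orbT.
Qed.

End BinomialBound.

Section BinomialMixture.
Local Open Scope ring_scope.
Variables (R : realType) (c : R).
Implicit Types a t : nat -> R.
Hypotheses (c0 : 0 < c) (c1 : c <= 1).

(* The expectation of a (j + B) for B binomial with parameters n and c. *)
Fixpoint binmix a n j : R :=
  if n is n'.+1 then c * binmix a n' j.+1 + (1 - c) * binmix a n' j else a j.

Let c1' : 0 <= 1 - c. Proof. by rewrite subr_ge0. Qed.

(** A walk that moves up by 1 with probability c spends 1/c units of time at each level on average.
    So the sum is at most 1/c times the sum of a over the levels from j on, of which t is a
    telescoping majorant. *)
Lemma binmix_sum a t N j : (forall j, 0 <= t j) -> (forall j, a j + t j.+1 <= t j) ->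
  \sum_(n < N) binmix a n j <= t j / c.
Proof.
move=> t0 at_; elim: N j => [|N IHN] j; first by rewrite big_ord0 divr_ge0// ltW.
rewrite big_ord_recl /=.
rewrite big_split -!mulr_sumr /=.
have I1 := IHN j.+1; have I2 := IHN j; have I3 := at_ j.
apply: le_trans (_ : _ <= a j + (c * (t j.+1 / c) + (1 - c) * (t j / c))) _.
  by rewrite lerD2l; exact: lerD (ler_wpM2l (ltW c0) I1) (ler_wpM2l c1' I2).
rewrite -subr_ge0 (_ : _ - _ = t j - (a j + t j.+1)) ?subr_ge0//.
by field; rewrite gt_eqF.
Qed.

(** The weight n+1 turns the sum into a sum of tails, so the previous bound is used twice: t
    majorizes the tails of a, t2 those of t, and each pass costs 1/c. *)
Lemma binmix_wsum a t t2 N j : (forall j, 0 <= t j) -> (forall j, a j + t j.+1 <= t j) ->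
  (forall j, 0 <= t2 j) -> (forall j, t j + t2 j.+1 <= t2 j) ->
  \sum_(n < N) n.+1%:R * binmix a n j <= t2 j / c ^+ 2.
Proof.
move=> t0 at_ t20 tt; elim: N j => [|N IHN] j.
  by rewrite big_ord0 divr_ge0// exprn_ge0// ltW.
have E : \sum_(n < N.+1) n.+1%:R * binmix a n j = \sum_(n < N.+1) binmix a n j +
   (c * (\sum_(n < N) n.+1%:R * binmix a n j.+1) +
    (1 - c) * (\sum_(n < N) n.+1%:R * binmix a n j)).
  rewrite (eq_bigr (fun n : 'I_N.+1 => binmix a n j + n%:R * binmix a n j)); last first.
    by move=> n _; rewrite -natr1; ring.
  rewrite big_split; congr (_ + _); rewrite big_ord_recl/= ?mulr0n mul0r add0r.
  rewrite !mulr_sumr -big_split; apply: eq_bigr => n _ /=.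
  by rewrite /bump /=; ring.
rewrite E; have I0 := binmix_sum N.+1 j t0 at_.
have I1 := IHN j.+1; have I2 := IHN j; have I3 := tt j.
apply: le_trans (_ : _ <= t j / c + (c * (t2 j.+1 / c ^+ 2) + (1 - c) * (t2 j / c ^+ 2))) _.
  exact: lerD I0 (lerD (ler_wpM2l (ltW c0) I1) (ler_wpM2l c1' I2)).
rewrite -subr_ge0 (_ : _ - _ = (t2 j - (t j + t2 j.+1)) / c).
  by rewrite divr_ge0 ?subr_ge0// ltW.
by field; rewrite gt_eqF.
Qed.

End BinomialMixture.

Section InverseSqrt.
Local Open Scope ring_scope.
Variable R : realType.

Definition isqrt (j : nat) : R := (Num.sqrt j.+1%:R)^-1.

Lemma isqrt_gt0 j : 0 < isqrt j.
Proof. by rewrite invr_gt0 sqrtr_gt0 ltr0n. Qed.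

Lemma isqrt_sqr j : isqrt j ^+ 2 * j.+1%:R = 1.
Proof. by rewrite exprVn sqr_sqrtr ?ler0n// mulVf// pnatr_eq0. Qed.

Lemma isqrt_le1 j : isqrt j <= 1.
Proof.
rewrite invf_le1 ?sqrtr_gt0 ?ltr0n// -[leLHS]sqrtr1 ler_sqrt ?ltr0n//.
by rewrite ler1n.
Qed.

(* The telescoping sums for j^(-3/2) and j^(-5/2). *)
Lemma isqrt_telescope j : isqrt j ^+ 3 + 4 * isqrt j.+1 <= 4 * isqrt j.
Proof.
have := isqrt_sqr j; have := isqrt_sqr j.+1; have := isqrt_gt0 j; have := isqrt_gt0 j.+1.
set u := isqrt j; set v := isqrt j.+1; rewrite -[j.+2%:R]natr1.
have n1 : 1 <= j.+1%:R :> R by rewrite ler1n.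
set n : R := j.+1%:R in n1 *.
move=> v0 u0 ev eu.
(* Here u^2 = 1/n and v^2 = 1/(n+1), so u - v is u^2 v^2 / (u + v), which is of order u^3. *)
have uv : u ^+ 2 - v ^+ 2 = u ^+ 2 * v ^+ 2.
  transitivity (u ^+ 2 * (v ^+ 2 * (n + 1)) - (u ^+ 2 * n) * v ^+ 2); last by ring.
  by rewrite ev eu; ring.
have v2 : u ^+ 2 <= 2 * v ^+ 2.
  have : u ^+ 2 <= 1 by nra.
  by move=> ?; nra.
have vu : v <= u by nra.
have D : (u - v) * (u + v) = u ^+ 2 * v ^+ 2 by rewrite -uv; ring.
have : u ^+ 3 * (u + v) <= 4 * ((u - v) * (u + v)).
  rewrite D; have h : u * (u + v) <= 4 * v ^+ 2 by nra.
  by have := ler_wpM2l (sqr_ge0 u) h; lra.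
rewrite mulrA ler_pM2r; last by rewrite addr_gt0.
lra.
Qed.

Lemma isqrt_telescope3 j : isqrt j ^+ 5 + 4 * isqrt j.+1 ^+ 3 <= 4 * isqrt j ^+ 3.
Proof.
have := isqrt_telescope j; have := isqrt_gt0 j; have := isqrt_gt0 j.+1.
set u := isqrt j; set v := isqrt j.+1 => v0 u0 h.
have u3 : 0 <= u ^+ 3 by rewrite exprn_ge0// ltW.
have vu : v <= u by lra.
have h2 : u ^+ 2 * (u ^+ 3 + 4 * v) <= u ^+ 2 * (4 * u) by rewrite ler_wpM2l ?sqr_ge0.
have h3 : v * v ^+ 2 <= v * u ^+ 2.
  by rewrite ler_wpM2l ?(ltW v0)// lerXn2r ?nnegrE ?(ltW v0) ?(ltW u0).
have -> : u ^+ 5 = u ^+ 2 * u ^+ 3 by ring.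
have -> : v ^+ 3 = v * v ^+ 2 by ring.
have E : u ^+ 3 = u ^+ 2 * u by ring.
rewrite E in h2 *; lra.
Qed.

End InverseSqrt.

(** * Upper bounds on the return probabilities of lattice walks *)

Section LatticeUpper.
Local Open Scope ring_scope.
Variables (R : realType) (d : nat) (mu : Zpow d -> R) (S : seq (Zpow d)).
Implicit Types (f g : Zpow d -> R) (x y : Zpow d) (z : int).

Definition zcoord x (i : 'I_d) : int := (x : 'rV[int]_d) ord0 i.
Definition unit_vec (i : 'I_d) : Zpow d := delta_mx ord0 i.

Lemma zcoordM x y i : zcoord (x * y)%g i = zcoord x i + zcoord y i.
Proof. by rewrite /zcoord mxE. Qed.

Lemma zcoordV x i : zcoord x^-1%g i = - zcoord x i.
Proof. by rewrite /zcoord mxE. Qed.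

Lemma zcoord1 i : zcoord 1%g i = 0.
Proof. by rewrite /zcoord mxE. Qed.

Lemma zcoord_unit_vec i j : zcoord (unit_vec i) j = (j == i)%:R.
Proof. by rewrite /zcoord mxE eqxx. Qed.

Lemma zcoordP x y : (forall i, zcoord x i = zcoord y i) -> x = y.
Proof. by move=> xy; apply/rowP. Qed.

Lemma zpow_mulC x y : (x * y = y * x)%g.
Proof. by apply: zcoordP => i; rewrite !zcoordM addrC. Qed.

(* The mass at z of a sum of j independent uniform variables in {0, 2}. *)
Definition coin j (z : int) : R :=
  match z with
  | Posz m => if odd m then 0 else 'C(j, m./2)%:R / 2 ^+ j
  | Negz _ => 0
  end.

Lemma coin0 z : coin 0 z = (z == 0)%:R.
Proof.
case: z => [[|[|m]]|m] //=; first by rewrite bin0 expr0 divr1.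
by case: ifP; rewrite // bin0n /= mul0r.
Qed.

Lemma coinS j z : coin j.+1 z = (coin j z + coin j (z - 2)) / 2.
Proof.
case: z => [[|[|m]]|m].
- by rewrite (_ : Posz 0 - 2 = Negz 1)//= !bin0 exprS; field; rewrite expf_neq0.
- by rewrite (_ : Posz 1 - 2 = Negz 0)//= addr0 mul0r.
- have -> : Posz m.+2 - 2 = Posz m by lia.
  rewrite /= negbK; case: ifP => _; first by rewrite addr0 mul0r.
  by rewrite binS natrD exprS; field; rewrite expf_neq0.
- have -> : Negz m - 2 = Negz m.+2 by lia.
  by rewrite /= addr0 mul0r.
Qed.

Lemma coin_ge0 j z : 0 <= coin j z.
Proof. by case: z => [m|m] //=; case: ifP => // _; rewrite divr_ge0 ?exprn_ge0. Qed.

Lemma coin_le j z : coin j z <= Num.sqrt 2 * isqrt R j.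
Proof.
have s0 : 0 <= Num.sqrt 2 * isqrt R j.
  by rewrite mulr_ge0 ?sqrtr_ge0// ltW// isqrt_gt0.
case: z => [m|m] //=; case: ifP => // _.
rewrite -(ler_pXn2r (_ : 0 < 2)%N) ?nnegrE ?divr_ge0 ?exprn_ge0//.
have e : 'C(j, m./2)%:R ^+ 2 * j.+1%:R <= 2 * 4 ^+ j :> R.
  have := bin_bound j m./2; rewrite -(ler_nat R) !natrM !natrX; exact.
have p4 : (2 ^+ j) ^+ 2 = 4 ^+ j :> R by rewrite -exprM mulnC exprM; congr (_ ^+ _); ring.
rewrite -(ler_pM2r (_ : 0 < j.+1%:R)) ?ltr0n//.
rewrite [(_ * isqrt R j) ^+ 2]exprMn sqr_sqrtr// -[leRHS]mulrA isqrt_sqr mulr1.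
by rewrite expr_div_n p4 mulrAC ler_pdivrMr// exprn_gt0.
Qed.

(** Convolution by the uniform measure on {0, 2 e_i}. The step 2 e_i avoids parity obstructions: for
    a symmetric walk, 0 = e_i - e_i and 2 e_i are charged at a common time. *)
Definition shift2 i f : Zpow d -> R :=
  fun x => (f x + f ((unit_vec i * unit_vec i)^-1 * x)%g) / 2.

Definition shift2s (r : seq 'I_d) f := foldr shift2 f r.

Definition coins (J : 'I_d -> nat) x : R := \prod_i coin (J i) (zcoord x i).

Lemma zcoord_shift2 i x k :
  zcoord ((unit_vec i * unit_vec i)^-1 * x)%g k = zcoord x k - (k == i)%:R *+ 2.
Proof.
rewrite (zcoordM (unit_vec i * unit_vec i)^-1%g x) (zcoordV (unit_vec i * unit_vec i)%g).
by rewrite (zcoordM (unit_vec i) (unit_vec i)) !zcoord_unit_vec addrC mulr2n.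
Qed.

Lemma shift2_coins i J : shift2 i (coins J) = coins (fun k => (k == i) + J k)%N.
Proof.
apply/funext => x; rewrite /shift2 /coins (bigD1 i)//= [X in (_ + X) / 2](bigD1 i)//=.
rewrite [RHS](bigD1 i)//= eqxx add1n coinS.
rewrite zcoord_shift2 eqxx.
rewrite [in X in _ + X](eq_bigr (fun k => coin (J k) (zcoord x k))); last first.
  by move=> k /negPf ki; rewrite zcoord_shift2 ki mul0rn subr0.
rewrite [in RHS](eq_bigr (fun k => coin (J k) (zcoord x k))); last first.
  by move=> k /negPf ->.
by rewrite -mulrDl mulrAC.
Qed.

Lemma shift2s_coins r J : shift2s r (coins J) = coins (fun k => count_mem k r + J k)%N.
Proof.
elim: r => //= i r ->; rewrite shift2_coins; congr coins; apply/funext => k.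
by rewrite addnA eq_sym.
Qed.

Lemma shift2s_enum_coins j : shift2s (enum 'I_d) (coins (fun=> j)) = coins (fun=> j.+1).
Proof.
rewrite shift2s_coins; congr coins; apply/funext => k.
by rewrite count_uniq_mem ?enum_uniq// mem_enum add1n.
Qed.

Lemma coins0 : coins (fun=> 0%N) = dirac1.
Proof.
apply/funext => x; rewrite /coins /dirac1; have [->|x1] := eqVneq x 1%g.
  by rewrite big1// => i _; rewrite zcoord1 coin0.
have [i xi] : exists i, zcoord x i != 0.
  apply/existsP; rewrite -[X in is_true X]negbK negb_exists; apply/negP => /forallP h.
  case/eqP: x1; apply: zcoordP => i; rewrite zcoord1; apply/eqP.
  by have := h i; rewrite negbK.
by rewrite (bigD1 i)//= coin0 (negPf xi) mul0r.
Qed.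

Lemma coins_le j x : coins (fun=> j) x <= (Num.sqrt 2 * isqrt R j) ^+ d.
Proof.
rewrite -[X in _ ^+ X]card_ord -prodr_const; apply: ler_prod => i _.
by rewrite coin_ge0 coin_le.
Qed.

Lemma shift2_le i f g : (forall x, f x <= g x) -> forall x, shift2 i f x <= shift2 i g x.
Proof. by move=> fg x; rewrite ler_pM2r// lerD. Qed.

Lemma shift2Z i c f : shift2 i (fun x => c * f x) = fun x => c * shift2 i f x.
Proof. by apply/funext => x; rewrite /shift2; ring. Qed.

Lemma shift2s_cst r c : shift2s r (fun=> c) = fun=> c.
Proof. by elim: r => //= i r ->; apply/funext => x; rewrite /shift2; field. Qed.

Lemma shift2sB r f g :
  shift2s r (fun x => f x - g x) = fun x => shift2s r f x - shift2s r g x.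
Proof.
by elim: r => //= i r ->; apply/funext => x; rewrite /shift2; ring.
Qed.

Local Notation A := (step mu S).
Local Notation p := (mass mu S).

Hypothesis mu_ge0 : forall x, 0 <= mu x.
Hypothesis mu_sum1 : \sum_(y <- S) mu y = 1.
Hypothesis adm : forall x, exists n, 0 < p n x.
Hypothesis p_sym : forall n x, p n x^-1%g = p n x.

Lemma iter_step_shift2 n i f : iter n A (shift2 i f) = shift2 i (iter n A f).
Proof.
rewrite /shift2.
rewrite (_ : (fun x => _) = fun x =>
   2^-1 * f x + 2^-1 * f (x * (unit_vec i * unit_vec i)^-1)%g); last first.
  by apply/funext => x; rewrite [(x * _)%g]zpow_mulC; ring.
rewrite iter_stepD !iter_stepZ iter_step_translate; apply/funext => x.
by rewrite [(x * _)%g]zpow_mulC; ring.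
Qed.

Lemma iter_step_shift2s n r f : iter n A (shift2s r f) = shift2s r (iter n A f).
Proof. by elim: r => //= i r <-; rewrite iter_step_shift2. Qed.

Lemma unit_vec_neq1 i : unit_vec i != 1%g.
Proof.
by apply/eqP => /(congr1 (zcoord ^~ i)); rewrite zcoord1 zcoord_unit_vec eqxx.
Qed.

(** If e_i has mass q at time n then, by symmetry, both 0 and 2 e_i have mass at least q^2 at time
    2n, so A^(2n) dominates q^2 times [shift2 i]; these bounds are composed along r. A positive m is
    recorded for nonempty r because time will be cut into blocks of that length. *)
Lemma shift2s_dominated r : exists m c, [/\ 0 < c, (r == [::]) || (0 < m)%N &
  forall f, (forall x, 0 <= f x) -> forall x, c * shift2s r f x <= iter m A f x].
Proof.
elim: r => [|i r [m [c [c0 _ IHr]]]].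
  by exists 0%N, 1; split=> // f _ x; rewrite mul1r.
have [n en] := adm (unit_vec i).
have n0 : (0 < n)%N.
  case: n en => //; rewrite /mass /= /dirac1 (negPf (unit_vec_neq1 i)).
  by rewrite mulr0n ltxx.
set q := p n (unit_vec i) in en.
exists ((n + n) + m)%N, (q ^+ 2 * c); split.
- by rewrite mulr_gt0 ?exprn_gt0.
- by rewrite addnC addnA addn_gt0 n0 orbT.
move=> f f0 x.
have q1 : q ^+ 2 <= p (n + n) 1%g.
  rewrite -(mulgV (unit_vec i)); apply: le_trans (massD_ge S mu_ge0 n n _ _).
  by rewrite p_sym.
have q2 : q ^+ 2 <= p (n + n) (unit_vec i * unit_vec i)%g.
  exact: (massD_ge S mu_ge0 n n _ _).
rewrite iterD; set h := iter m A f.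
have h0 y : 0 <= h y by exact: iter_step_ge0.
have hx : c * shift2 i (shift2s r f) x <= shift2 i h x.
  by rewrite -(congr1 (fun F => F x) (shift2Z i c (shift2s r f))) shift2_le//; exact: IHr.
have h1 := @iter_step_ge_mass _ _ mu S mu_ge0 (n + n) h x 1%g h0.
have h2 := @iter_step_ge_mass _ _ mu S mu_ge0 (n + n) h x (unit_vec i * unit_vec i)%g h0.
rewrite invg1 mul1g in h1.
rewrite -mulrA /=; apply: le_trans (ler_wpM2l _ hx) _; first exact: sqr_ge0.
have k1 := ler_wpM2r (h0 x) q1.
have k2 := ler_wpM2r (h0 ((unit_vec i * unit_vec i)^-1 * x)%g) q2.
rewrite /shift2; lra.
Qed.

(* Writing mu^N = c nu + (1 - c) rho with nu uniform on {0, 2}^d, the n-th power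
   of mu^N is a binomial mixture of terms containing a power of nu. *)
Lemma mass_le_binmix : (0 < d)%N -> exists N c, [/\ (0 < N)%N, 0 < c <= 1 &
  forall n s x, p (s + n * N) x <=
    binmix c (fun j => (Num.sqrt 2 * isqrt R j) ^+ d) n 0].
Proof.
move=> d0; have [N [c [c0 N0 dom]]] := shift2s_dominated (enum 'I_d).
have {}N0 : (0 < N)%N.
  case/orP: N0 => // /eqP e; have := size_enum_ord d; rewrite e => de.
  by rewrite -de in d0.
(* This is (1 - c) times averaging by rho. Domination applied to K - f shows that it sends the upper
   bound K to (1 - c) K. *)
pose D f x := iter N A f x - c * shift2s (enum 'I_d) f x.
have cst k : iter N A (fun=> k) = fun=> k.
  elim: (N) => //= n' ->; apply/funext => x.
  by rewrite /step -mulr_suml mu_sum1 mul1r.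
have c1 : c <= 1.
  have := dom (fun=> 1) (fun=> ler01) 1%g.
  by rewrite shift2s_cst cst mulr1.
have D_le f K : (forall x, f x <= K) -> forall x, D f x <= (1 - c) * K.
  move=> fK x; have Kf y : 0 <= K - f y by rewrite subr_ge0.
  have := dom _ Kf x; rewrite shift2sB shift2s_cst.
  rewrite (_ : (fun x => K - f x) = fun x => K + -1 * f x); last first.
    by apply/funext => y; ring.
  by rewrite iter_stepD iter_stepZ cst /D; lra.
exists N, c; split=> //; first by rewrite c0.
set a := fun j => _.
(* Here j counts the tosses of nu already collected. One more block either collects another one,
   with weight c, or averages by rho, which preserves upper bounds. *)
suff H n j x : iter n (iter N A) (coins (fun=> j)) x <= binmix c a n j.
  move=> n s x; rewrite massD; apply: iter_step_bounded => // y.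
  have -> : p (n * N) = iter n (iter N A) (coins (fun=> 0%N)).
    rewrite coins0 /mass; elim: n => //= n' IHn.
    by rewrite mulSn iterD IHn.
  exact: H.
elim: n j x => [|n IHn] j x; first exact: coins_le.
rewrite iterS /=; set h := iter n (iter N A) (coins (fun=> j)).
have hE : iter N A h x = c * shift2s (enum 'I_d) h x + D h x by rewrite /D; ring.
have sh : shift2s (enum 'I_d) h = iter n (iter N A) (coins (fun=> j.+1)).
  rewrite -shift2s_enum_coins /h.
  by elim: (n) => //= n' IH; rewrite -IH iter_step_shift2s.
rewrite hE sh; apply: lerD; first by rewrite ler_wpM2l ?(ltW c0).
by apply: D_le => y; exact: IHn.
Qed.

Lemma isqrtX_le e j : (e <= d)%N ->
  (Num.sqrt 2 * isqrt R j) ^+ d <= Num.sqrt 2 ^+ d * isqrt R j ^+ e.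
Proof.
move=> ed; rewrite exprMn ler_wpM2l ?exprn_ge0 ?sqrtr_ge0//.
have i0 := ltW (isqrt_gt0 R j).
by rewrite -(subnK ed) exprD ler_piMl ?exprn_ge0// exprn_ile1// isqrt_le1.
Qed.

Lemma le_binmix c a b n j : 0 < c <= 1 -> (forall j, a j <= b j) ->
  binmix c a n j <= binmix c b n j :> R.
Proof.
move=> /andP[c0 c1] ab; elim: n j => //= n IHn j.
by apply: lerD; apply: ler_wpM2l; rewrite ?subr_ge0// ltW.
Qed.

(** All times s + n N with s < N share the bound [b n]. The sum is first enlarged from K times to K
    whole blocks. *)
Lemma mass_block_le (w : nat -> R) N K b : (0 < N)%N -> (forall n, 0 <= w n) ->
  (forall n s x, p (s + n * N) x <= b n) -> forall x,
  \sum_(n < K) w n * p n x <= \sum_(n < K) (\sum_(s < N) w (s + n * N)%N) * b n.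
Proof.
move=> N0 w0 pb x.
apply: le_trans (_ : _ <= \sum_(0 <= n < K * N) w n * p n x) _.
  rewrite -(big_mkord predT (fun n => w n * p n x)).
  have KN : (K <= K * N)%N by rewrite leq_pmulr.
  rewrite [leRHS](big_cat_nat (leq0n K) KN)/= lerDl; apply: sumr_ge0 => n _.
  by rewrite mulr_ge0// mass_ge0.
rewrite big_nat_mul big_mkord; apply: ler_sum => n _.
rewrite -{1}[(n * N)%N]add0n mulSn big_addn addnK big_mkord mulr_suml.
by apply: ler_sum => s _; rewrite ler_wpM2l.
Qed.

(** The sup norm after j coin tosses, of order j^(-d/2), is at most of order j^(-3/2), which is
    summable. *)
Lemma lattice_transient : (3 <= d)%N -> exists M, forall N x, \sum_(n < N) p n x <= M.
Proof.
move=> d3; have [|N [c [N0 c01 pb]]] := mass_le_binmix; first exact: leq_trans d3.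
have /andP[c0 c1] := c01.
pose K := Num.sqrt 2 ^+ d : R; have K0 : 0 <= K by rewrite exprn_ge0// sqrtr_ge0.
pose a j := K * isqrt R j ^+ 3; pose t j := K * (4 * isqrt R j).
exists (N%:R * (t 0%N / c)) => L x.
have := @mass_block_le (fun=> 1) N L _ N0 (fun=> ler01) pb x.
under eq_bigr do rewrite mul1r; move/le_trans; apply.
under eq_bigr do rewrite sumr_const card_ord.
rewrite -mulr_sumr ler_wpM2l ?ler0n//.
apply: le_trans (binmix_sum c0 c1 L 0 (_ : forall j, 0 <= t j) (_ : forall j, a j + t j.+1 <= t j)).
- by apply: ler_sum => n _; apply: le_binmix => // j; exact: isqrtX_le.
- by move=> j; rewrite !mulr_ge0// ltW// isqrt_gt0.
- by move=> j; rewrite -mulrDr ler_wpM2l// isqrt_telescope.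
Qed.

Lemma lattice_mean_mass : (5 <= d)%N ->
  exists M, forall N x, \sum_(n < N) n%:R * p n x <= M.
Proof.
move=> d5; have [|N [c [N0 c01 pb]]] := mass_le_binmix; first exact: leq_trans d5.
have /andP[c0 c1] := c01.
pose K := Num.sqrt 2 ^+ d : R; have K0 : 0 <= K by rewrite exprn_ge0// sqrtr_ge0.
(* The tails of j^(-5/2) are at most 4 j^(-3/2), and the tails of these at most 16 j^(-1/2), with j
   shifted by 1 throughout. *)
pose a j := K * isqrt R j ^+ 5; pose t j := K * (4 * isqrt R j ^+ 3).
pose t2 j := K * (16 * isqrt R j).
exists (N%:R * N%:R * (t2 0%N / c ^+ 2)) => L x.
have := @mass_block_le (fun n => n%:R) N L _ N0 (fun=> ler0n _ _) pb x.
move/le_trans; apply.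
have b0 n : 0 <= binmix c (fun j => (Num.sqrt 2 * isqrt R j) ^+ d) n 0.
  by apply: le_trans (pb n 0%N 1%g); rewrite mass_ge0.
apply: le_trans (_ : _ <= N%:R * N%:R * \sum_(n < L) n.+1%:R * binmix c a n 0) _.
  rewrite mulr_sumr; apply: ler_sum => n _; rewrite mulrA; apply: ler_pM => //.
  - by apply: sumr_ge0.
  - rewrite -!natrM -natr_sum ler_nat.
    apply: leq_trans (_ : _ <= \sum_(s < N) N * n.+1)%N _.
      by apply: leq_sum => s _; have := ltn_ord s; lia.
    by rewrite sum_nat_const card_ord mulnA.
  - by apply: le_binmix => // j; exact: isqrtX_le.
rewrite ler_wpM2l ?mulr_ge0//.
apply: (binmix_wsum c0 c1 L 0 (_ : forall j, 0 <= t j) (_ : forall j, a j + t j.+1 <= t j)).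
- move=> j; apply: mulr_ge0 => //; apply: mulr_ge0 => //.
  exact/exprn_ge0/ltW/isqrt_gt0.
- by move=> j; rewrite -mulrDr ler_wpM2l// isqrt_telescope3.
- by move=> j; rewrite !mulr_ge0// ltW// isqrt_gt0.
- by move=> j; rewrite -mulrDr ler_wpM2l//; have := isqrt_telescope R j; lra.
Qed.

End LatticeUpper.

(** * Second moments of return times and triple convolutions *)

Section WalkSums.
Local Open Scope ring_scope.
Variables (R : realType) (G : groupType) (mu : G -> R) (S : seq G).
Implicit Types (f g : G -> R) (x y z : G).
Hypothesis mu_ge0 : forall x, 0 <= mu x.

Local Notation A := (step mu S).
Local Notation p := (mass mu S).

Lemma le_sum_uniq_sub (T : eqType) (s1 s2 : seq T) (F : T -> R) :
  uniq s1 -> uniq s2 -> {subset s1 <= s2} -> (forall a, 0 <= F a) ->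
  \sum_(a <- s1) F a <= \sum_(a <- s2) F a.
Proof.
move=> u1 u2 s12 F0; rewrite [leRHS](bigID (mem s1))/=.
rewrite -[in X in _ <= X + _]big_filter.
rewrite (perm_big [seq a <- s2 | a \in s1]) ?lerDl ?sumr_ge0//.
apply: uniq_perm; rewrite ?filter_uniq// => a; rewrite mem_filter/= andbC.
by case: (boolP (a \in s1)) => [/s12 ->|_]; rewrite ?andbF.
Qed.

(** One list serves all n < N, so that sums over group elements can be exchanged with sums over
    times. *)
Lemma iter_step_le_support N : exists2 L : seq G, uniq L &
  forall n f x, (n < N)%N -> (forall y, 0 <= f y) ->
  iter n A f x <= \sum_(z <- L) p n z * f (z^-1 * x)%g.
Proof.
elim: N => [|N [L uL HL]]; first by exists [::].
have [L' uL' HL'] := mass_support mu S N.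
exists (undup (L ++ L')); first exact: undup_uniq.
move=> n f x nN f0; rewrite ltnS leq_eqVlt in nN.
have t0 m z : 0 <= p m z * f (z^-1 * x)%g by rewrite mulr_ge0// mass_ge0.
case/orP: nN => [/eqP ->|nN].
  rewrite HL'; apply: le_sum_uniq_sub => //; first exact: undup_uniq.
  by move=> z zL; rewrite mem_undup mem_cat zL orbT.
apply: le_trans (HL n f x nN f0) _; apply: le_sum_uniq_sub => //; first exact: undup_uniq.
by move=> z zL; rewrite mem_undup mem_cat zL.
Qed.

(** Chapman-Kolmogorov for a loop of length i + j + k, with x and y its positions at times i and i +
    j. The right side has the shape of the sum defining [I2]. *)
Lemma triple_convolution_le N : exists L Y : seq G, [/\ uniq L, uniq Y &
  \sum_(i < N) \sum_(j < N) \sum_(k < N) p (i + (j + k)) 1%g <=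
  \sum_(x <- L) \sum_(y <- Y) (\sum_(n < N) p n x) * (\sum_(n < N) p n (x^-1 * y)%g) *
    (\sum_(n < N) p n (y^-1)%g)].
Proof.
have [L uL HL] := iter_step_le_support N.
pose Y := undup [seq (x * z)%g | x <- L, z <- L].
exists L, Y; split=> //; first exact: undup_uniq.
have p0 n z : 0 <= p n z by exact: mass_ge0.
have E x y : (\sum_(n < N) p n x) * (\sum_(n < N) p n (x^-1 * y)%g) * (\sum_(n < N) p n (y^-1)%g) =
    \sum_(i < N) \sum_(j < N) \sum_(k < N) p i x * p j (x^-1 * y)%g * p k (y^-1)%g.
  rewrite mulr_suml mulr_suml; apply: eq_bigr => i _.
  rewrite [p i x * _]mulr_sumr mulr_suml; apply: eq_bigr => j _.
  by rewrite mulr_sumr.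
under [leRHS]eq_bigr do under eq_bigr do rewrite E.
under [leRHS]eq_bigr do rewrite exchange_big.
rewrite [leRHS]exchange_big; apply: ler_sum => i _.
under [leRHS]eq_bigr do rewrite exchange_big.
rewrite [leRHS]exchange_big; apply: ler_sum => j _.
under [leRHS]eq_bigr do rewrite exchange_big.
rewrite [leRHS]exchange_big; apply: ler_sum => k _.
rewrite massD; apply: le_trans (HL i _ 1%g (ltn_ord i) (p0 _)) _.
rewrite big_seq [leRHS]big_seq; apply: ler_sum => x xL.
under eq_bigr do rewrite -mulrA.
rewrite -mulr_sumr ler_wpM2l// mulg1 massD.
apply: le_trans (HL j _ _ (ltn_ord j) (p0 _)) _.
apply: le_trans (_ : _ <= \sum_(y <- [seq (x * z)%g | z <- L])
    p j (x^-1 * y)%g * p k (y^-1)%g) _.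
  by rewrite big_map; apply: ler_sum => z _; rewrite mulKg invgM.
apply: le_sum_uniq_sub => [||y|y]; last by rewrite mulr_ge0.
- by rewrite map_inj_uniq//; exact: mulgI.
- exact: undup_uniq.
- by move=> /mapP[z zL ->]; rewrite mem_undup; apply/allpairsP; exists (x, z).
Qed.

Lemma sum_leq_nat N m : (\sum_(i < N) (i <= m) = minn N m.+1)%N.
Proof. by elim: N => [|N IHN]; rewrite ?big_ord0 ?min0n// big_ord_recr IHN /=; lia. Qed.

(** The index n is hit by at least (n/2)^2 triples: i and j range freely up to the integer part of
    n/2, and k = n - i - j. *)
Lemma triple_sum_ge (q : nat -> R) N : (forall n, 0 <= q n) ->
  \sum_(n < N) n%:R ^+ 2 * q n <=
  4 * \sum_(i < N) \sum_(j < N) \sum_(k < N) q (i + (j + k))%N.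
Proof.
move=> q0.
have H1 m : \sum_(n < N) (m <= n)%N%:R * q n <= \sum_(k < N) q (m + k)%N.
  have [Nm|mN] := leqP N m.
    rewrite big1 ?sumr_ge0// => n _; rewrite leqNgt (leq_trans (ltn_ord n) Nm).
    by rewrite mul0r.
  rewrite -(big_mkord predT (fun n => (m <= n)%N%:R * q n)) (big_cat_nat (leq0n m) (ltnW mN))/=.
  rewrite big_nat big1 ?add0r => [|n /andP[_ nm]]; last by rewrite leqNgt nm mul0r.
  rewrite -{1}[m]add0n big_addn big_mkord -(subnK (ltnW mN)) big_split_ord/= addnK.
  apply: le_trans (_ : _ <= \sum_(i < N - m) q (m + i)%N) _; last by rewrite lerDl sumr_ge0.
  by apply: ler_sum => i _; rewrite addnC leq_addr mul1r.
have H2 n : (n < N)%N -> n%:R ^+ 2 <= 4 * \sum_(i < N) \sum_(j < N) (i + j <= n)%N%:R :> R.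
  move=> nN.
  have H3 : \sum_(i < N) (i <= n./2)%N%:R = n./2.+1%:R :> R.
    rewrite -natr_sum sum_leq_nat; congr (_%:R); apply/minn_idPr.
    by apply: leq_ltn_trans nN; have := odd_double_half n; lia.
  apply: le_trans (_ : 4 * (n./2.+1%:R * n./2.+1%:R) <= _).
    rewrite -natrX -!natrM ler_nat; have := odd_double_half n; nia.
  have -> : n./2.+1%:R * n./2.+1%:R =
      \sum_(i < N) \sum_(j < N) (i <= n./2)%N%:R * (j <= n./2)%N%:R :> R.
    by rewrite -big_distrlr /= H3.
  rewrite ler_wpM2l//; apply: ler_sum => i _; apply: ler_sum => j _.
  rewrite -natrM ler_nat.
  case: (leqP i n./2) => //= hi; case: (leqP j n./2) => //= hj.
  by rewrite lt0b; have := odd_double_half n; lia.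
apply: le_trans (_ : _ <= \sum_(n < N) (4 * \sum_(i < N) \sum_(j < N) (i + j <= n)%N%:R) * q n) _.
  by apply: ler_sum => n _; rewrite ler_wpM2r// H2.
under eq_bigr do rewrite -mulrA.
rewrite -mulr_sumr ler_wpM2l//.
under eq_bigr do rewrite mulr_suml.
rewrite [leLHS]exchange_big; apply: ler_sum => i _.
under eq_bigr do rewrite mulr_suml.
rewrite exchange_big; apply: ler_sum => j _ /=.
by under [leRHS]eq_bigr do rewrite addnA; exact: H1.
Qed.

End WalkSums.

(** * Lower bounds on the return probabilities of lattice walks *)

Section LatticeLower.
Local Open Scope ring_scope.
Local Open Scope classical_set_scope.
Variables (R : realType) (d : nat) (mu : Zpow d -> R) (S : seq (Zpow d)).
Implicit Types (f g : Zpow d -> R) (x y : Zpow d).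

Local Notation A := (step mu S).
Local Notation p := (mass mu S).

Hypothesis mu_ge0 : forall x, 0 <= mu x.
Hypothesis mu_sum1 : \sum_(y <- S) mu y = 1.
Hypothesis mu_sym : forall x, mu x = mu x^-1%g.
Hypothesis S_inv : perm_eq [seq y^-1%g | y <- S] S.

Lemma sum_inv (F : Zpow d -> R) : \sum_(y <- S) F y^-1%g = \sum_(y <- S) F y.
Proof. by rewrite -[RHS](perm_big _ S_inv) big_map. Qed.

(** Inversion exchanges left and right convolution, which agree on Z^d by commutativity; mu itself
    is invariant by symmetry. *)
Lemma iter_step_inv n f x :
  iter n A (fun y => f y^-1%g) x = iter n A f x^-1%g.
Proof.
elim: n x => // n IHn x; rewrite !iterS (funext IHn) /step -sum_inv.
apply: eq_bigr => y _; rewrite -mu_sym; congr (_ * iter n A f _).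
by rewrite invgM invgK; exact: zpow_mulC.
Qed.

Lemma lattice_mass_sym n x : p n x^-1%g = p n x.
Proof.
rewrite /mass -iter_step_inv; congr (iter n A _ x); apply/funext => y.
by rewrite /dirac1 invg_eq1.
Qed.

Definition sqnorm x : R := \sum_i (zcoord x i)%:~R ^+ 2.

Lemma sqnorm_parallelogram x y :
  sqnorm (y^-1 * x)%g + sqnorm (y * x)%g = 2 * (sqnorm x + sqnorm y).
Proof.
rewrite /sqnorm -!big_split mulr_sumr; apply: eq_bigr => i _ /=.
rewrite (zcoordM y^-1%g x) (zcoordM y x) (zcoordV y) !rmorphD rmorphN /=; ring.
Qed.

Definition variance : R := \sum_(y <- S) mu y * sqnorm y.

(** Symmetry pairs y with its inverse, and the parallelogram law then cancels the cross term. *)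
Lemma step_sqnorm x : A sqnorm x = sqnorm x + variance.
Proof.
have E : A sqnorm x = \sum_(y <- S) mu y * sqnorm (y * x)%g.
  by rewrite /step -sum_inv; apply: eq_bigr => y _; rewrite -mu_sym invgK.
suff : 2 * A sqnorm x = 2 * (sqnorm x + variance) by apply: mulfI.
rewrite mulr_natl mulr2n {2}E /step -big_split.
rewrite (eq_bigr (fun y => 2 * (mu y * sqnorm x + mu y * sqnorm y))) => [|y _].
  by rewrite -mulr_sumr big_split -mulr_suml mu_sum1 mul1r.
by rewrite /= -mulrDr sqnorm_parallelogram; ring.
Qed.

Lemma iter_step_cst n k : iter n A (fun=> k) = fun=> k.
Proof.
elim: n => //= n ->; apply/funext => x.
by rewrite /step -mulr_suml mu_sum1 mul1r.
Qed.

Lemma iter_step_sqnorm n x : iter n A sqnorm x = sqnorm x + n%:R * variance.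
Proof.
elim: n => [|n IHn]; first by rewrite mul0r addr0.
rewrite iterSr (_ : A sqnorm = fun x => sqnorm x + variance); last exact/funext/step_sqnorm.
by rewrite iter_stepD iter_step_cst IHn -natr1; ring.
Qed.

Lemma sqnorm1 : sqnorm 1%g = 0.
Proof. by rewrite /sqnorm big1// => i _; rewrite zcoord1 expr0n. Qed.

Section Box.
Variable L : nat.

Definition box_point (k : {ffun 'I_d -> 'I_L.*2.+1}) : Zpow d :=
  \row_i ((k i)%:Z - L%:Z).
Definition box := [seq box_point k | k <- enum {: {ffun 'I_d -> 'I_L.*2.+1}}].

Lemma box_uniq : uniq box.
Proof.
rewrite map_inj_uniq ?enum_uniq// => k k' /rowP kk; apply/ffunP => i.
by have := kk i; rewrite !mxE => /addIr [] /val_inj.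
Qed.

Lemma size_box : size box = (L.*2.+1 ^ d)%N.
Proof. by rewrite size_map -cardE card_ffun !card_ord. Qed.

Lemma mem_box x : (forall i, `|zcoord x i| <= L%:Z) -> x \in box.
Proof.
move=> xL; apply/mapP; exists [ffun i => inord (absz (zcoord x i + L%:Z))]; first by rewrite mem_enum.
apply: zcoordP => i; rewrite {2}/zcoord /box_point mxE ffunE.
by have := xL i => xi; rewrite inordK; lia.
Qed.

(** Pointwise, 1 - |y|^2 / (L+1)^2 is at most the indicator of the box; applying A^n gives the
    claim, as the mean of |X_n|^2 is n times the variance. *)
Lemma chebyshev_box n : 1 - n%:R * variance / L.+1%:R ^+ 2 <= \sum_(z <- box) p n z.
Proof.
have := @iter_step_pick _ _ mu S n box (fun=> 1) 1%g.
under [in X in _ = X -> _]eq_bigr do rewrite mulr1.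
move=> <-.
have -> : 1 - n%:R * variance / L.+1%:R ^+ 2 =
    iter n A (fun y => 1 + - (L.+1%:R ^- 2) * sqnorm y) 1%g.
  rewrite iter_stepD iter_step_cst iter_stepZ iter_step_sqnorm sqnorm1 add0r.
  by rewrite mulNr mulrC.
apply: le_iter_step => // y.
have := @sum_dirac1 R _ box (fun=> 1) 1%g y^-1%g box_uniq.
rewrite !mulg1 invgK => ->; have n0 : 0 < L.+1%:R ^+ 2 :> R by rewrite exprn_gt0 ?ltr0n.
have Q0 : 0 <= sqnorm y by apply: sumr_ge0 => i _; exact: sqr_ge0.
case: ifPn => [_|yB].
  by rewrite mulNr gerDl oppr_le0 mulr_ge0 ?invr_ge0 ?(ltW n0).
rewrite mulNr subr_le0 mulrC ler_pdivlMr// mul1r.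
have [i yi] : exists i, (L < absz (zcoord y i))%N.
  apply: contrapT => h; case/negP: yB; apply: mem_box => i.
  rewrite (zcoordV y i) normrN leNgt; apply/negP => yi; apply: h; exists i.
  by rewrite -ltz_nat abszE.
rewrite /sqnorm (bigD1 i)//= -[leLHS]addr0 lerD//; last by apply: sumr_ge0 => j _; exact: sqr_ge0.
rewrite -[X in _ <= X]real_normK ?num_real// lerXn2r ?nnegrE ?ler0n//.
rewrite -intr_norm; have : (L.+1%:Z <= `|zcoord y i|)%R by rewrite -abszE lez_nat.
by rewrite -(ler_int R).
Qed.

(** By symmetry p_(2n)(e) is the sum of p_n(z)^2. The hypothesis puts at least half of the mass of
    p_n in the box, and Cauchy-Schwarz spreads it over the points of the box. *)
Lemma box_return_ge n : 2 * (n%:R * variance) <= L.+1%:R ^+ 2 ->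
  (4 * (L.*2.+1 ^ d)%:R)^-1 <= p (n + n) 1%g.
Proof.
move=> nL; have n0 : 0 < L.+1%:R ^+ 2 :> R by rewrite exprn_gt0 ?ltr0n.
have s2 : 2^-1 <= \sum_(z <- box) p n z.
  apply: le_trans (chebyshev_box n).
  have : n%:R * variance / L.+1%:R ^+ 2 <= 2^-1.
    by rewrite ler_pdivrMr//; move: nL; set a := n%:R * variance; set b := L.+1%:R ^+ 2; lra.
  by set a := _ / _; lra.
rewrite massD; apply: le_trans (iter_step_ge_sum S mu_ge0 n 1%g box_uniq (mass_ge0 S mu_ge0 n)).
under eq_bigr do rewrite mulg1 lattice_mass_sym.
have B0 : 0 < (L.*2.+1 ^ d)%:R :> R by rewrite ltr0n expn_gt0.
set K : R := (_ ^ _)%:R in B0 *.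
(* Cauchy-Schwarz, from the squares of p z - 1 / (2 K). *)
have : 0 <= \sum_(z <- box) (p n z - (2 * K)^-1) ^+ 2.
  by apply: sumr_ge0 => z _; exact: sqr_ge0.
have -> : \sum_(z <- box) (p n z - (2 * K)^-1) ^+ 2 =
    \sum_(z <- box) p n z * p n z - K^-1 * (\sum_(z <- box) p n z) + (4 * K)^-1.
  rewrite (eq_bigr (fun z => p n z * p n z + (- K^-1) * p n z + (4 * K ^+ 2)^-1)).
    rewrite !big_split -mulr_sumr mulNr /=; congr (_ + _).
    rewrite big_const_seq count_predT size_box iter_addr_0 -mulr_natr -/K.
    by field; rewrite gt_eqF.
  by move=> z _; field; rewrite gt_eqF.
have : K^-1 * 2^-1 <= K^-1 * \sum_(z <- box) p n z by rewrite ler_wpM2l// invr_ge0 ltW.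
have -> : (4 * K)^-1 = K^-1 * 2^-1 * 2^-1 by field; rewrite gt_eqF.
set s := \sum_(z <- box) p n z * p n z; lra.
Qed.

End Box.

Lemma nat_sqrt_exists m : exists L, (L ^ 2 <= m < L.+1 ^ 2)%N.
Proof.
elim: m => [|m [L /andP[h1 h2]]]; first by exists 0%N.
by have [h|h] := ltnP m.+1 (L.+1 ^ 2); [exists L|exists L.+1]; nia.
Qed.

Lemma leq_expn_base m n e : (m <= n)%N -> (m ^ e <= n ^ e)%N.
Proof. by case: e => // e mn; rewrite leq_exp2r. Qed.

(** L is the integer square root of C n with C >= 2 [variance], so the box has at most (3 L)^d <=
    3^d (C n)^k points. The bound d <= 2k replaces n^(d/2) by an integer power. *)
Lemma return_ge k : (d <= k.*2)%N -> exists2 c : R, 0 < c &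
  forall n, (0 < n)%N -> c / n%:R ^+ k <= p (n + n) 1%g.
Proof.
move=> dk; pose C := (Num.truncn (2 * variance)).+1.
have hC : 2 * variance <= C%:R.
  by apply: ltW; apply: truncnS_gt.
exists (4 * (3 ^ d * C ^ k)%:R)^-1 => [|n n0].
  by rewrite invr_gt0 mulr_gt0// ltr0n muln_gt0 !expn_gt0.
have [L /andP[h1 h2]] := nat_sqrt_exists (C * n).
apply: le_trans (box_return_ge (_ : 2 * (n%:R * variance) <= L.+1%:R ^+ 2)); last first.
  apply: le_trans (_ : (C * n)%:R <= _).
    by rewrite natrM mulrCA mulrC ler_wpM2r ?ler0n.
  by rewrite -natrX ler_nat ltnW.
rewrite -invfM lef_pV2 ?posrE ?mulr_gt0 ?exprn_gt0 ?ltr0n ?muln_gt0 ?expn_gt0// ?n0//.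
rewrite -mulrA ler_wpM2l// -natrX -natrM ler_nat.
have L0 : (0 < L)%N by rewrite lt0n; apply/negP => /eqP L0; move: h2; rewrite L0; lia.
apply: (@leq_trans ((3 * L) ^ d)); first by apply: leq_expn_base; lia.
rewrite expnMn -mulnA leq_mul2l expn_eq0 /= -expnMn.
apply: (@leq_trans (L ^ k.*2)); first by rewrite leq_pexp2l.
by rewrite -mul2n expnM; apply: leq_expn_base.
Qed.

(** The even times alone dominate a multiple of the harmonic series. The uses are k = 2 for the
    first moment on Z^3 and k = 3 for the second moment on Z^5 and Z^6. *)
Lemma mass_moment_unbounded k b : (0 < k)%N -> (d <= k.*2)%N ->
  ~ (forall N, \sum_(n < N) n%:R ^+ k.-1 * p n 1%g <= b).
Proof.
move=> k0 dk hb; have [c c0 hc] := return_ge dk.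
pose F n := n%:R ^+ k.-1 * p n 1%g.
have F0 n : 0 <= F n by rewrite mulr_ge0 ?exprn_ge0 ?mass_ge0.
have even N : \sum_(m < N) F (m.+1 + m.+1)%N <= \sum_(n < N.*2.+1) F n.
  elim: N => [|N IHN]; first by rewrite big_ord0 sumr_ge0.
  rewrite big_ord_recr doubleS 2!big_ord_recr /= addSn addnS addnn.
  by have := F0 N.*2.+1; lra.
apply: (@dvg_harmonic R); apply: (@nonneg_series_cvg _ _ (b / c)) => [n|N].
  exact: harmonic_ge0.
rewrite ler_pdivlMr// mulr_suml; apply: le_trans (le_trans (even N) (hb _)).
apply: ler_sum => m _; rewrite /harmonic /F /=.
have m0 : 0 < m.+1%:R :> R by rewrite ltr0n.
apply: le_trans (_ : m.+1%:R ^+ k.-1 * (c / m.+1%:R ^+ k) <= _).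
  rewrite -{2}(prednK k0) exprS le_eqVlt; apply/orP; left; apply/eqP.
  by field; rewrite expf_neq0 gt_eqF.
by rewrite ler_pM ?exprn_ge0 ?hc ?divr_ge0 ?(ltW c0)// lerXn2r ?nnegrE// ler_nat leq_addr.
Qed.

End LatticeLower.

(** * The walk on the free product *)

Section FreeProductStep.
Local Open Scope ring_scope.
Variables (R : realType) (G1 G2 : groupType).
Variables (mu1 : G1 -> R) (mu2 : G2 -> R) (S1 : seq G1) (S2 : seq G2) (alpha : R).
Local Notation G := (free_prod G1 G2).
Local Notation mu := (mix alpha mu1 mu2).

(** [undup] is there because the two images share the identity, which both measures may charge. *)
Definition mix_support : seq G :=
  undup ([seq @fp_inl G1 G2 x | x <- S1] ++ [seq @fp_inr G1 G2 y | y <- S2]).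
Local Notation S := mix_support.

Hypotheses (mu1_ge0 : forall x, 0 <= mu1 x) (mu2_ge0 : forall y, 0 <= mu2 y).
Hypotheses (S1_uniq : uniq S1) (S2_uniq : uniq S2).
Hypotheses (S1_supp : forall x, x \notin S1 -> mu1 x = 0).
Hypotheses (S2_supp : forall y, y \notin S2 -> mu2 y = 0).
Hypothesis alpha01 : 0 <= alpha <= 1.

Lemma push_mass_inj (K : groupType) (f : K -> G) (m : K -> R) x : injective f ->
  push_mass f m (f x) = m x.
Proof.
move=> fI; rewrite /push_mass (_ : preimage _ _ = [set x]%classic) ?fsbig_set1//.
by apply/seteqP; split => y /=; [exact: fI|move=> ->].
Qed.

Lemma push_mass_out (K : groupType) (f : K -> G) (m : K -> R) y :
  (forall x, m x != 0 -> f x != y) -> push_mass f m y = 0.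
Proof.
move=> fy; apply: fsbig1 => x /= fx; apply: contrapT => /eqP mx.
by have := fy _ mx; rewrite fx eqxx.
Qed.

Lemma sum_push_mass (K : groupType) (f : K -> G) (m : K -> R) (L : seq K) (L' : seq G)
    (h : G -> R) : injective f -> uniq L -> uniq L' -> (forall x, x \notin L -> m x = 0) ->
  {subset [seq f x | x <- L] <= L'} ->
  \sum_(y <- L') push_mass f m y * h y = \sum_(x <- L) m x * h (f x).
Proof.
move=> fI uL uL' mL LL'.
transitivity (\sum_(y <- [seq f x | x <- L]) push_mass f m y * h y); last first.
  by rewrite big_map; apply: eq_bigr => x _; rewrite push_mass_inj.
rewrite (bigID (mem [seq f x | x <- L]))/= [X in _ + X]big1 ?addr0.
  rewrite -big_filter; apply: perm_big; apply: uniq_perm.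
  - exact: filter_uniq.
  - by rewrite map_inj_uniq.
  - move=> y; rewrite mem_filter/= andbC.
    by case: (boolP (y \in map _ _)) => [/LL' ->|_]; rewrite ?andbF.
move=> y yL; rewrite push_mass_out ?mul0r// => x mx; apply: contra yL => /eqP <-.
by apply: map_f; apply: contraTT mx => /mL ->; rewrite eqxx.
Qed.

Lemma mix_ge0 w : 0 <= mu w.
Proof.
case/andP: alpha01 => a0 a1.
by rewrite addr_ge0// mulr_ge0 ?subr_ge0// /push_mass fsumr_ge0.
Qed.

Lemma mix_supp w : w \notin S -> mu w = 0.
Proof.
rewrite mem_undup mem_cat negb_or => /andP[w1 w2].
rewrite /mix !push_mass_out ?mulr0 ?addr0// => x mx.
  by apply: contra w2 => /eqP <-; apply: map_f; apply: contraTT mx => /S2_supp ->; rewrite eqxx.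
by apply: contra w1 => /eqP <-; apply: map_f; apply: contraTT mx => /S1_supp ->; rewrite eqxx.
Qed.

Lemma step_mix f w : step mu S f w =
  alpha * (\sum_(x <- S1) mu1 x * f ((fp_inl G2 x)^-1 * w)%g) +
  (1 - alpha) * (\sum_(y <- S2) mu2 y * f ((fp_inr G1 y)^-1 * w)%g).
Proof.
rewrite -(@sum_push_mass _ (@fp_inl G1 G2) mu1 S1 S (fun u => f (u^-1 * w)%g))//.
- rewrite -(@sum_push_mass _ (@fp_inr G1 G2) mu2 S2 S (fun u => f (u^-1 * w)%g))//.
  + by rewrite !mulr_sumr -big_split; apply: eq_bigr => u _; rewrite /mix /=; ring.
  + exact: fp_inr_inj.
  + exact: undup_uniq.
  + by move=> u uS; rewrite mem_undup mem_cat uS orbT.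
- exact: fp_inl_inj.
- exact: undup_uniq.
- by move=> u uS; rewrite mem_undup mem_cat uS.
Qed.

Section WordProduct.
Variables (F1 : G1 -> R) (F2 : G2 -> R).
Hypotheses (F11 : F1 1%g = 1) (F21 : F2 1%g = 1).

Definition letter_weight (a : G1 + G2) : R :=
  match a with inl x => F1 x | inr y => F2 y end.
Definition seq_weight (s : seq (G1 + G2)) : R := \prod_(a <- s) letter_weight a.
Lemma seq_weight_nil : seq_weight [::] = 1. Proof. exact: big_nil. Qed.

Definition word_weight (w : G) : R := seq_weight (word w).

Lemma fp_inlV (x : G1) : (fp_inl G2 x)^-1%g = fp_inl G2 x^-1%g :> G.
Proof.
have e : fp_inl G2 1%g = 1%g :> G by apply: val_inj; rewrite /= /lcons /= eqxx.
by rewrite -[RHS]mul1g -(mulVg (fp_inl G2 x)) -mulgA -fp_inlM mulgV e mulg1.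
Qed.

Lemma fp_inrV (y : G2) : (fp_inr G1 y)^-1%g = fp_inr G1 y^-1%g :> G.
Proof.
have e : fp_inr G1 1%g = 1%g :> G by apply: val_inj; rewrite /= /lcons /= eqxx.
by rewrite -[RHS]mul1g -(mulVg (fp_inr G1 y)) -mulgA -fp_inrM mulgV e mulg1.
Qed.

Lemma word_inlM (x : G1) (w : G) : word ((fp_inl G2 x * w)%g : G) = lcons (inl x) (word w).
Proof.
rewrite [LHS]/= /lcons /=; have [->|x1] := eqVneq x 1%g => //=.
by rewrite /lcons /= x1.
Qed.

Lemma word_inrM (y : G2) (w : G) : word ((fp_inr G1 y * w)%g : G) = lcons (inr y) (word w).
Proof.
rewrite [LHS]/= /lcons /=; have [->|y1] := eqVneq y 1%g => //=.
by rewrite /lcons /= y1.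
Qed.

(** The normalization F1 1 = 1 makes the formula cover the cancellation of the two letters. *)
Lemma weight_inl_inl x x0 s : 
  seq_weight (lcons (inl x) (inl x0 :: s)) = F1 (x * x0)%g * seq_weight s.
Proof.
rewrite /lcons /seq_weight /=; have [->|x1] /= := eqVneq x 1%g.
  by rewrite mul1g big_cons.
by case: eqP => [->|_]; rewrite ?F11 ?mul1r// big_cons.
Qed.

Lemma weight_inr_inr y y0 s :
  seq_weight (lcons (inr y) (inr y0 :: s)) = F2 (y * y0)%g * seq_weight s.
Proof.
rewrite /lcons /seq_weight /=; have [->|y1] /= := eqVneq y 1%g.
  by rewrite mul1g big_cons.
by case: eqP => [->|_]; rewrite ?F21 ?mul1r// big_cons.
Qed.

Lemma weight_inl_other x s : (if s is inl _ :: _ then false else true) ->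
  seq_weight (lcons (inl x) s) = F1 x * seq_weight s.
Proof.
rewrite /lcons /seq_weight /=; have [->|x1] /= := eqVneq x 1%g; first by rewrite F11 mul1r.
by case: s => [|[a|a] s]//= _; rewrite big_cons.
Qed.

Lemma weight_inr_other y s : (if s is inr _ :: _ then false else true) ->
  seq_weight (lcons (inr y) s) = F2 y * seq_weight s.
Proof.
rewrite /lcons /seq_weight /=; have [->|y1] /= := eqVneq y 1%g; first by rewrite F21 mul1r.
by case: s => [|[a|a] s]//= _; rewrite big_cons.
Qed.

Lemma word_weight_inr y : word_weight (fp_inr G1 y) = F2 y.
Proof.
rewrite /word_weight -[fp_inr _ _]mulg1 word_inrM weight_inr_other//.
by rewrite /seq_weight big_nil mulr1.
Qed.

Lemma word_weight1 : word_weight 1%g = 1.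
Proof. by rewrite /word_weight /seq_weight big_nil. Qed.

Variables (s1 s2 U1 U2 kappa : R).
Hypotheses (s1_neq0 : s1 != 0) (s2_neq0 : s2 != 0).
Hypothesis F1_eq : forall x, F1 x = (1 - U1) * dirac1 x + s1 * step mu1 S1 F1 x.
Hypothesis F2_eq : forall y, F2 y = (1 - U2) * dirac1 y + s2 * step mu2 S2 F2 y.
Hypothesis kappa1 : alpha * (1 - U1) / s1 = kappa.
Hypothesis kappa2 : (1 - alpha) * (1 - U2) / s2 = kappa.

Let step1_neq1 x : x != 1%g -> step mu1 S1 F1 x = F1 x / s1.
Proof.
move=> /negPf x1; rewrite [F1 x in RHS]F1_eq /dirac1 x1 mulr0 add0r mulrC.
by rewrite mulKf.
Qed.

Let step2_neq1 y : y != 1%g -> step mu2 S2 F2 y = F2 y / s2.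
Proof.
move=> /negPf y1; rewrite [F2 y in RHS]F2_eq /dirac1 y1 mulr0 add0r mulrC.
by rewrite mulKf.
Qed.

Let step1_1 : step mu1 S1 F1 1%g = U1 / s1.
Proof.
have := F1_eq 1%g; rewrite F11 /dirac1 eqxx mulr1 => e.
by apply: (mulfI s1_neq0); rewrite [RHS]mulrC divfK//; lra.
Qed.

Let step2_1 : step mu2 S2 F2 1%g = U2 / s2.
Proof.
have := F2_eq 1%g; rewrite F21 /dirac1 eqxx mulr1 => e.
by apply: (mulfI s2_neq0); rewrite [RHS]mulrC divfK//; lra.
Qed.

(** The factor of the first letter acts on that letter by its own equation, which gives alpha / s1
    or (1 - alpha) / s2. The other factor prepends a letter and only sees its return value U / s,
    which gives its own coefficient minus kappa. Equality of the two kappas makes the total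
    independent of the first letter. At the empty word both factors see returns, and the deficit is
    kappa. *)
Lemma step_word_weight (w : G) :
  (alpha / s1 + (1 - alpha) / s2 - kappa) * word_weight w =
  kappa * dirac1 w + step mu S word_weight w.
Proof.
have e1 : alpha * (U1 / s1) = alpha / s1 - kappa by rewrite -kappa1; ring.
have e2 : (1 - alpha) * (U2 / s2) = (1 - alpha) / s2 - kappa by rewrite -kappa2; ring.
have w1E : (w == 1%g) = (word w == [::]) by [].
rewrite step_mix /dirac1 w1E.
rewrite (eq_bigr (fun x => mu1 x * seq_weight (lcons (inl x^-1%g) (word w)))) => [|x _];
  last by rewrite fp_inlV /word_weight word_inlM.
rewrite [in X in _ + (_ + X)](eq_bigr (fun y => mu2 y * seq_weight (lcons (inr y^-1%g) (word w))))
  => [|y _]; last by rewrite fp_inrV /word_weight word_inrM.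
have := valP w; rewrite /word_weight /=; case: (word w) => [|[x0|y0] s].
- move=> _; rewrite eqxx mulr1.
  (* The inverse is written as [_^-1 * 1] so that the sum is recognized as [step] at the
     identity. *)
  under eq_bigr do rewrite weight_inl_other// seq_weight_nil mulr1 -[_^-1%g]mulg1.
  under [in X in _ = _ + (_ + X)]eq_bigr do
    rewrite weight_inr_other// seq_weight_nil mulr1 -[_^-1%g]mulg1.
  rewrite -!/(step _ _ _ _) step1_1 step2_1 e1 e2 seq_weight_nil; ring.
- rewrite reduced_cons => /and3P[/= x01 _ _]; rewrite mulr0 add0r.
  under eq_bigr do rewrite weight_inl_inl mulrA.
  under [in X in _ = _ + X]eq_bigr do rewrite weight_inr_other// mulrA -[_^-1%g]mulg1.
  rewrite -!mulr_suml -!/(step _ _ _ _) step1_neq1// step2_1 [_ * (U2 / s2 * _)]mulrA e2.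
  by rewrite /seq_weight big_cons /=; ring.
- rewrite reduced_cons => /and3P[/= y01 _ _]; rewrite mulr0 add0r.
  under eq_bigr do rewrite weight_inl_other// mulrA -[_^-1%g]mulg1.
  under [in X in _ = _ + X]eq_bigr do rewrite weight_inr_inr mulrA.
  rewrite -!mulr_suml -!/(step _ _ _ _) step1_1 step2_neq1// [_ * (U1 / s1 * _)]mulrA e1.
  by rewrite /seq_weight big_cons /=; ring.
Qed.

End WordProduct.

End FreeProductStep.

(** * Intermediate values from order estimates *)

Section LipschitzIVT.
Local Open Scope ring_scope.
Local Open Scope classical_set_scope.
Variable R : realType.

Lemma lipschitz_IVT (f : R -> R) (a b v K : R) : a <= b -> 0 <= K ->
  (forall s t, a <= s -> s <= t -> t <= b -> f s <= f t <= f s + K * (t - s)) ->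
  f a <= v <= f b -> exists2 c, a <= c <= b & f c = v.
Proof.
move=> ab K0 fK /andP[fav vfb].
pose E := [set s | a <= s <= b /\ f s <= v].
have Ea : E a by split=> //; rewrite lexx.
have supE : has_sup E by split; [exists a|exists b => s [/andP[_ sb] _]].
have ac : a <= sup E by exact: sup_upper_bound.
have cb : sup E <= b by apply: ge_sup; [exists a|move=> s [/andP[_ sb] _]].
set c := sup E in ac cb; exists c; first by rewrite ac.
apply/eqP; rewrite eq_le; apply/andP; split.
  apply/ler_addgt0Pr => e e0.
  have K1 : 0 < K + 1 by rewrite ltr_wpDl.
  have [s [/andP[as_ sb] fs] cs] := sup_adherent (divr_gt0 e0 K1) supE.
  have sc : s <= c by apply: sup_upper_bound => //; rewrite /E/= as_ sb.
  have /andP[_] := fK _ _ as_ sc cb.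
  have : (K + 1) * (c - s) <= e by rewrite -ler_pdivlMl// mulrC; rewrite -/c in cs; lra.
  have : 0 <= c - s by rewrite subr_ge0.
  lra.
apply/ler_addgt0Pr => e e0.
have K1 : 0 < K + 1 by rewrite ltr_wpDl.
(* A point slightly to the right of the supremum c, cut off at b. Either t = b, where f is at least
   v, or f t < v would contradict the choice of c. *)
pose t := Num.min b (c + e / (K + 1)).
have ek : 0 < e / (K + 1) by exact: divr_gt0.
have ct : c <= t by rewrite /t le_min cb lerDl ltW.
have tb : t <= b by rewrite /t ge_min lexx.
have /andP[_ h] := fK _ _ ac ct tb.
have vt : v <= f t.
  have [e1|e1] := leP b (c + e / (K + 1)).
    by rewrite /t; move/min_idPl: e1 => ->.
  rewrite leNgt; apply/negP => ftv.
  have : t <= c.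
    apply: sup_upper_bound => //; split; last exact: ltW.
    by rewrite (le_trans ac ct).
  by rewrite /t (min_idPr (ltW e1)); lra.
have tc : t <= c + e / (K + 1) by rewrite /t ge_min lexx orbT.
have : (K + 1) * (t - c) <= e by rewrite -ler_pdivlMl// mulrC; lra.
have : 0 <= t - c by rewrite subr_ge0.
lra.
Qed.

End LipschitzIVT.

(** * Power series with nonnegative coefficients up to the endpoint 1 *)

Section GeneratingFunction.
Local Open Scope ring_scope.
Local Open Scope classical_set_scope.
Variables (R : realType) (u : nat -> R) (M : R).
Implicit Types s t : R.
Hypothesis u_ge0 : forall k, 0 <= u k.
Hypothesis u_bounded : forall N, \sum_(k < N) u k <= M.

Definition gf s : R := rsum (fun k => u k * s ^+ k.+1).
Definition gf_deriv s : R := rsum (fun k => k.+1%:R * u k * s ^+ k).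

(** Automatic for s < 1; at s = 1 it says that the law u has a finite mean. *)
Definition has_gf_deriv s := exists B, forall N, \sum_(k < N) k.+1%:R * u k * s ^+ k <= B.

Lemma gf_cvg s : 0 <= s <= 1 -> cvgn (series (fun k => u k * s ^+ k.+1)).
Proof.
move=> s01; have s0 : 0 <= s by case/andP: s01.
apply: (@nonneg_series_cvg _ _ M) => [k|N]; first by rewrite mulr_ge0 ?exprn_ge0.
by apply: le_trans (u_bounded N); apply: ler_sum => k _; apply: ler_piMr => //; exact: expr01_le1.
Qed.

Lemma gf_homo s t : 0 <= s -> s <= t -> t <= 1 -> gf s <= gf t.
Proof.
move=> s0 st t1; have t0 : 0 <= t by exact: le_trans st.
apply: le_rsum => [||k]; [apply: gf_cvg|apply: gf_cvg|]; rewrite ?s0 ?t0 ?t1 ?(le_trans st)//.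
by rewrite ler_wpM2l// lerXn2r.
Qed.

Lemma gf_ge0 s : 0 <= s <= 1 -> 0 <= gf s.
Proof.
move=> s01; apply: rsum_ge0; last exact: gf_cvg.
by move=> k; rewrite mulr_ge0 ?exprn_ge0//; case/andP: s01.
Qed.

Lemma gf0 : gf 0 = 0.
Proof.
rewrite /gf (_ : (fun k => _) = fun=> 0); last first.
  by apply/funext => k; rewrite expr0n mulr0.
have c0 : cvgn (series (fun=> 0 : R)) by apply: (@nonneg_series_cvg _ _ 0) => // N; rewrite big1.
apply/eqP; rewrite eq_le; apply/andP; split.
  by apply: rsum_le => // N; rewrite big1.
exact: rsum_ge0.
Qed.

Lemma deriv_term_ge0 s k : 0 <= s -> 0 <= k.+1%:R * u k * s ^+ k.
Proof. by move=> s0; rewrite !mulr_ge0 ?exprn_ge0. Qed.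

Lemma gf_deriv_cvg s : 0 <= s -> has_gf_deriv s ->
  cvgn (series (fun k => k.+1%:R * u k * s ^+ k)).
Proof.
move=> s0 [B hB]; apply: (@nonneg_series_cvg _ _ B) => // k.
exact: deriv_term_ge0.
Qed.

Lemma gf_deriv_ge0 s : 0 <= s -> has_gf_deriv s -> 0 <= gf_deriv s.
Proof.
move=> s0 hs; apply: rsum_ge0; last exact: gf_deriv_cvg.
by move=> k; exact: deriv_term_ge0.
Qed.

Lemma gf_diff_le s t : 0 <= s -> s <= t -> t <= 1 -> has_gf_deriv t ->
  gf t - gf s <= gf_deriv t * (t - s).
Proof.
move=> s0 st t1 ht; have t0 : 0 <= t by exact: le_trans st.
have cs : cvgn (series (fun k => u k * s ^+ k.+1)) by apply: gf_cvg; rewrite s0 (le_trans st).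
have ct : cvgn (series (fun k => u k * t ^+ k.+1)) by apply: gf_cvg; rewrite t0.
rewrite -rsumB//; apply: rsum_le => [|N]; first exact: is_cvg_seriesB.
apply: le_trans (_ : (\sum_(k < N) k.+1%:R * u k * t ^+ k) * (t - s) <= _).
  rewrite mulr_suml; apply: ler_sum => k _; rewrite -mulrBr.
  rewrite [leRHS](_ : _ = u k * (k.+1%:R * t ^+ k * (t - s))); last by ring.
  by rewrite ler_wpM2l//; exact: (expr_diff_le k.+1 s0 st).
rewrite ler_wpM2r ?subr_ge0//; apply: rsum_ge; last exact: gf_deriv_cvg.
by move=> k; exact: deriv_term_ge0.
Qed.

(** Strictness comes from k = 1, where the tangent bound exceeds the increment by exactly u_1 (t -
    s)^2. The partial sums run to N+2 so that this term is always included. *)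
Lemma gf_diff_lt s t : 0 <= s -> s < t -> t <= 1 -> has_gf_deriv t -> 0 < u 1%N ->
  gf t - gf s < gf_deriv t * (t - s).
Proof.
move=> s0 st t1 ht u1; have t0 : 0 <= t by exact: le_trans (ltW st).
have cs : cvgn (series (fun k => u k * s ^+ k.+1)).
  by apply: gf_cvg; rewrite s0 (le_trans (ltW st)).
have ct : cvgn (series (fun k => u k * t ^+ k.+1)) by apply: gf_cvg; rewrite t0.
have cd := gf_deriv_cvg t0 ht.
pose gap := u 1%N * (t - s) ^+ 2.
have gap0 : 0 < gap by rewrite mulr_gt0// exprn_gt0// subr_gt0.
apply: lt_le_trans (_ : gf t - gf s + gap <= _); first by rewrite ltrDl.
rewrite -lerBrDr -rsumB//; apply: rsum_le => [|N]; first exact: is_cvg_seriesB.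
have step2 K : \sum_(k < K.+2) (u k * t ^+ k.+1 - u k * s ^+ k.+1) <=
    (\sum_(k < K.+2) k.+1%:R * u k * t ^+ k) * (t - s) - gap.
  have H k : u k * t ^+ k.+1 - u k * s ^+ k.+1 <=
      k.+1%:R * u k * t ^+ k * (t - s) - (k == 1%N)%:R * gap.
    case: eqP => [->|_].
      by rewrite le_eqVlt; apply/orP; left; apply/eqP; rewrite /gap /=; ring.
    rewrite mul0r subr0 -mulrBr.
    rewrite [leRHS](_ : _ = u k * (k.+1%:R * t ^+ k * (t - s))); last by ring.
    by rewrite ler_wpM2l//; exact: (expr_diff_le k.+1 s0 (ltW st)).
  have E : gap = \sum_(k < K.+2) (k == 1%N :> nat)%:R * gap.
    by rewrite 2!big_ord_recl big1 => [|i _] /=; rewrite ?mul0r ?mul1r ?add0r ?addr0.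
  by rewrite [X in _ - X]E mulr_suml -sumrB; apply: ler_sum => k _; exact: H.
apply: le_trans (_ : _ <= \sum_(k < N.+2) (u k * t ^+ k.+1 - u k * s ^+ k.+1)) _.
  have T k : 0 <= u k * t ^+ k.+1 - u k * s ^+ k.+1.
    by rewrite -mulrBr mulr_ge0// subr_ge0 lerXn2r ?nnegrE ?(ltW st).
  by rewrite 2!big_ord_recr /= -addrA lerDl addr_ge0.
apply: le_trans (step2 N) _; rewrite lerD2r ler_wpM2r ?subr_ge0 ?(ltW st)//.
by apply: rsum_ge => // k; exact: deriv_term_ge0.
Qed.

(** The derivative at t is the limit of left secant slopes, even at t = 1. A truncation of the
    derivative series is within e of its sum, remains so at some s0 < t by continuity, and is
    nondecreasing in s. *)
Lemma gf_diff_ge t e : 0 < t <= 1 -> has_gf_deriv t -> 0 < e ->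
  exists2 s0, 0 < s0 < t & forall s, s0 <= s -> s <= t ->
    (gf_deriv t - e) * (t - s) <= gf t - gf s.
Proof.
move=> /andP[t0 t1] ht e0.
have cd := gf_deriv_cvg (ltW t0) ht.
have [N hN] : exists N, gf_deriv t - e < \sum_(k < N) k.+1%:R * u k * t ^+ k.
  apply: contrapT => h; suff : gf_deriv t <= gf_deriv t - e by lra.
  by apply: rsum_le => // N; rewrite leNgt; apply/negP => hN; apply: h; exists N.
have [s0 [/andP[s00 s0t] hs0]] : exists s0, 0 < s0 < t /\
    gf_deriv t - e < \sum_(k < N) k.+1%:R * u k * s0 ^+ k.
  apply: contrapT => h; move: hN; apply/negP; rewrite -leNgt.
  apply: (@polysum_le_left _ N (fun k => k.+1%:R * u k) id 0 t) => // s s0t.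
  by rewrite leNgt; apply/negP => hs; apply: h; exists s.
exists s0; first by rewrite s00.
move=> s s0s st; have s_ge0 : 0 <= s by apply: le_trans s0s; exact: ltW.
have cs : cvgn (series (fun k => u k * s ^+ k.+1)) by apply: gf_cvg; rewrite s_ge0 (le_trans st).
have ct : cvgn (series (fun k => u k * t ^+ k.+1)) by apply: gf_cvg; rewrite ltW.
rewrite -rsumB//.
apply: le_trans (_ : (\sum_(k < N) k.+1%:R * u k * s ^+ k) * (t - s) <= _).
  rewrite ler_wpM2r ?subr_ge0//; apply: le_trans (ltW hs0) _; apply: ler_sum => k _.
  by rewrite ler_wpM2l ?mulr_ge0// lerXn2r ?nnegrE// ltW.
apply: le_trans (_ : \sum_(k < N) (u k * t ^+ k.+1 - u k * s ^+ k.+1) <= _).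
  rewrite mulr_suml; apply: ler_sum => k _; rewrite -mulrBr.
  rewrite [leLHS](_ : _ = u k * (k.+1%:R * s ^+ k * (t - s))); last by ring.
  by rewrite ler_wpM2l//; exact: (expr_diff_ge k.+1 s_ge0 st).
apply: rsum_ge => [k|]; last exact: is_cvg_seriesB.
by rewrite -mulrBr mulr_ge0// subr_ge0 lerXn2r ?nnegrE// ltW.
Qed.

(** The quantity (k+1) s^k (1 - s) + s^(k+1) is 1 at k = 0 and decreases by (k+1) s^k (1 - s)^2 at
    each step. *)
Lemma geometric_weight k s : 0 <= s < 1 -> k.+1%:R * s ^+ k <= (1 - s)^-1.
Proof.
move=> /andP[s0 s1]; rewrite -[leRHS]mul1r ler_pdivlMr ?subr_gt0//.
suff : k.+1%:R * s ^+ k * (1 - s) + s ^+ k.+1 <= 1.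
  by have : 0 <= s ^+ k.+1; [exact: exprn_ge0|lra].
elim: k => [|k IHk]; first by rewrite expr0 expr1; lra.
apply: le_trans IHk; rewrite -subr_ge0 -[k.+2%:R]natr1.
rewrite [X in 0 <= X](_ : _ = k.+1%:R * s ^+ k * (1 - s) ^+ 2); last by rewrite !exprS; ring.
by apply: mulr_ge0; [apply: mulr_ge0 => //; exact: exprn_ge0|exact: sqr_ge0].
Qed.

Lemma u_le k : u k <= M.
Proof.
by apply: le_trans (u_bounded k.+1); rewrite big_ord_recr /= lerDr sumr_ge0.
Qed.

Lemma has_gf_deriv_lt1 s : 0 <= s < 1 -> has_gf_deriv s.
Proof.
move=> s01; exists ((1 - s)^-1 * M) => N.
apply: le_trans (ler_wpM2l _ (u_bounded N)).
  rewrite mulr_sumr; apply: ler_sum => k _; rewrite mulrAC ler_wpM2r//.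
  exact: geometric_weight.
by rewrite invr_ge0; case/andP: s01 => _ s1; lra.
Qed.

(* [1 / gf_W] is [Phi - t Phi'] at the point of parameter s. *)
Definition gf_W s := 1 - gf s + s * gf_deriv s.

(** This is W - 1: subtracting U from s U' lowers the weight k+1 to k, so the coefficients are
    nonnegative and W is monotone. *)
Definition gf_excess s : R := rsum (fun k => k%:R * u k * s ^+ k.+1).

Lemma gf_excess_cvg s : 0 <= s -> has_gf_deriv s ->
  cvgn (series (fun k => k%:R * u k * s ^+ k.+1)).
Proof.
move=> s0 [B hB]; apply: (@nonneg_series_cvg _ _ (s * B)) => [k|N].
  by rewrite !mulr_ge0 ?exprn_ge0.
apply: le_trans (ler_wpM2l s0 (hB N)); rewrite mulr_sumr; apply: ler_sum => k _.
rewrite [leRHS](_ : _ = k.+1%:R * (u k * s ^+ k.+1)); last by rewrite exprS; ring.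
by rewrite -mulrA ler_wpM2r ?mulr_ge0 ?exprn_ge0// ler_nat.
Qed.

Lemma gf_WE s : 0 <= s <= 1 -> has_gf_deriv s -> gf_W s = 1 + gf_excess s.
Proof.
move=> s01 hs; have s0 : 0 <= s by case/andP: s01.
have ce := gf_excess_cvg s0 hs; have cg := gf_cvg s01.
suff -> : gf_excess s = s * gf_deriv s - gf s by rewrite /gf_W; ring.
rewrite /gf_deriv -rsumZ; last exact: gf_deriv_cvg.
rewrite -rsumB//.
  by congr rsum; apply/funext => k; rewrite -natr1 exprS; ring.
exact: (@is_cvg_seriesZ _ _ s (gf_deriv_cvg s0 hs)).
Qed.

Hypothesis mean_infinite : forall b, ~ (forall N, \sum_(k < N) k.+1%:R * u k <= b).

(** W - 1 vanishes at 0, and the infinite mean makes it unbounded near 1; intermediate values do the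
    rest. *)
Lemma gf_W_solve w : 1 < w -> exists2 s, 0 < s < 1 & gf_W s = w.
Proof.
move=> w1.
have [N hN] : exists N, w - 1 < \sum_(k < N) k%:R * u k.
  apply: contrapT => h; apply: (@mean_infinite (w - 1 + M)) => N.
  rewrite (eq_bigr (fun k : 'I_N => k%:R * u k + u k)) => [|k _]; last by rewrite -natr1; ring.
  rewrite big_split; apply: lerD; last exact: u_bounded.
  by rewrite leNgt; apply/negP => hN; apply: h; exists N.
have [s [/andP[s0 s1] hs]] : exists s, 0 < s < 1 /\
    w - 1 < \sum_(k < N) k%:R * u k * s ^+ k.+1.
  apply: contrapT => h; move: hN; apply/negP; rewrite -leNgt.
  under eq_bigr => k _ do rewrite -[_ * _]mulr1 -[X in _ * X](expr1n _ k.+1).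
  apply: (@polysum_le_left _ N (fun k => k%:R * u k) S 0 1) => // s s01.
  by rewrite leNgt; apply/negP => hs; apply: h; exists s.
(* Chosen so that s <= y^3 < 1, by the tangent to the cube at 1. On [0, y^3] the increments have
   weights k (k+1) y^(3k); two factors y^k absorb k and k+1, giving the Lipschitz constant M / (1 -
   y)^2. *)
pose y := (s + 2) / 3.
have y0 : 0 < y by rewrite /y; lra.
have y1 : y < 1 by rewrite /y; lra.
have sy : s <= y ^+ 3.
  have -> : s = 3 * y - 2 by rewrite /y; field.
  by rewrite -subr_ge0 [X in 0 <= X](_ : _ = (y - 1) ^+ 2 * (y + 2));
    [rewrite mulr_ge0 ?sqr_ge0//; lra|ring].
have y3 : y ^+ 3 < 1 by rewrite exprn_ilt1// ltW.
have y30 : 0 <= y ^+ 3 by rewrite exprn_ge0// ltW.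
have z01 t : 0 <= t -> t <= y ^+ 3 -> 0 <= t < 1 by move=> -> /le_lt_trans ->.
have hd t : 0 <= t -> t <= y ^+ 3 -> has_gf_deriv t by move=> t0 ty; exact/has_gf_deriv_lt1/z01.
pose K := M * (1 - y)^-1 ^+ 2.
have M0 : 0 <= M by apply: le_trans (u_le 0%N).
have K0 : 0 <= K by rewrite mulr_ge0 ?sqr_ge0.
have [c /andP[c0 cy] cw] : exists2 c, 0 <= c <= y ^+ 3 & gf_excess c = w - 1.
  apply: (@lipschitz_IVT _ _ _ _ _ K) => //.
    move=> a b a0 ab by_; have b0 : 0 <= b by exact: le_trans ab.
    have ca := gf_excess_cvg a0 (hd _ a0 (le_trans ab by_)).
    have cb := gf_excess_cvg b0 (hd _ b0 by_).
    apply/andP; split.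
      by apply: le_rsum => // k; rewrite ler_wpM2l ?mulr_ge0// lerXn2r.
    rewrite -lerBlDl -rsumB//; apply: rsum_le => [|L]; first exact: is_cvg_seriesB.
    apply: le_trans (_ : \sum_(k < L) u k * ((1 - y)^-1 ^+ 2 * (b - a)) <= _); last first.
      by rewrite -mulr_suml mulrA ler_wpM2r ?subr_ge0// ler_wpM2r ?sqr_ge0.
    apply: ler_sum => k _; rewrite -mulrBr.
    rewrite [leLHS](_ : _ = u k * (k%:R * (b ^+ k.+1 - a ^+ k.+1))); last by ring.
    rewrite ler_wpM2l//; apply: le_trans (_ : k%:R * (k.+1%:R * b ^+ k * (b - a)) <= _).
      by rewrite ler_wpM2l//; exact: (expr_diff_le k.+1 a0 ab).
    rewrite !mulrA ler_wpM2r ?subr_ge0//.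
    have yk0 : 0 <= y ^+ k by rewrite exprn_ge0// ltW.
    have g := @geometric_weight k y; rewrite (ltW y0) y1 in g; have {}g := g isT.
    apply: le_trans (_ : k.+1%:R * k.+1%:R * (y ^+ k * y ^+ k) <= _).
      apply: ler_pM; rewrite ?mulr_ge0 ?exprn_ge0//; first by rewrite ler_wpM2r// ler_nat.
      apply: le_trans (_ : (y ^+ 3) ^+ k <= _); first by rewrite lerXn2r.
      have -> : (y ^+ 3) ^+ k = (y ^+ k * y ^+ k) * y ^+ k.
        by rewrite -exprM mulnC exprM; ring.
      by rewrite ler_piMr ?mulr_ge0// expr01_le1// (ltW y0) (ltW y1).
    rewrite mulrACA expr2 ler_pM ?mulr_ge0//.
  apply/andP; split.
    rewrite /gf_excess (_ : (fun k => _) = fun k => 0 * (k%:R * u k * 0 ^+ k.+1)).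
      rewrite rsumZ ?mul0r; first by rewrite subr_ge0 ltW.
      exact: (gf_excess_cvg (lexx _) (hd _ (lexx _) y30)).
    by apply/funext => k; rewrite expr0n mulr0 mul0r.
  apply: le_trans (ltW hs) _; apply: le_trans (_ : \sum_(k < N) k%:R * u k * (y ^+ 3) ^+ k.+1 <= _).
    by apply: ler_sum => k _; rewrite ler_wpM2l ?mulr_ge0// lerXn2r ?nnegrE// ltW.
  apply: rsum_ge => [k|]; first by apply: mulr_ge0; [exact: mulr_ge0|exact: exprn_ge0].
  exact: (gf_excess_cvg y30 (hd _ y30 (lexx _))).
have c1 : c < 1 by exact: le_lt_trans y3.
have hc := hd _ c0 cy.
have c01 : 0 <= c <= 1 by rewrite c0 ltW.
have WE : gf_W c = w by rewrite gf_WE// cw; ring.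
exists c => //; rewrite c1 andbT lt_neqAle c0 andbT; apply/eqP => c00.
by move: WE; rewrite -c00 /gf_W gf0 mul0r; lra.
Qed.

End GeneratingFunction.

(** * The critical parameters *)

Section CriticalPoint.
Local Open Scope ring_scope.
Variables (R : realType) (u1 u2 : nat -> R) (M1 M2 : R).
Implicit Types s t : R.
Hypotheses (u1_ge0 : forall k, 0 <= u1 k) (u2_ge0 : forall k, 0 <= u2 k).
Hypothesis u1_bounded : forall N, \sum_(k < N) u1 k <= M1.
Hypothesis u2_bounded : forall N, \sum_(k < N) u2 k <= M2.
Hypothesis gap1 : forall s, 0 <= s <= 1 -> 0 < 1 - gf u1 s.
Hypothesis gap2 : forall s, 0 <= s <= 1 -> 0 < 1 - gf u2 s.
Hypothesis deriv2 : has_gf_deriv u2 1.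
Hypothesis u2_1 : 0 < u2 1%N.

Lemma gf_W_gt1 : 1 < gf_W u2 1.
Proof.
have := gf_diff_lt u2_ge0 u2_bounded (lexx 0) ltr01 (lexx 1) deriv2 u2_1.
by rewrite gf0 /gf_W; lra.
Qed.

Lemma critical_exists : (forall b, ~ (forall N, \sum_(k < N) k.+1%:R * u1 k <= b)) ->
  exists2 s, 0 < s < 1 & (gf_W u1 s)^-1 + (gf_W u2 1)^-1 = 1.
Proof.
move=> inf1; have W2 := gf_W_gt1; set w := gf_W u2 1 in W2 *.
have [|s s01 hs] := @gf_W_solve _ u1 M1 u1_ge0 u1_bounded inf1 (w / (w - 1)).
  by rewrite ltr_pdivlMr; lra.
exists s => //; rewrite hs; field.
by apply/andP; split; lra.
Qed.

Variable sb : R.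
Hypothesis sb01 : 0 < sb < 1.
Hypothesis critical : (gf_W u1 sb)^-1 + (gf_W u2 1)^-1 = 1.

Let sb0 : 0 < sb. Proof. by case/andP: sb01. Qed.
Let sb1 : sb < 1. Proof. by case/andP: sb01. Qed.

Definition ret1 s : R := 1 - gf u1 s.
Definition ret2 s : R := 1 - gf u2 s.
Definition crit_alpha : R := ret2 1 / (ret1 sb / sb + ret2 1).
Local Notation alpha := crit_alpha.

(* The reciprocals of t = r G(r) and of r at the parameters s1, s. *)
Definition inv_t s : R := (1 - alpha) * ret2 s / s.
Definition inv_r s1 s : R := alpha / s1 + (1 - alpha) / s - inv_t s.
Definition Phi s1 s : R := (ret1 s1)^-1 + (ret2 s)^-1 - 1.
Definition partner s1 s := alpha * ret1 s1 / s1 = inv_t s.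

Let ab0 : 0 < ret1 sb. Proof. by apply: gap1; rewrite !ltW. Qed.
Let bb0 : 0 < ret2 1. Proof. by apply: gap2; rewrite ler01 lexx. Qed.
Let den0 : 0 < ret1 sb / sb + ret2 1. Proof. by rewrite addr_gt0// divr_gt0. Qed.

Lemma crit_alpha_gt0 : 0 < alpha. Proof. exact: divr_gt0. Qed.

Lemma crit_alpha_lt1 : alpha < 1.
Proof. by rewrite /crit_alpha ltr_pdivrMr// mul1r ltrDr divr_gt0. Qed.

Let a0 := crit_alpha_gt0.
Let a1 : 0 < 1 - alpha. Proof. by rewrite subr_gt0 crit_alpha_lt1. Qed.

Lemma crit_partner : partner sb 1.
Proof.
rewrite /partner /inv_t /crit_alpha divr1.
set A := ret1 sb; set B := ret2 1; set C := A / sb + B.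
have C0 : C != 0 by rewrite gt_eqF.
have -> : 1 - B / C = A / sb / C by rewrite -[1](divff C0) -mulrBl /C addrK.
by rewrite /C; ring.
Qed.

Lemma ret1_homo s t : 0 <= s -> s <= t -> t <= 1 -> ret1 t <= ret1 s.
Proof. by move=> *; rewrite lerD2l lerN2; apply: gf_homo u1_ge0 u1_bounded _ _ _ _ _. Qed.

Lemma ret2_homo s t : 0 <= s -> s <= t -> t <= 1 -> ret2 t <= ret2 s.
Proof. by move=> *; rewrite lerD2l lerN2; apply: gf_homo u2_ge0 u2_bounded _ _ _ _ _. Qed.

Lemma ret1_le1 s : 0 <= s <= 1 -> ret1 s <= 1.
Proof. by move=> s01; rewrite gerBl; apply: gf_ge0 u1_ge0 u1_bounded _ _. Qed.

Lemma ret2_le1 s : 0 <= s <= 1 -> ret2 s <= 1.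
Proof. by move=> s01; rewrite gerBl; apply: gf_ge0 u2_ge0 u2_bounded _ _. Qed.

Lemma inv_t_gt0 s : 0 < s <= 1 -> 0 < inv_t s.
Proof.
by move=> /andP[s0 s1]; rewrite divr_gt0// mulr_gt0// gap2// (ltW s0).
Qed.

Lemma inv_t_gt s : 0 < s < 1 -> inv_t 1 < inv_t s.
Proof.
move=> /andP[s0 s1]; rewrite /inv_t divr1 ltr_pdivlMr// -mulrA ltr_pM2l//.
apply: lt_le_trans (ret2_homo (ltW s0) (ltW s1) (lexx 1)).
by rewrite gtr_pMr.
Qed.

(** Cleared of its denominator, the equation is U_1(x) + lam x = 1 with lam = inv_t s / alpha. The
    left side is 0 at 0, and exceeds 1 at sb because inv_t s > inv_t 1. *)
Lemma partner_exists s : 0 < s < 1 -> exists2 s1, 0 < s1 < sb & partner s1 s.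
Proof.
move=> s01; have it := inv_t_gt s01.
have s01' : 0 < s <= 1 by case/andP: s01 => -> /ltW ->.
pose lam := inv_t s / alpha.
have lam0 : 0 < lam by rewrite divr_gt0// inv_t_gt0.
have lamb : ret1 sb < lam * sb.
  rewrite /lam mulrAC ltr_pdivlMr// mulrC -ltr_pdivrMr//.
  by have := crit_partner; rewrite /partner => ->.
have hd : has_gf_deriv u1 sb by apply: has_gf_deriv_lt1 u1_ge0 u1_bounded _ _; rewrite ltW.
have D0 := gf_deriv_ge0 u1_ge0 (ltW sb0) hd.
have [||||s1 /andP[s10 s1b] e] := @lipschitz_IVT _ (fun x => gf u1 x + lam * x) 0 sb 1
    (gf_deriv u1 sb + lam).
- exact: ltW.
- by rewrite addr_ge0// ltW.
- move=> x y x0 xy yb; have y0 : 0 <= y by exact: le_trans xy.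
  have y1 : y <= 1 by exact: le_trans (ltW sb1).
  have g1 := gf_homo u1_ge0 u1_bounded x0 xy y1.
  have hy : has_gf_deriv u1 y.
    by apply: has_gf_deriv_lt1 u1_ge0 u1_bounded _ _; rewrite y0 (le_lt_trans yb).
  have g2 := gf_diff_le u1_ge0 u1_bounded x0 xy y1 hy.
  have g3 : gf_deriv u1 y <= gf_deriv u1 sb.
    apply: le_rsum; [exact: gf_deriv_cvg|exact: (gf_deriv_cvg u1_ge0 (ltW sb0) hd)|move=> k].
    by rewrite ler_wpM2l ?mulr_ge0// lerXn2r ?nnegrE ?(ltW sb0).
  have yx : 0 <= y - x by rewrite subr_ge0.
  have g4 := ler_wpM2r yx g3; have g5 := mulr_ge0 (ltW lam0) yx.
  by apply/andP; split; lra.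
- rewrite gf0 mulr0 addr0 ler01 /=; move: lamb; rewrite /ret1; lra.
have s1n : s1 != 0 by apply/eqP => z; move: e; rewrite z gf0 mulr0; lra.
exists s1.
  rewrite lt_neqAle eq_sym s1n s10 /= lt_neqAle s1b andbT.
  by apply/eqP => z; move: e lamb; rewrite z /ret1; lra.
rewrite /partner /ret1 (_ : 1 - gf u1 s1 = lam * s1); last by rewrite -e; ring.
by rewrite /lam; field; rewrite s1n gt_eqF.
Qed.

Section Secant.
Variables s1 s : R.
Hypotheses (s1_bd : 0 < s1 < sb) (s_bd : 0 < s < 1) (s1s : partner s1 s).

Let s10 : 0 < s1. Proof. by case/andP: s1_bd. Qed.
Let s1b : s1 < sb. Proof. by case/andP: s1_bd. Qed.
Let s0 : 0 < s. Proof. by case/andP: s_bd. Qed.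
Let s_lt1 : s < 1. Proof. by case/andP: s_bd. Qed.
Let r10 : 0 < ret1 s1. Proof. by apply: gap1; rewrite !ltW// (lt_trans s1b). Qed.
Let r20 : 0 < ret2 s. Proof. by apply: gap2; rewrite !ltW. Qed.
Let k0 : 0 < inv_t s. Proof. by apply: inv_t_gt0; rewrite s0 ltW. Qed.
Let kb0 : 0 < inv_t 1. Proof. by apply: inv_t_gt0; rewrite ltr01 lexx. Qed.

Definition slope1 := (ret1 s1 - ret1 sb) / (sb - s1).
Definition slope2 := (ret2 s - ret2 1) / (1 - s).
(** The expression 1 / W_1(sb) + 1 / W_2(1) - 1 with slopes for derivatives; the factor 1 keeps the
    two sides parallel. *)
Definition secant_gap := (ret1 sb + sb * slope1)^-1 + (ret2 1 + 1 * slope2)^-1 - 1.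

Lemma slope1_ge0 : 0 <= slope1.
Proof.
rewrite divr_ge0 ?subr_ge0 ?(ltW s1b)//.
by apply: ret1_homo; rewrite ?(ltW s10) ?(ltW s1b) ?(ltW sb1).
Qed.

Lemma slope2_ge0 : 0 <= slope2.
Proof.
rewrite divr_ge0 ?subr_ge0 ?(ltW s_lt1)//.
by apply: ret2_homo; rewrite ?(ltW s0) ?(ltW s_lt1).
Qed.

(* With the secant slope [be] in place of the derivative, the tangent inequality
   for the convex function Phi becomes an identity. *)
Lemma secant_one_side (al x y a b t T be : R) : 0 < al -> 0 < a -> 0 < b ->
  0 < T -> 0 < b + y * be -> x = al * a * t -> y = al * b * T -> a - b = be * (y - x) ->
  T * (b^-1 - a^-1) = (T - t) * (b^-1 - (b + y * be)^-1).
Proof.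
move=> al0 aa0 b0 T0 w0 xE yE ab.
have -> : b^-1 - a^-1 = (a - b) / (a * b) by field; rewrite !gt_eqF.
have -> : b^-1 - (b + y * be)^-1 = y * be / (b * (b + y * be)) by field; rewrite !gt_eqF.
have key : (a - b) * (b + y * be) = be * (T - t) * al * a * b.
  transitivity (be * ((y - x) * b + y * (a - b))).
    by rewrite ab; ring.
  by rewrite {1}yE xE yE; ring.
set w := b + y * be in w0 key *; clearbody w.
transitivity (T * ((a - b) * w) / (a * b * w)); first by field; rewrite !gt_eqF.
by rewrite key yE; field; rewrite !gt_eqF.
Qed.

Lemma inv_r_Phi : inv_r s1 s = inv_t s * Phi s1 s.
Proof.
have e1 : alpha / s1 = inv_t s / ret1 s1.
  by rewrite -s1s; field; rewrite !gt_eqF.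
have e2 : (1 - alpha) / s = inv_t s / ret2 s.
  by rewrite /inv_t; field; rewrite !gt_eqF.
by rewrite /inv_r e1 e2 /Phi; ring.
Qed.

Lemma inv_r_Phi_crit : inv_r sb 1 = inv_t 1 * Phi sb 1.
Proof.
have e1 : alpha / sb = inv_t 1 / ret1 sb.
  by rewrite -crit_partner; field; rewrite !gt_eqF.
have e2 : (1 - alpha) / 1 = inv_t 1 / ret2 1.
  by rewrite /inv_t; field; rewrite !gt_eqF.
by rewrite /inv_r e1 e2 /Phi; ring.
Qed.

Lemma Phi_ge1 : 1 <= Phi s1 s.
Proof.
have h1 : 1 <= (ret1 s1)^-1.
  by rewrite invf_ge1//; apply: ret1_le1; rewrite !ltW// (lt_trans s1b).
have h2 : 1 <= (ret2 s)^-1 by rewrite invf_ge1//; apply: ret2_le1; rewrite !ltW.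
by rewrite /Phi; lra.
Qed.

Lemma Phi_crit_ge1 : 1 <= Phi sb 1.
Proof.
have h1 : 1 <= (ret1 sb)^-1 by rewrite invf_ge1//; apply: ret1_le1; rewrite !ltW.
have h2 : 1 <= (ret2 1)^-1 by rewrite invf_ge1//; apply: ret2_le1; rewrite ler01 lexx.
by rewrite /Phi; lra.
Qed.

Let T := (inv_t 1)^-1.
Let t := (inv_t s)^-1.
Let w10 : 0 < ret1 sb + sb * slope1.
Proof. by rewrite ltr_wpDr// mulr_ge0 ?slope1_ge0// ltW. Qed.
Let w20 : 0 < ret2 1 + 1 * slope2.
Proof. by rewrite ltr_wpDr// mulr_ge0 ?slope2_ge0. Qed.

Lemma secant_side1 : T * ((ret1 sb)^-1 - (ret1 s1)^-1) =
  (T - t) * ((ret1 sb)^-1 - (ret1 sb + sb * slope1)^-1).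
Proof.
apply: (@secant_one_side alpha s1); rewrite ?invr_gt0//.
- by rewrite /t -s1s; field; rewrite !gt_eqF.
- by rewrite /T -crit_partner; field; rewrite !gt_eqF.
- by rewrite /slope1 divfK// subr_eq0 gt_eqF.
Qed.

Lemma secant_side2 : T * ((ret2 1)^-1 - (ret2 s)^-1) =
  (T - t) * ((ret2 1)^-1 - (ret2 1 + 1 * slope2)^-1).
Proof.
apply: (@secant_one_side (1 - alpha) s); rewrite ?invr_gt0//.
- by rewrite /t /inv_t; field; rewrite !gt_eqF.
- by rewrite /T /inv_t; field; rewrite !gt_eqF.
- by rewrite /slope2 divfK// subr_eq0 gt_eqF.
Qed.

Lemma secant_Phi : T * (Phi sb 1 - Phi s1 s) = (T - t) * (Phi sb 1 - secant_gap).
Proof.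
rewrite [RHS](_ : _ = (T - t) * ((ret1 sb)^-1 - (ret1 sb + sb * slope1)^-1) +
  (T - t) * ((ret2 1)^-1 - (ret2 1 + 1 * slope2)^-1)); last first.
  by rewrite /Phi /secant_gap; ring.
by rewrite -secant_side1 -secant_side2 /Phi; ring.
Qed.

(** The secant form of dr/dt = (Phi - t Phi') / Phi^2, obtained from r = t / Phi at both ends. *)
Lemma secant_radius :
  ((inv_r sb 1)^-1 - (inv_r s1 s)^-1) * (Phi s1 s * Phi sb 1) = (T - t) * secant_gap.
Proof.
have P1 := Phi_ge1; have P2 := Phi_crit_ge1.
have -> : ((inv_r sb 1)^-1 - (inv_r s1 s)^-1) * (Phi s1 s * Phi sb 1) =
    T * Phi s1 s - t * Phi sb 1.
  rewrite inv_r_Phi inv_r_Phi_crit /T /t; field.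
  by apply/and4P; split; rewrite gt_eqF//; lra.
have e : T * Phi s1 s = T * Phi sb 1 - (T - t) * (Phi sb 1 - secant_gap).
  by rewrite -secant_Phi; ring.
by rewrite e; ring.
Qed.

Lemma T_gt_t : t < T.
Proof. by rewrite ltf_pV2 ?posrE//; exact: inv_t_gt. Qed.

Let hd1 : has_gf_deriv u1 sb.
Proof. by apply: has_gf_deriv_lt1 u1_ge0 u1_bounded _ _; rewrite ltW. Qed.

Lemma slope1_le : slope1 <= gf_deriv u1 sb.
Proof.
rewrite ler_pdivrMr ?subr_gt0//.
have := gf_diff_le u1_ge0 u1_bounded (ltW s10) (ltW s1b) (ltW sb1) hd1.
by rewrite /ret1; lra.
Qed.

Lemma slope2_lt : slope2 < gf_deriv u2 1.
Proof.
rewrite ltr_pdivrMr ?subr_gt0//.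
have := gf_diff_lt u2_ge0 u2_bounded (ltW s0) s_lt1 (lexx 1) deriv2 u2_1.
by rewrite /ret2; lra.
Qed.

(** With derivatives in place of slopes the gap is 0 by criticality. Slopes lie below derivatives,
    strictly so on the second side. *)
Lemma secant_gap_gt0 : 0 < secant_gap.
Proof.
have h1 : (gf_W u1 sb)^-1 <= (ret1 sb + sb * slope1)^-1.
  rewrite lef_pV2 ?posrE//; last by apply: lt_le_trans w10 _; rewrite lerD2l ler_pM2l// slope1_le.
  by rewrite lerD2l ler_pM2l// slope1_le.
have h2 : (gf_W u2 1)^-1 < (ret2 1 + 1 * slope2)^-1.
  rewrite ltf_pV2 ?posrE//; last by apply: lt_trans gf_W_gt1.
  by rewrite ltrD2l ltr_pM2l// slope2_lt.
by rewrite /secant_gap; move: critical; lra.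
Qed.

Lemma inv_r_crit_lt : inv_r sb 1 < inv_r s1 s.
Proof.
have P1 := Phi_ge1; have P2 := Phi_crit_ge1.
have q1 : 0 < inv_r s1 s by rewrite inv_r_Phi mulr_gt0//; lra.
have q2 : 0 < inv_r sb 1 by rewrite inv_r_Phi_crit mulr_gt0//; lra.
rewrite -ltf_pV2 ?posrE// -subr_gt0.
have P0 : 0 < Phi s1 s * Phi sb 1 by rewrite mulr_gt0//; lra.
by rewrite -(pmulr_lgt0 _ P0) secant_radius mulr_gt0 ?secant_gap_gt0// subr_gt0 T_gt_t.
Qed.

Lemma secant_gap_le e : gf_deriv u1 sb - e <= slope1 -> gf_deriv u2 1 - e <= slope2 ->
  0 <= e -> secant_gap <= e * ((ret1 sb)^-1 ^+ 2 + (ret2 1)^-1 ^+ 2).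
Proof.
move=> h1 h2 e0.
have side (b y be D : R) : 0 < b -> 0 <= y <= 1 -> 0 <= be -> be <= D -> D - e <= be ->
    (b + y * be)^-1 - (b + y * D)^-1 <= e * b^-1 ^+ 2.
  move=> b0 /andP[y0 y1] be0 beD De.
  have w : b <= b + y * be by rewrite lerDl mulr_ge0.
  have W : b <= b + y * D by rewrite lerDl mulr_ge0// (le_trans be0).
  have w0 := lt_le_trans b0 w; have W0 := lt_le_trans b0 W.
  have -> : (b + y * be)^-1 - (b + y * D)^-1 = y * (D - be) * ((b + y * be)^-1 * (b + y * D)^-1).
    by field; rewrite !gt_eqF.
  have Db : 0 <= D - be by rewrite subr_ge0.
  apply: ler_pM; rewrite ?mulr_ge0 ?invr_ge0 ?(ltW w0) ?(ltW W0)//.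
    by rewrite -[leRHS]mul1r; apply: ler_pM => //; lra.
  by rewrite expr2 ler_pM ?invr_ge0 ?(ltW w0) ?(ltW W0)// lef_pV2 ?posrE.
have d1 : slope1 <= gf_deriv u1 sb by exact: slope1_le.
have d2 : slope2 <= gf_deriv u2 1 by exact/ltW/slope2_lt.
have sb_le1 : 0 <= sb <= 1 by rewrite !ltW.
have l01 : 0 <= (1 : R) <= 1 by rewrite ler01 lexx.
have k1 := side _ _ _ _ ab0 sb_le1 slope1_ge0 d1 h1.
have k2 := side _ _ _ _ bb0 l01 slope2_ge0 d2 h2.
move: critical; rewrite /gf_W -/(ret1 sb) -/(ret2 1) /secant_gap mulrDr; lra.
Qed.

(** A bound for alpha (T - t) / (1 - s), which in turn bounds (sb - s1) / (1 - s). *)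
Definition partner_lip := alpha * (ret2 1 + gf_deriv u2 1) / ((1 - alpha) * ret2 1 ^+ 2).

Lemma partner_lip_ge0 : 0 <= partner_lip.
Proof.
have D2 := gf_deriv_ge0 u2_ge0 ler01 deriv2.
apply: divr_ge0; apply: mulr_ge0; rewrite ?sqr_ge0//; [exact: ltW| |exact: ltW].
by apply: addr_ge0 => //; exact: ltW.
Qed.

(* Both sides of the comparison are expressed through T - t. *)
Lemma partner_close : sb - s1 <= partner_lip * (1 - s).
Proof.
have e1 : (T - t) * (alpha * ret1 s1 * ret1 sb) = (sb - s1) * (ret1 sb + sb * slope1).
  have sl : slope1 * (sb - s1) = ret1 s1 - ret1 sb by rewrite /slope1 divfK// subr_eq0 gt_eqF.
  transitivity ((sb - s1) * ret1 sb + sb * (slope1 * (sb - s1))); last by ring.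
  rewrite sl /T /t -s1s -crit_partner.
  by field; rewrite !gt_eqF.
have e2 : (T - t) * ((1 - alpha) * ret2 s * ret2 1) = (1 - s) * (ret2 1 + 1 * slope2).
  have sl : slope2 * (1 - s) = ret2 s - ret2 1 by rewrite /slope2 divfK// subr_eq0 gt_eqF.
  transitivity ((1 - s) * ret2 1 + 1 * (slope2 * (1 - s))); last by ring.
  rewrite sl /T /t /inv_t.
  by field; rewrite !gt_eqF.
have Tt : 0 < T - t by rewrite subr_gt0 T_gt_t.
have m1 : ret1 s1 <= 1 by apply: ret1_le1; rewrite !ltW// (lt_trans s1b).
have m2 : ret2 1 <= ret2 s by exact: ret2_homo (ltW s0) (ltW s_lt1) (lexx 1).
have f1 : sb - s1 <= (T - t) * alpha.
  have h : (sb - s1) * ret1 sb <= (T - t) * alpha * ret1 sb.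
    apply: le_trans (_ : (sb - s1) * (ret1 sb + sb * slope1) <= _).
      by rewrite ler_wpM2l ?subr_ge0 ?(ltW s1b)// lerDl mulr_ge0 ?slope1_ge0 ?ltW.
    have m3 : ret1 s1 * ret1 sb <= ret1 sb by rewrite ler_piMl// ltW.
    rewrite -e1 [leLHS](_ : _ = (T - t) * alpha * (ret1 s1 * ret1 sb)); last by ring.
    by apply: ler_wpM2l => //; apply: mulr_ge0; exact: ltW.
  by move: h; rewrite ler_pM2r.
have f2 : (T - t) * ((1 - alpha) * ret2 1 ^+ 2) <= (1 - s) * (ret2 1 + gf_deriv u2 1).
  apply: le_trans (_ : (1 - s) * (ret2 1 + 1 * slope2) <= _); last first.
    by rewrite ler_wpM2l ?subr_ge0 ?(ltW s_lt1)// mul1r lerD2l ltW// slope2_lt.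
  rewrite -e2; apply: ler_wpM2l; first exact: ltW.
  rewrite -mulrA expr2; apply: ler_wpM2l; first exact: ltW.
  by apply: ler_wpM2r => //; exact: ltW.
apply: le_trans f1 _; rewrite /partner_lip mulrAC ler_pdivlMr ?mulr_gt0 ?exprn_gt0//.
have := ler_wpM2l (ltW a0) f2; lra.
Qed.

Lemma Phi_crit_close : Phi sb 1 - Phi s1 s <=
  (gf_deriv u1 sb * partner_lip / ret1 sb ^+ 2 + gf_deriv u2 1 / ret2 1 ^+ 2) * (1 - s).
Proof.
have side (b a D x : R) : 0 < b -> b <= a -> a - b <= D * x -> 0 <= D -> 0 <= x ->
    b^-1 - a^-1 <= D * x / b ^+ 2.
  move=> b0 ba abD D0 x0; have aa0 := lt_le_trans b0 ba.
  have -> : b^-1 - a^-1 = (a - b) * (b^-1 * a^-1) by field; rewrite !gt_eqF.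
  apply: ler_pM; rewrite ?subr_ge0 ?mulr_ge0 ?invr_ge0 ?(ltW b0) ?(ltW aa0)//.
  by rewrite expr2 invfM ler_wpM2l ?invr_ge0 ?(ltW b0)// lef_pV2 ?posrE.
have D1 := gf_deriv_ge0 u1_ge0 (ltW sb0) hd1.
have D2 := gf_deriv_ge0 u2_ge0 ler01 deriv2.
have m1 : ret1 sb <= ret1 s1 by exact: ret1_homo (ltW s10) (ltW s1b) (ltW sb1).
have m2 : ret2 1 <= ret2 s by exact: ret2_homo (ltW s0) (ltW s_lt1) (lexx 1).
have g1 : ret1 s1 - ret1 sb <= gf_deriv u1 sb * (sb - s1).
  have := gf_diff_le u1_ge0 u1_bounded (ltW s10) (ltW s1b) (ltW sb1) hd1.
  by rewrite /ret1; lra.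
have g2 : ret2 s - ret2 1 <= gf_deriv u2 1 * (1 - s).
  have := gf_diff_le u2_ge0 u2_bounded (ltW s0) (ltW s_lt1) (lexx 1) deriv2.
  by rewrite /ret2; lra.
have x1 : 0 <= sb - s1 by rewrite subr_ge0 ltW.
have x2 : 0 <= 1 - s by rewrite subr_ge0 ltW.
have k1 := side _ _ _ _ ab0 m1 g1 D1 x1.
have k2 := side _ _ _ _ bb0 m2 g2 D2 x2.
have k3 : gf_deriv u1 sb * (sb - s1) / ret1 sb ^+ 2 <=
    gf_deriv u1 sb * (partner_lip * (1 - s)) / ret1 sb ^+ 2.
  by rewrite ler_wpM2r ?invr_ge0 ?sqr_ge0// ler_wpM2l// partner_close.
rewrite /Phi mulrDl.
have -> : gf_deriv u1 sb * partner_lip / ret1 sb ^+ 2 * (1 - s) =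
  gf_deriv u1 sb * (partner_lip * (1 - s)) / ret1 sb ^+ 2 by ring.
have -> : gf_deriv u2 1 / ret2 1 ^+ 2 * (1 - s) = gf_deriv u2 1 * (1 - s) / ret2 1 ^+ 2 by ring.
lra.
Qed.

(* A bounded difference quotient K of r |-> G(r) would bound secant_gap below. *)
Lemma quotient_bound K : 0 <= K ->
  Phi sb 1 - Phi s1 s <= K * ((inv_r sb 1)^-1 - (inv_r s1 s)^-1) ->
  Phi sb 1 <= (Phi sb 1 + (inv_r sb 1)^-1 * K) * secant_gap.
Proof.
move=> K0 hK; have P1 := Phi_ge1; have P2 := Phi_crit_ge1.
have q1 : 0 < inv_r s1 s by rewrite inv_r_Phi mulr_gt0//; lra.
have q2 : 0 < inv_r sb 1 by rewrite inv_r_Phi_crit mulr_gt0//; lra.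
have rr : 0 < (inv_r sb 1)^-1 - (inv_r s1 s)^-1.
  by rewrite subr_gt0 ltf_pV2 ?posrE// inv_r_crit_lt.
have TE : T = (inv_r sb 1)^-1 * Phi sb 1.
  by rewrite /T inv_r_Phi_crit; field; rewrite !gt_eqF//; lra.
have tE : t = (inv_r s1 s)^-1 * Phi s1 s.
  by rewrite /t inv_r_Phi; field; rewrite !gt_eqF//; lra.
have rad := secant_radius; have Tt := T_gt_t.
set rb := (inv_r sb 1)^-1 in rr hK TE rad *; set r := (inv_r s1 s)^-1 in rr hK tE rad.
have r0 : 0 < r by rewrite invr_gt0.
set P := Phi s1 s in P1 hK tE rad; set Pb := Phi sb 1 in P2 hK TE rad *.
(* The product rule for t = r Phi bounds T - t by the increment of r; [secant_radius] goes back from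
   T - t to that increment at the cost of the gap. *)
have h1 : T - t <= (Pb + rb * K) * (rb - r).
  have -> : T - t = Pb * (rb - r) + r * (Pb - P) by rewrite TE tE; ring.
  rewrite [leRHS]mulrDl; apply: lerD => //; rewrite -mulrA.
  apply: le_trans (_ : r * (K * (rb - r)) <= _); first by rewrite ler_pM2l.
  by rewrite ler_wpM2r ?mulr_ge0 ?(ltW rr)//; lra.
have h2 : (T - t) * (P * Pb) <= (T - t) * ((Pb + rb * K) * secant_gap).
  rewrite [leRHS](_ : _ = (Pb + rb * K) * ((T - t) * secant_gap)); last by ring.
  rewrite -rad [leRHS]mulrA; apply: ler_wpM2r => //.
  by apply: mulr_ge0; lra.
have {}h2 : P * Pb <= (Pb + rb * K) * secant_gap by move: h2; rewrite ler_pM2l// subr_gt0.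
by apply: le_trans h2; rewrite ler_peMl//; lra.
Qed.

End Secant.

Lemma secant_gap_small e : 0 < e -> exists2 s0, 0 < s0 < 1 &
  forall s1 s, 0 < s1 < sb -> s0 < s < 1 -> partner s1 s -> secant_gap s1 s <= e.
Proof.
move=> e0.
pose c := (ret1 sb)^-1 ^+ 2 + (ret2 1)^-1 ^+ 2.
have c0 : 0 < c by rewrite addr_gt0// exprn_gt0// invr_gt0.
have ec : 0 < e / c by exact: divr_gt0.
have hd1 : has_gf_deriv u1 sb by apply: has_gf_deriv_lt1 u1_ge0 u1_bounded _ _; rewrite ltW.
have sb01' : 0 < sb <= 1 by rewrite sb0 ltW.
have one01 : 0 < (1 : R) <= 1 by rewrite ltr01 lexx.
have [x1 /andP[x10 x1b] h1] := gf_diff_ge u1_ge0 u1_bounded sb01' hd1 ec.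
have [x2 /andP[x20 x21] h2] := gf_diff_ge u2_ge0 u2_bounded one01 deriv2 ec.
have L0 := partner_lip_ge0.
have L1 : 0 < partner_lip + 1 by rewrite ltr_wpDl.
(* For s beyond x3, [partner_close] forces s1 above x1, so both slopes are within e / c of the
   derivatives. *)
pose x3 := 1 - (sb - x1) / (partner_lip + 1).
have x31 : x3 < 1 by rewrite /x3 ltrBlDr ltrDl divr_gt0// subr_gt0.
exists (Num.max x2 x3).
  by rewrite lt_max x20 gt_max x21 x31.
move=> s1 s s1_bd /andP[]; rewrite gt_max => /andP[x2s x3s] s1' s1s.
have s_bd : 0 < s < 1 by rewrite (lt_trans x20).
have pc := partner_close s1_bd s_bd s1s.
have x1s1 : x1 <= s1.
  suff : partner_lip * (1 - s) <= sb - x1 by lra.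
  apply: le_trans (_ : (partner_lip + 1) * (1 - s) <= _).
    by rewrite ler_wpM2r ?subr_ge0 ?(ltW s1')// lerDl.
  by rewrite mulrC -ler_pdivlMr//; move: x3s; rewrite /x3; lra.
have /andP[_ s1b] := s1_bd.
apply: le_trans (secant_gap_le s1_bd s_bd (_ : _ - e / c <= _) (_ : _ - e / c <= _) (ltW ec)) _.
- rewrite ler_pdivlMr ?subr_gt0//; have := h1 s1 x1s1 (ltW s1b); rewrite /ret1; lra.
- rewrite ler_pdivlMr ?subr_gt0//; have := h2 s (ltW x2s) (ltW s1'); rewrite /ret2; lra.
- by rewrite divfK// gt_eqF.
Qed.

Lemma Phi_crit_approx e : 0 < e -> exists2 s0, 0 < s0 < 1 &
  forall s1 s, 0 < s1 < sb -> s0 < s < 1 -> partner s1 s -> Phi sb 1 - e <= Phi s1 s.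
Proof.
move=> e0.
pose C := gf_deriv u1 sb * partner_lip / ret1 sb ^+ 2 + gf_deriv u2 1 / ret2 1 ^+ 2.
have hd1 : has_gf_deriv u1 sb by apply: has_gf_deriv_lt1 u1_ge0 u1_bounded _ _; rewrite ltW.
have C0 : 0 <= C.
  have D1 := gf_deriv_ge0 u1_ge0 (ltW sb0) hd1.
  have D2 := gf_deriv_ge0 u2_ge0 ler01 deriv2.
  by rewrite addr_ge0// divr_ge0 ?sqr_ge0// mulr_ge0// partner_lip_ge0.
have C1 : 0 < C + 1 by rewrite ltr_wpDl.
pose x := 1 - e / (C + 1).
have x1 : x < 1 by rewrite /x ltrBlDr ltrDl divr_gt0.
exists (Num.max 2^-1 x).
  by rewrite lt_max invr_gt0 ltr0n /= gt_max x1 andbT invf_lt1// ltr1n.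
move=> s1 s s1_bd /andP[]; rewrite gt_max => /andP[hs xs] s1' s1s.
have s_bd : 0 < s < 1 by rewrite s1' andbT (lt_trans _ hs)// invr_gt0.
have := Phi_crit_close s1_bd s_bd s1s; rewrite -/C => h.
have : (C + 1) * (1 - s) <= e by rewrite mulrC -ler_pdivlMr//; move: xs; rewrite /x; lra.
have : 0 <= 1 - s by rewrite subr_ge0 ltW.
lra.
Qed.

End CriticalPoint.

(** * The critical walk *)

Section FreeProductCriticality.
Local Open Scope ring_scope.
Local Open Scope classical_set_scope.
Variables (R : realType) (G1 G2 : groupType).
Variables (mu1 : G1 -> R) (mu2 : G2 -> R) (S1 : seq G1) (S2 : seq G2) (M1 M2 : R).
Local Notation G := (free_prod G1 G2).
Local Notation p1 := (mass mu1 S1).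
Local Notation p2 := (mass mu2 S2).

Hypotheses (mu1_ge0 : forall x, 0 <= mu1 x) (mu2_ge0 : forall y, 0 <= mu2 y).
Hypotheses (S1_uniq : uniq S1) (S2_uniq : uniq S2).
Hypotheses (S1_supp : forall x, x \notin S1 -> mu1 x = 0).
Hypotheses (S2_supp : forall y, y \notin S2 -> mu2 y = 0).
Hypotheses (mu1_sum1 : \sum_(x <- S1) mu1 x = 1) (mu2_sum1 : \sum_(y <- S2) mu2 y = 1).
Hypothesis transient1 : forall N x, \sum_(n < N) p1 n x <= M1.
Hypothesis transient2 : forall N y, \sum_(n < N) p2 n y <= M2.
Hypothesis mean1 : forall b, ~ (forall N, \sum_(n < N) n%:R * p1 n 1%g <= b).
Hypothesis mean2 : exists b, forall N, \sum_(n < N) n%:R * p2 n 1%g <= b.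
Hypothesis second2 : forall b, ~ (forall N, \sum_(n < N) n%:R ^+ 2 * p2 n 1%g <= b).
Hypothesis hit2 : 0 < hit mu2 S2 1 1%g.

Local Notation u1 := (fun k => hit mu1 S1 k 1%g).
Local Notation u2 := (fun k => hit mu2 S2 k 1%g).

Let u1_ge0 k : 0 <= u1 k. Proof. exact: hit_ge0. Qed.
Let u2_ge0 k : 0 <= u2 k. Proof. exact: hit_ge0. Qed.
Let u1_bounded N : \sum_(k < N) u1 k <= M1.
Proof. exact: (hit_bounded mu1_ge0 transient1). Qed.
Let u2_bounded N : \sum_(k < N) u2 k <= M2.
Proof. exact: (hit_bounded mu2_ge0 transient2). Qed.
Let gap1 s : 0 <= s <= 1 -> 0 < 1 - gf u1 s.
Proof. exact: (Ugen_lt1 mu1_ge0 mu1_sum1 transient1). Qed.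
Let gap2 s : 0 <= s <= 1 -> 0 < 1 - gf u2 s.
Proof. exact: (Ugen_lt1 mu2_ge0 mu2_sum1 transient2). Qed.

Let deriv2 : has_gf_deriv u2 1.
Proof.
have [b hb] := mean2; exists b => N; apply: le_trans (hb N.+1).
rewrite big_ord_recl mul0r add0r; apply: ler_sum => k _.
by rewrite expr1n mulr1 lift0 ler_wpM2l// hit_le_mass.
Qed.

Let infinite_mean1 b : ~ (forall N, \sum_(k < N) k.+1%:R * u1 k <= b).
Proof.
move=> hb; apply: (mean1 (b := b * M1 ^+ 2)).
exact: (mean_hit_mean_mass mu1_ge0 mu1_sum1 transient1 hb).
Qed.

Section AtCriticalPoint.
Variable sb : R.
Hypothesis sb01 : 0 < sb < 1.
Hypothesis critical : (gf_W u1 sb)^-1 + (gf_W u2 1)^-1 = 1.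

Local Notation alpha := (crit_alpha u1 u2 sb).
Local Notation mu := (mix alpha mu1 mu2).
Local Notation S := (mix_support S1 S2).
Local Notation p := (mass mu S).
Local Notation invr := (inv_r u1 u2 sb).
Local Notation invt := (inv_t u1 u2 sb).
Local Notation phi := (Phi u1 u2).
Local Notation partners := (partner u1 u2 sb).

Let sb0 : 0 < sb. Proof. by case/andP: sb01. Qed.
Let sb1 : sb < 1. Proof. by case/andP: sb01. Qed.
Let alpha_gt0 : 0 < alpha. Proof. exact: (crit_alpha_gt0 gap1 gap2 sb01). Qed.
Let alpha_lt1 : alpha < 1. Proof. exact: (crit_alpha_lt1 gap1 gap2 sb01). Qed.
Let alpha01 : 0 <= alpha <= 1. Proof. by rewrite !ltW. Qed.

Let mu_ge0 w : 0 <= mu w. Proof. exact: mix_ge0. Qed.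
Let S_uniq : uniq S. Proof. exact: undup_uniq. Qed.
Let S_supp w : w \notin S -> mu w = 0. Proof. exact: mix_supp. Qed.

Definition weight s1 s : G -> R := word_weight (Fgen mu1 S1 s1) (Fgen mu2 S2 s).
(** The upper bounds are closed so as to include the critical pair. All pairs give upper bounds on
    Green functions; matching lower bounds are proved for strict ones. *)
Definition admissible_pair s1 s := [/\ 0 < s1 <= sb, 0 < s <= 1 & partners s1 s].

Lemma admissible_crit : admissible_pair sb 1.
Proof.
by split; rewrite ?sb0 ?ltr01 ?lexx//; exact: (crit_partner gap1 gap2 sb01).
Qed.

Lemma admissible_lt s1 s : 0 < s1 < sb -> 0 < s < 1 -> partners s1 s -> admissible_pair s1 s.
Proof. by move=> /andP[a b] /andP[c e] h; split; rewrite ?a ?c ?ltW. Qed.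

Lemma inv_rE s1 s : admissible_pair s1 s -> [/\ 0 < invt s, 1 <= phi s1 s &
  invr s1 s = invt s * phi s1 s].
Proof.
move=> [/andP[s10 s1b] s01 h]; have /andP[s0 s_1] := s01.
have s1_1 : s1 <= 1 by apply: le_trans (ltW sb1).
have r1 : 0 < ret1 u1 s1 by apply: gap1; rewrite s1_1 ltW.
have r2 : 0 < ret2 u2 s by apply: gap2; rewrite s_1 ltW.
have it : 0 < invt s by exact: (inv_t_gt0 gap1 gap2 sb01 s01).
split => //.
  have h1 : 1 <= (ret1 u1 s1)^-1.
    by rewrite invf_ge1//; apply: (ret1_le1 u1_ge0 u1_bounded); rewrite s1_1 ltW.
  have h2 : 1 <= (ret2 u2 s)^-1.
    by rewrite invf_ge1//; apply: (ret2_le1 u2_ge0 u2_bounded); rewrite s_1 ltW.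
  by rewrite /Phi; lra.
have e1 : alpha / s1 = invt s / ret1 u1 s1.
  by rewrite -h; field; rewrite !gt_eqF.
have e2 : (1 - alpha) / s = invt s / ret2 u2 s.
  by rewrite /inv_t; field; rewrite !gt_eqF.
by rewrite /inv_r e1 e2 /Phi; ring.
Qed.

Lemma weight_expand s1 s w N : admissible_pair s1 s ->
  weight s1 s w = (phi s1 s)^-1 * (\sum_(n < N) p n w * (invr s1 s)^-1 ^+ n) +
    (invr s1 s)^-1 ^+ N * iter N (step mu S) (weight s1 s) w.
Proof.
move=> adm; have [it P1 rE] := inv_rE adm; have [/andP[s10 s1b] /andP[s0 s_1] h] := adm.
have s1_01 : 0 <= s1 <= 1 by rewrite (ltW s10) (le_trans s1b)// ltW.
have s_01 : 0 <= s <= 1 by rewrite (ltW s0).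
apply: mass_expand => // {}w.
have P0 : 0 < phi s1 s by lra.
have r0 : 0 < invr s1 s by rewrite rE mulr_gt0.
have := @step_word_weight _ _ _ _ _ _ _ alpha S1_uniq S2_uniq S1_supp S2_supp
  _ _ (Fgen1 mu1 S1 s1) (Fgen1 mu2 S2 s) s1 s (Ugen mu1 S1 s1) (Ugen mu2 S2 s) (invt s)
  (lt0r_neq0 s10) (lt0r_neq0 s0)
  (fun x => Fgen_equation mu1_ge0 transient1 x s1_01)
  (fun x => Fgen_equation mu2_ge0 transient2 x s_01) h erefl w.
rewrite -/(weight s1 s) -/(invr s1 s) => e.
apply: (mulfI (lt0r_neq0 r0)); rewrite e mulrDr mulrA mulVKf ?gt_eqF//.
by congr (_ + _); rewrite rE mulfK// gt_eqF.
Qed.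

Lemma weight_ge0 s1 s w : admissible_pair s1 s -> 0 <= weight s1 s w.
Proof.
move=> [/andP[s10 s1b] /andP[s0 s_1] _]; apply: prodr_ge0 => -[x|y] _ /=.
  by apply: (Fgen_ge0 mu1_ge0 transient1); rewrite (ltW s10) (le_trans s1b)// ltW.
by apply: (Fgen_ge0 mu2_ge0 transient2); rewrite (ltW s0).
Qed.

Lemma weight_le_crit s1 s w : admissible_pair s1 s -> weight s1 s w <= weight sb 1 w.
Proof.
move=> [/andP[s10 s1b] /andP[s0 s_1] _]; apply: ler_prod => -[x|y] _ /=; apply/andP; split.
- by apply: (Fgen_ge0 mu1_ge0 transient1); rewrite (ltW s10) (le_trans s1b)// ltW.
- by apply: (Fgen_homo mu1_ge0 transient1); rewrite ?(ltW s10)// ltW.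
- by apply: (Fgen_ge0 mu2_ge0 transient2); rewrite (ltW s0).
- by apply: (Fgen_homo mu2_ge0 transient2); rewrite ?(ltW s0).
Qed.

Lemma inv_r_gt0 s1 s : admissible_pair s1 s -> 0 < invr s1 s.
Proof. by move=> /inv_rE[it P1 ->]; rewrite mulr_gt0//; lra. Qed.

Lemma green_le_weight s1 s w N : admissible_pair s1 s ->
  \sum_(n < N) p n w * (invr s1 s)^-1 ^+ n <= phi s1 s * weight s1 s w.
Proof.
move=> adm; have [it P1 rE] := inv_rE adm; have r0 := inv_r_gt0 adm.
have P0 : 0 < phi s1 s by lra.
rewrite -ler_pdivrMl// (weight_expand w N adm) lerDl mulr_ge0 ?exprn_ge0 ?invr_ge0 ?(ltW r0)//.
by apply: iter_step_ge0 => // x; exact: weight_ge0.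
Qed.

Let term_ge0 r w n : 0 <= r -> 0 <= p n w * r ^+ n.
Proof. by move=> r0; rewrite mulr_ge0 ?exprn_ge0// mass_ge0. Qed.

Lemma mix_green_cvg s1 s w : admissible_pair s1 s ->
  cvgn (series (fun n => p n w * (invr s1 s)^-1 ^+ n)).
Proof.
move=> adm; apply: (@nonneg_series_cvg _ _ (phi s1 s * weight s1 s w)) => [n|N].
  by apply: term_ge0; rewrite invr_ge0 ltW// inv_r_gt0.
exact: green_le_weight.
Qed.

Local Notation rb := (invr sb 1)^-1.

Let rb0 : 0 < rb. Proof. by rewrite invr_gt0; apply: inv_r_gt0; exact: admissible_crit. Qed.

Definition green_crit w : R := rsum (fun n => p n w * rb ^+ n).

Let green_crit_cvg w : cvgn (series (fun n => p n w * rb ^+ n)).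
Proof. by apply: mix_green_cvg; exact: admissible_crit. Qed.

(* The harmonic part of the weight vanishes below the critical radius, as it is
   dominated by (r / rb)^N times the critical weight. *)
Lemma weight_le_green s1 s w : 0 < s1 < sb -> 0 < s < 1 -> partners s1 s ->
  phi s1 s * weight s1 s w <= rsum (fun n => p n w * (invr s1 s)^-1 ^+ n).
Proof.
move=> s1_bd s_bd h; have adm := admissible_lt s1_bd s_bd h.
have [it P1 rE] := inv_rE adm; have r0 := inv_r_gt0 adm.
have q0 := inv_r_gt0 admissible_crit.
have P0 : 0 < phi s1 s by lra.
have lt_r : invr sb 1 < invr s1 s.
  exact: (inv_r_crit_lt u1_ge0 u2_ge0 u1_bounded u2_bounded gap1 gap2 deriv2 hit2 sb01
    critical s1_bd s_bd h).
rewrite -ler_pdivlMl//.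
set r := (invr s1 s)^-1; have r_gt0 : 0 < r by rewrite invr_gt0.
pose q := r / rb.
have q_ge0 : 0 <= q by rewrite divr_ge0 ?ltW.
have q_lt1 : `|q| < 1.
  by rewrite ger0_norm// /q /r invrK mulrC ltr_pdivrMr// mul1r.
set L := _^-1 * _.
have B N : weight s1 s w <= L + q ^+ N * weight sb 1 w.
  rewrite (weight_expand w N adm) -/r; apply: lerD.
    rewrite ler_wpM2l ?invr_ge0 ?(ltW P0)//; apply: rsum_ge => [n|]; last exact: mix_green_cvg.
    by apply: term_ge0; exact: ltW.
  rewrite /q expr_div_n -mulrA ler_wpM2l ?exprn_ge0 ?(ltW r_gt0)//.
  rewrite ler_pdivlMl ?exprn_gt0//.
  apply: le_trans (_ : rb ^+ N * iter N (step mu S) (weight sb 1) w <= _).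
    by rewrite ler_wpM2l ?exprn_ge0 ?(ltW rb0)//; apply: le_iter_step => // x; exact: weight_le_crit.
  rewrite [leRHS](weight_expand w N admissible_crit) lerDr.
  have [_ Pb _] := inv_rE admissible_crit.
  rewrite mulr_ge0 ?invr_ge0//; first by lra.
  by apply: sumr_ge0 => n _; apply: term_ge0; exact: ltW.
have c : L + q ^+ N * weight sb 1 w @[N --> \oo] --> L.
  rewrite -[X in _ --> X]addr0; apply: cvgD; first exact: cvg_cst.
  by rewrite -[X in _ --> X](mul0r (weight sb 1 w)); apply: cvgMl; exact: cvg_expr.
rewrite -(cvg_lim _ c)//; apply: limr_ge; first by apply/cvg_ex; exists L.
exact: nearW.
Qed.

Lemma inv_r_lt s1 s : 0 < s1 < sb -> 0 < s < 1 -> partners s1 s -> (invr s1 s)^-1 < rb.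
Proof.
move=> s1_bd s_bd h; have adm := admissible_lt s1_bd s_bd h.
rewrite ltf_pV2 ?posrE; [|exact: (inv_r_gt0 adm)|exact: (inv_r_gt0 admissible_crit)].
exact: (inv_r_crit_lt u1_ge0 u2_ge0 u1_bounded u2_bounded gap1 gap2 deriv2 hit2 sb01
    critical s1_bd s_bd h).
Qed.

Lemma green_crit_ge s1 s w : 0 < s1 < sb -> 0 < s < 1 -> partners s1 s ->
  phi s1 s * weight s1 s w <= green_crit w.
Proof.
move=> s1_bd s_bd h; apply: le_trans (weight_le_green w s1_bd s_bd h) _.
have adm := admissible_lt s1_bd s_bd h; have r0 := inv_r_gt0 adm.
have r_lt := inv_r_lt s1_bd s_bd h.
apply: le_rsum => [||n]; [exact: mix_green_cvg|exact: green_crit_cvg|].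
rewrite ler_wpM2l ?mass_ge0// lerXn2r ?nnegrE ?invr_ge0 ?(ltW r0) ?(ltW r_lt)//.
by rewrite -invr_ge0 ltW.
Qed.

Lemma weight1 s1 s : weight s1 s 1%g = 1.
Proof. exact: word_weight1. Qed.

Let exists_pair s : 0 < s < 1 -> exists2 s1, 0 < s1 < sb & partners s1 s.
Proof. exact: (partner_exists u1_ge0 u2_ge0 u1_bounded u2_bounded gap1 gap2 sb01). Qed.

(** The lower bound at rb is the limit of those at strict pairs approaching (sb, 1), since the decay
    of the remainder is only known for r < rb. *)
Lemma green_crit_ge_Phi : phi sb 1 <= green_crit 1%g.
Proof.
apply/ler_addgt0Pr => e e0.
have [s0 /andP[s00 s01] hs] := Phi_crit_approx u1_ge0 u2_ge0 u1_bounded u2_bounded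
  gap1 gap2 deriv2 hit2 sb01 e0.
pose s := (s0 + 1) / 2.
have s_bd : 0 < s < 1 by rewrite /s; apply/andP; split; lra.
have [s1 s1_bd h] := exists_pair s_bd.
have s0s : s0 < s < 1 by rewrite /s; apply/andP; split; lra.
have := green_crit_ge 1%g s1_bd s_bd h; rewrite weight1 mulr1.
have := hs _ _ s1_bd s0s h; lra.
Qed.

(** A finite K = G'(rb) would bound the difference quotients of G below rb, and so keep [secant_gap]
    away from 0; but the gap is arbitrarily small near the critical pair. *)
Lemma mix_green_derivative : green_derivative mu rb = +oo%E.
Proof.
rewrite (green_derivative_mass mu_ge0 S_uniq S_supp).
apply: contrapT => fin.
have t0 n : 0 <= n%:R * p n 1%g * rb ^+ n.-1.
  by rewrite mulr_ge0 ?exprn_ge0 ?(ltW rb0)// mulr_ge0// mass_ge0.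
have ck : cvgn (series (fun n => n%:R * p n 1%g * rb ^+ n.-1)).
  by apply: nneseries_fin_cvg => //; rewrite ltey; apply/eqP.
pose K := rsum (fun n => n%:R * p n 1%g * rb ^+ n.-1).
have K0 : 0 <= K by exact: rsum_ge0.
have [_ Pb _] := inv_rE admissible_crit.
have D0 : 0 < phi sb 1 + rb * K.
  by rewrite ltr_wpDr ?mulr_ge0 ?(ltW rb0)//; lra.
(* Half of the lower bound that [quotient_bound] would impose on the gap. *)
have e0 : 0 < phi sb 1 / (2 * (phi sb 1 + rb * K)).
  by rewrite divr_gt0 ?mulr_gt0//; lra.
have [s0 /andP[s00 s01] hs] := secant_gap_small u1_ge0 u2_ge0 u1_bounded u2_bounded
  gap1 gap2 deriv2 hit2 sb01 critical e0.
pose s := (s0 + 1) / 2.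
have s_bd : 0 < s < 1 by rewrite /s; apply/andP; split; lra.
have s0s : s0 < s < 1 by rewrite /s; apply/andP; split; lra.
have [s1 s1_bd h] := exists_pair s_bd.
have adm := admissible_lt s1_bd s_bd h.
have r0 := inv_r_gt0 adm; have r_lt := inv_r_lt s1_bd s_bd h.
set r := (invr s1 s)^-1 in r_lt; have r_ge0 : 0 <= r by rewrite invr_ge0 ltW.
have quot : phi sb 1 - phi s1 s <= K * (rb - r).
  have up : rsum (fun n => p n 1%g * r ^+ n) <= phi s1 s.
    apply: rsum_le => [|N]; first exact: mix_green_cvg.
    by have := green_le_weight 1%g N adm; rewrite weight1 mulr1.
  apply: le_trans (_ : green_crit 1%g - rsum (fun n => p n 1%g * r ^+ n) <= _).
    by apply: lerB => //; exact: green_crit_ge_Phi.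
  have cr : cvgn (series (fun n => p n 1%g * r ^+ n)) by exact: mix_green_cvg.
  have cb := @green_crit_cvg 1%g.
  rewrite -rsumB//; apply: rsum_le => [|N]; first exact: is_cvg_seriesB.
  apply: le_trans (_ : (\sum_(n < N) n%:R * p n 1%g * rb ^+ n.-1) * (rb - r) <= _).
    rewrite mulr_suml; apply: ler_sum => n _; rewrite -mulrBr.
    rewrite [leRHS](_ : _ = p n 1%g * (n%:R * rb ^+ n.-1 * (rb - r))); last by ring.
    by rewrite ler_wpM2l ?mass_ge0//; exact: (expr_diff_le n r_ge0 (ltW r_lt)).
  by rewrite ler_wpM2r ?subr_ge0 ?(ltW r_lt)//; exact: rsum_ge.
have := quotient_bound u1_ge0 u2_ge0 u1_bounded u2_bounded gap1 gap2 deriv2 hit2 sb01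
  critical s1_bd s_bd h K0 quot.
have := hs _ _ s1_bd s0s h; set g := secant_gap _ _ _ _ _ => g_le.
apply/negP; rewrite -ltNge.
apply: le_lt_trans (ler_wpM2l (ltW D0) g_le) _.
have Pp : 0 < phi sb 1 by exact: lt_le_trans ltr01 Pb.
have cancel (x y : R) : 0 < y -> y * (x / (2 * y)) = x / 2.
  by move=> y0; field; rewrite gt_eqF.
by rewrite cancel// ltr_pdivrMr// ltr_pMr// ltr1n.
Qed.

(** The series converges at rb by comparison with the weight. Convergence at some r > rb would make
    G'(rb) finite, through n rb^(n-1) <= r^n / (r - rb). *)
Lemma mix_green_radius : green_radius mu = rb.
Proof.
have gE r w : green mu r 1%g w = (\sum_(0 <= n <oo) (p n w * r ^+ n)%:E)%E.
  by rewrite (green_mass mu_ge0 S_uniq S_supp) invg1 mul1g.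
have in_rb : 0 <= rb /\ (green mu rb 1%g 1%g < +oo)%E.
  split; first exact: ltW.
  rewrite gE nneseries_rsum ?ltry//.
  by move=> n; apply: term_ge0; exact: ltW.
have ub r : 0 <= r /\ (green mu r 1%g 1%g < +oo)%E -> r <= rb.
  move=> [r0]; rewrite gE => fin; rewrite leNgt; apply/negP => rb_r.
  have cr : cvgn (series (fun n => p n 1%g * r ^+ n)).
    by apply: nneseries_fin_cvg => // n; exact: term_ge0.
  have t0 n : 0 <= n%:R * p n 1%g * rb ^+ n.-1.
    by rewrite mulr_ge0 ?exprn_ge0 ?(ltW rb0)// mulr_ge0// mass_ge0.
  have d0 : 0 < r - rb by rewrite subr_gt0.
  have := mix_green_derivative; rewrite (green_derivative_mass mu_ge0 S_uniq S_supp).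
  rewrite nneseries_rsum//.
  apply: (@dominated_series_cvg _ _ (fun n => (r - rb)^-1 * (p n 1%g * r ^+ n))) => // [n|].
    rewrite ler_pdivlMl// mulrC.
    rewrite [leLHS](_ : _ = p n 1%g * (n%:R * rb ^+ n.-1 * (r - rb))); last by ring.
    rewrite ler_wpM2l ?mass_ge0//.
    apply: le_trans (expr_diff_ge n (ltW rb0) (ltW rb_r)) _.
    by rewrite gerBl exprn_ge0// ltW.
  exact: (@is_cvg_seriesZ _ _ (r - rb)^-1 cr).
apply/eqP; rewrite eq_le; apply/andP; split.
  by apply: ge_sup; [exists rb; exact: in_rb|move=> r; exact: ub].
apply: sup_upper_bound => //; split; first by exists rb; exact: in_rb.
by exists rb => r; exact: ub.
Qed.

(** At a one-letter word, strict pairs give at least Phi F_2(y|s) >= F_2(y|s). Truncations of F_2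
    are polynomials in s, so the bound extends to s = 1. *)
Lemma mix_green_inr y : Fgen mu2 S2 1 y <= green_crit (fp_inr G1 y).
Proof.
have H s : 0 < s < 1 -> Fgen mu2 S2 s y <= green_crit (fp_inr G1 y).
  move=> s_bd; have [s1 s1_bd h] := exists_pair s_bd.
  apply: le_trans (green_crit_ge _ s1_bd s_bd h).
  have adm := admissible_lt s1_bd s_bd h; have [_ P1 _] := inv_rE adm.
  have -> : weight s1 s (fp_inr G1 y) = Fgen mu2 S2 s y.
    by apply: word_weight_inr; exact: Fgen1.
  rewrite ler_peMl//; case/andP: s_bd => s0 s_1.
  by apply: (Fgen_ge0 mu2_ge0 transient2); rewrite !ltW.
(* One value of s settles y = 1, where F_2 is constantly 1; the limit in s concerns the other y. *)
have half : 0 < (2^-1 : R) < 1 by rewrite invr_gt0 ltr0n invf_lt1 ?ltr1n.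
have := H _ half; rewrite /Fgen; case: ifP => // y1 _.
have {}H s : 0 < s < 1 -> hitsum mu2 S2 s y <= green_crit (fp_inr G1 y).
  by move=> /H; rewrite /Fgen y1.
have c1 : 0 <= (1 : R) <= 1 by rewrite ler01 lexx.
apply: rsum_le => [|N]; first exact: (hit_cvg mu2_ge0 transient2 c1).
apply: (@polysum_le_left _ N (hit mu2 S2 ^~ y) succn 0 1) => // s /andP[s0 s_1].
apply: le_trans (H s _); last by rewrite s0.
have s01 : 0 <= s <= 1 by rewrite !ltW.
apply: rsum_ge => [k|]; last exact: (hit_cvg mu2_ge0 transient2 s01).
by rewrite mulr_ge0 ?exprn_ge0 ?hit_ge0// ltW.
Qed.

(** Each Green factor is at least c = 1 - U_2(1) times a truncated Green sum on the factor, so a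
    finite value B would bound the second moment of p2 by 4 B / c^3. *)
Lemma mix_I2_inr : I2 mu (range (@fp_inr G1 G2)) rb = +oo%E.
Proof.
apply: contrapT => fin.
have gE x y : green mu rb x y = (green_crit (x^-1 * y)%g)%:E.
  rewrite (green_mass mu_ge0 S_uniq S_supp) nneseries_rsum// => n.
  by apply: term_ge0; exact: ltW.
have gc0 w : 0 <= green_crit w.
  by apply: rsum_ge0 => // n; apply: term_ge0; exact: ltW.
pose c := 1 - Ugen mu2 S2 1.
have c01 : 0 <= (1 : R) <= 1 by rewrite ler01 lexx.
have c0 : 0 < c by exact: gap2.
have gc N y : c * (\sum_(n < N) p2 n y) <= green_crit (fp_inr G1 y).
  apply: le_trans (green_le_Fgen1 mu2_ge0 mu2_sum1 transient2 N y) _.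
  exact: mix_green_inr.
have I2_ge0 : (0 <= I2 mu (range (@fp_inr G1 G2)) rb)%E.
  by apply: esum_ge0 => z _; rewrite !gE -!EFinM lee_fin !mulr_ge0.
have {fin}: I2 mu (range (@fp_inr G1 G2)) rb \is a fin_num.
  by rewrite ge0_fin_numE// ltey; apply/eqP.
move=> /fineK; set B := fine _ => BE.
apply: (second2 (b := 4 * (B / c ^+ 3))) => N.
have p0 n : 0 <= p2 n 1%g by exact: mass_ge0.
apply: le_trans (triple_sum_ge N p0) _.
rewrite ler_wpM2l// ler_pdivlMr ?exprn_gt0//.
have [L [Y [uL uY]]] := triple_convolution_le S2 mu2_ge0 N.
move=> /(ler_wpM2r (ltW (exprn_gt0 3 c0))) /le_trans; apply.
rewrite -lee_fin BE.
pose Z : seq (G * G) := [seq (fp_inr G1 x, fp_inr G1 y) | x <- L, y <- Y].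
have uZ : uniq Z.
  apply: allpairs_uniq => // -[x y] [x' y'] _ _ e.
  by rewrite (fp_inr_inj (congr1 fst e)) (fp_inr_inj (congr1 snd e)).
apply: esum_ge; exists [set` Z].
  split; first exact: finite_seq.
  by move=> z /= /allpairsP[[x y] [_ _ ->]]; split; [exists x|exists y].
rewrite -fsbig_seq// /Z big_allpairs_dep.
under eq_bigr do under eq_bigr do rewrite /= !gE -!EFinM.
under eq_bigr do rewrite sumEFin.
rewrite sumEFin lee_fin mulr_suml; apply: ler_sum => x _.
rewrite mulr_suml; apply: ler_sum => y _ /=.
rewrite invg1 mul1g mulg1 !fp_inrV -fp_inrM.
have sum0 z : 0 <= c * \sum_(n < N) p2 n z.
  by rewrite mulr_ge0 ?(ltW c0)//; apply: sumr_ge0 => n _; exact: mass_ge0.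
rewrite [leLHS](_ : _ = (c * \sum_(n < N) p2 n x) * (c * \sum_(n < N) p2 n (x^-1 * y)%g) *
  (c * \sum_(n < N) p2 n y^-1%g)); last by ring.
apply: ler_pM; [exact: mulr_ge0|exact: sum0| |exact: gc].
by apply: ler_pM; [exact: sum0|exact: sum0|exact: gc|exact: gc].
Qed.

Lemma mix_critical : divergent mu /\ ~ spectrally_positive_recurrent mu.
Proof.
have dv : divergent mu by rewrite /divergent mix_green_radius; exact: mix_green_derivative.
split => // -[_].
have g0 w : (0 <= \sum_(0 <= n <oo) (p n w * rb ^+ n)%:E)%E.
  by apply: nneseries_ge0 => n _ _; rewrite lee_fin; apply: term_ge0; exact: ltW.
(* In the extended reals the other summand must be kept away from -oo before the infinite one
   decides the sum. *)
have I0 : (0 <= I2 mu (range (@fp_inl G1 G2)) rb)%E.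
  apply: esum_ge0 => z _; rewrite !(green_mass mu_ge0 S_uniq S_supp).
  by rewrite !mule_ge0.
by rewrite mix_green_radius /J2 mix_I2_inr addey ?ltxx// gt_eqF// (lt_le_trans ltNy0 I0).
Qed.

End AtCriticalPoint.

Lemma free_product_critical : exists alpha : R,
  [/\ 0 < alpha < 1, divergent (mix alpha mu1 mu2)
    & ~ spectrally_positive_recurrent (mix alpha mu1 mu2)].
Proof.
have [sb sb01 crit] := critical_exists u1_ge0 u2_ge0 u1_bounded u2_bounded deriv2 hit2
  infinite_mean1.
exists (crit_alpha u1 u2 sb); have [dv nspr] := mix_critical sb01 crit.
split => //; apply/andP; split; first exact: (crit_alpha_gt0 gap1 gap2 sb01).
exact: (crit_alpha_lt1 gap1 gap2 sb01).
Qed.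

End FreeProductCriticality.

(** * From the measures on the lattices to the hypotheses above *)

Section LatticeWalk.
Local Open Scope ring_scope.
Local Open Scope classical_set_scope.
Variables (R : realType) (d : nat) (mu : Zpow d -> R).
Hypotheses (prob : is_probability mu) (fin : finitely_supported mu).
Hypotheses (adm : admissible mu) (sym : is_symmetric mu).

Lemma lattice_support : exists S : seq (Zpow d), [/\ uniq S,
  forall x, x \notin S -> mu x = 0, \sum_(y <- S) mu y = 1 &
  perm_eq [seq y^-1%g | y <- S] S].
Proof.
have [mu_ge0 mu1] := prob.
have [s hs] := (finite_seqP _).1 fin.
have sE x : (x \in s) = (mu x != 0).
  have := congr1 (fun A : set (Zpow d) => A x) hs => /= e.
  by apply/idP/idP => h; [rewrite e|rewrite -e].
exists (undup s).
have supp x : x \notin undup s -> mu x = 0.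
  by rewrite mem_undup sE negbK => /eqP.
split; [exact: undup_uniq|exact: supp| |].
  have := esum_supp (undup_uniq s) mu_ge0 supp; rewrite mu1 => /esym/eqP.
  by rewrite eqe => /eqP.
apply: uniq_perm; rewrite ?undup_uniq//.
  by rewrite map_inj_uniq ?undup_uniq//; exact: invg_inj.
move=> x; rewrite mem_undup sE; apply/mapP/idP => [[y ys ->]|mx].
  by rewrite -sym -sE -mem_undup.
by exists x^-1%g; rewrite ?invgK// mem_undup sE -sym.
Qed.

Variable S : seq (Zpow d).
Hypothesis S_uniq : uniq S.
Hypothesis S_supp : forall x, x \notin S -> mu x = 0.

Lemma lattice_admissible x : exists n, 0 < mass mu S n x.
Proof.
have [mu_ge0 _] := prob; have [n] := adm x.
by rewrite (conv_pow_mass mu_ge0 S_uniq S_supp) lte_fin => h; exists n.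
Qed.

(** For d > 0 an admissible mu charges some y0 other than the identity; by symmetry, the walk can
    step to y0 and straight back, a first return at time 2. *)
Lemma lattice_hit2 : \sum_(y <- S) mu y = 1 -> (0 < d)%N -> 0 < hit mu S 1 1%g.
Proof.
move=> mu_sum1 d0; have [mu_ge0 _] := prob.
have [y0 y01 my0] : exists2 y, y != 1%g & 0 < mu y.
  apply: contrapT => h.
  have z y : y != 1%g -> mu y = 0.
    move=> y1; apply/eqP; rewrite eq_le mu_ge0 andbT leNgt; apply/negP => my.
    by apply: h; exists y.
  have [n] := lattice_admissible (unit_vec (Ordinal d0)).
  have stepE f x : step mu S f x = f x.
    rewrite /step -[RHS]mul1r -mu_sum1 mulr_suml; apply: eq_bigr => y _.
    by have [->|/z ->] := eqVneq y 1%g; rewrite ?mul0r// invg1 mul1g.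
  have -> : mass mu S n = dirac1.
    by rewrite /mass; elim: n => //= n ->; apply/funext => x; exact: stepE.
  by rewrite /dirac1 (negPf (unit_vec_neq1 _)) ltxx.
have y0S : y0 \in S by apply: contraTT my0 => /S_supp ->; rewrite ltxx.
have m1 : hit mu S 0 = mu by apply/funext => x; exact: (mu_mass1 S_uniq S_supp).
have -> : hit mu S 1 1%g = taboo mu S (hit mu S 0) 1%g by [].
rewrite m1 /taboo /step (bigD1_seq y0)//= ltr_pwDl//.
  by rewrite mulg1 invg_eq1 y01 mul1r -sym mulr_gt0.
by apply: sumr_ge0 => y _; rewrite !mulr_ge0// ler0n.
Qed.

End LatticeWalk.

Theorem theorem1p1 (R : realType) (d : nat) (hd : d = 5%N \/ d = 6%N)
    (mu1 : Zpow 3 -> R) (mu2 : Zpow d -> R)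
    (prob1 : is_probability mu1) (prob2 : is_probability mu2)
    (fin1 : finitely_supported mu1) (fin2 : finitely_supported mu2)
    (adm1 : admissible mu1) (adm2 : admissible mu2)
    (sym1 : is_symmetric mu1) (sym2 : is_symmetric mu2) :
  exists alpha : R,
    [/\ (0 < alpha < 1)%R,
        divergent (mix alpha mu1 mu2)
      & ~ spectrally_positive_recurrent (mix alpha mu1 mu2)].
Proof.
have [ge1 _] := prob1; have [ge2 _] := prob2.
have [S1 [uS1 supp1 sum1 inv1]] := lattice_support prob1 fin1 sym1.
have [S2 [uS2 supp2 sum2 inv2]] := lattice_support prob2 fin2 sym2.
(* The lower bound on d yields the finite mean, the upper bound the infinite second moment. *)
have d5 : (5 <= d)%N by case: hd => ->.
have d6 : (d <= 3.*2)%N by case: hd => ->.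
have psym1 := lattice_mass_sym sym1 inv1; have psym2 := lattice_mass_sym sym2 inv2.
have adm1' := lattice_admissible prob1 adm1 uS1 supp1.
have adm2' := lattice_admissible prob2 adm2 uS2 supp2.
have [M1 tr1] := lattice_transient ge1 sum1 adm1' psym1 (leqnn 3).
have [M2 tr2] := lattice_transient ge2 sum2 adm2' psym2 (leq_trans (isT : 3 <= 5)%N d5).
have [b2 mean2] := lattice_mean_mass ge2 sum2 adm2' psym2 d5.
have mean1 b : ~ (forall N, \sum_(n < N) n%:R * mass mu1 S1 n 1%g <= b)%R.
  exact: (@mass_moment_unbounded _ _ _ _ ge1 sum1 sym1 inv1 2).
have second2 b : ~ (forall N, \sum_(n < N) n%:R ^+ 2 * mass mu2 S2 n 1%g <= b)%R.
  exact: (@mass_moment_unbounded _ _ _ _ ge2 sum2 sym2 inv2 3).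
have hit2 := lattice_hit2 prob2 adm2 sym2 uS2 supp2 sum2 (leq_trans (isT : 0 < 5)%N d5).
exact: (free_product_critical ge1 ge2 uS1 uS2 supp1 supp2 sum1 sum2 tr1 tr2 mean1
  (ex_intro _ b2 (fun N => mean2 N 1%g)) second2 hit2).
Qed.
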